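(* Let $l\ge 1$ and let $\mathfrak g_l$ be the complex simple Lie algebra of type $A_l$. Let $(f_\lambda)_{\lambda\in\Lambda^+}$ be a family of elements of $\mathbb Z[\Lambda]^W$ of the form $$f_\lambda=\sum_{\mu\in\Pi^+(\lambda)}n_\lambda(\mu)\,h(\mu)=\sum_{x\in\Pi(\lambda)}n_\lambda(x)\,e(x),\qquad n_\lambda(x)\in\mathbb Z,\quad n_\lambda(\lambda)=1,\quad n_\lambda(x)=0 \text{ if } x\notin\Pi(\lambda).$$ Such a family is a $\mathbb Z$-basis of $\mathbb Z[\Lambda]^W$. For $\mu,\nu\in\Lambda^+$ let $n_{\mu,\nu}^{\lambda}$ be the unique integers with $$f_\mu * f_\nu=\sum_{\lambda\in\Pi^+(\mu+\nu)}n_{\mu,\nu}^{\lambda}\,f_\lambda ,$$ and put $n_{\mu,\nu}^\lambda=0$ for $\lambda\in\Lambda^+\setminus\Pi^+(\mu+\nu)$. Suppose that: (1) for all $\lambda\in\Lambda^+$ and $\mu\in\Pi^+(\lambda)$ such that $\beta=\lambda-\mu$ satisfies $|\mathrm{Supp}(\beta)|<l$, one has $n_\lambda(\mu)=m_\lambda(\mu)$; (2) for all $\lambda,\mu,\nu\in\Lambda^+$, one has $n_{\mu,\nu}^{\lambda}=n_{\lambda,\,-w_0\nu}^{\mu}$. Then $f_\lambda=\mathrm{ch}_\lambda$ for all $\lambda\in\Lambda^+$, and $n_{\mu,\nu}^{\lambda}=c_{\mu,\nu}^{\lambda}$ for all $\lambda,\mu,\nu\in\Lambda^+$.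
   Context: $\Delta=\{\alpha_1,\dots,\alpha_l\}$ is the set of simple roots of $\mathfrak g_l$ (type $A_l$), $\Lambda$ the weight lattice, $\omega_1,\dots,\omega_l$ the fundamental dominant weights, $\Lambda^+$ the set of dominant (integral) weights, $W$ the Weyl group, and $w_0$ its longest element. $\mathbb Z[\Lambda]$ is the group ring with $\mathbb Z$-basis $\{e(\lambda):\lambda\in\Lambda\}$ and multiplication $e(\lambda)*e(\mu)=e(\lambda+\mu)$; $W$ acts by $\sigma e(\lambda)=e(\sigma\lambda)$, and $\mathbb Z[\Lambda]^W$ is the ring of $W$-invariants. For a weight $\lambda$, $h(\lambda)=\sum_{x\in W\lambda}e(x)$ is the sum over the $W$-orbit of $\lambda$. For $\lambda\in\Lambda^+$, $\Pi(\lambda)$ is the saturated set of weights with highest weight $\lambda$ (i.e. the set of weights of $V(\lambda)$; equivalently all $x\in\Lambda$ whose dominant $W$-conjugate $x^+$ satisfies $\lambda-x^+\in\sum_i\mathbb Z_{\ge0}\alpha_i$), and $\Pi^+(\lambda)=\Pi(\lambda)\cap\Lambda^+$. For $\beta=\sum_{i=1}^l k_i\alpha_i$, $\mathrm{Supp}(\beta)=\{\alpha_i : k_i\ne0\}$. $V(\lambda)$ is the Weyl module (the finite-dimensional irreducible $\mathfrak g_l$-module of highest weight $\lambda\in\Lambda^+$), $m_\lambda(x)$ is the multiplicity of the weight $x$ in $V(\lambda)$, and $\mathrm{ch}_\lambda=\sum_{x\in\Pi(\lambda)}m_\lambda(x)e(x)$ is its formal character. $c_{\mu,\nu}^{\lambda}$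 is the Littlewood–Richardson coefficient, i.e. the multiplicity of $V(\lambda)$ in $V(\mu)\otimes V(\nu)$. *)

(* Defs.v *)
From mathcomp Require Import all_boot all_order all_algebra all_fingroup ring.
From mathcomp Require Import finmap boolp classical_sets fsbigop.
From mathcomp Require Import mxtens.
From mathcomp.multinomials Require Import monalg.

Set Implicit Arguments.
Unset Strict Implicit.
Unset Printing Implicit Defensive.

Import GRing.Theory.

Local Open Scope classical_set_scope.
Local Open Scope ring_scope.

(* The weight lattice of type A_l, in coordinates with respect to the
   fundamental weights: lam stands for \sum_i (lam 0 i) omega_i. *)
Notation weight l := 'rV[int]_l.

Section Weights.
Variable l : nat.
Implicit Types (lam mu x : weight l) (s : 'S_l.+1).

Definition dominant lam : Prop := forall i : 'I_l, 0 <= lam 0 i.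

Definition cartanA (i j : 'I_l) : int :=
  if i == j then 2 else if (i.+1 == j) || (j.+1 == i) then -1 else 0.

Definition sroot (i : 'I_l) : weight l := \row_j cartanA i j.

Definition lo (i : 'I_l) : 'I_l.+1 := widen_ord (leqnSn l) i.
Definition hi (i : 'I_l) : 'I_l.+1 := lift ord0 i.

(* Coordinates of lam in the basis eps_0, ..., eps_l, where
   omega_j = eps_0 + ... + eps_j modulo eps_0 + ... + eps_l. *)
Definition epscoord lam (k : 'I_l.+1) : int :=
  \sum_(j < l | (k <= j)%N) lam 0 j.

(* The Weyl group is the symmetric group, s sending eps_k to eps_(s k);
   see weyl_act_sreflection. Since permutations compose from left to right,
   weyl_act (s * t) lam = weyl_act t (weyl_act s lam). *)
Definition weyl_act s lam : weight l :=
  \row_i (epscoord lam ((s^-1)%g (lo i)) - epscoord lam ((s^-1)%g (hi i))).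

(* The number of positive roots eps_i - eps_j (i < j) that s makes negative. *)
Definition weyl_length s : nat :=
  #|[set p : 'I_l.+1 * 'I_l.+1 | (p.1 < p.2)%N && (s p.2 < s p.1)%N]|.

Definition longest : 'S_l.+1 := [arg max_(s > 1%g) weyl_length s]%N.

Definition weyl_orbit lam : set (weight l) :=
  [set x | exists s, x = weyl_act s lam].

Definition root_le mu lam : Prop :=
  exists k : 'I_l -> nat, lam - mu = \sum_i sroot i *+ k i.

Definition Pi lam : set (weight l) :=
  [set x | exists y, [/\ dominant y, weyl_orbit x y & root_le y lam]].

Definition PiPlus lam : set (weight l) := Pi lam `&` dominant.

Definition Supp (k : 'I_l -> int) : {set 'I_l} := [set i | k i != 0]%SET.

Lemma epscoord_lohi lam i : epscoord lam (lo i) - epscoord lam (hi i) = lam 0 i.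
Proof.
rewrite /epscoord (bigD1 i) //= -addrA [X in _ + X](_ : _ = 0) ?addr0 //.
apply/eqP; rewrite subr_eq0; apply/eqP; apply: eq_bigl => j.
by rewrite /bump /= add1n ltn_neqAle andbC eq_sym.
Qed.

Lemma weyl_act_sreflection i lam :
  weyl_act (tperm (lo i) (hi i)) lam = lam - lam 0 i *: sroot i.
Proof.
have lh j : (lo j : nat) = j by [].
have hh j : (hi j : nat) = j.+1 by [].
have inj k m : (k == m :> 'I_l.+1) = (k == m :> nat) by [].
have e (k m : 'I_l.+1) : k = m :> nat -> epscoord lam k = epscoord lam m.
  by move=> /val_inj ->.
have E j := epscoord_lohi lam j.
apply/rowP => j; rewrite !mxE tpermV /cartanA.
rewrite -(inj_eq val_inj) /=.
case: (ltngtP i j) => [ij|ji|/val_inj <-].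
- rewrite [tperm _ _ (hi j)]tpermD; first last.
  + by rewrite inj !hh eqSS neq_ltn ij.
  + by rewrite inj hh lh neq_ltn ltnS (ltnW ij).
  case: (eqVneq i.+1 j) => [sij|nsij] /=.
    have -> : lo j = hi i by apply: val_inj; rewrite /= /bump /= -sij.
    rewrite tpermR -(E i) -(E j) (e (lo j) (hi i)) ?hh ?lh //.
    by rewrite mulrN1 opprK addrC addrA subrK.
  rewrite tpermD; first last.
  + by rewrite inj hh lh.
  + by rewrite inj !lh neq_ltn ij.
  by rewrite E gtn_eqF ?mulr0 ?subr0 // (ltn_trans ij).
- rewrite [tperm _ _ (lo j)]tpermD; first last.
  + by rewrite inj hh lh neq_ltn ltnS (ltnW ji) orbT.
  + by rewrite inj !lh neq_ltn ji orbT.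
  rewrite gtn_eqF ?(ltn_trans ji) //=.
  case: (eqVneq j.+1 i) => [sji|nsji] /=.
    have -> : hi j = lo i by apply: val_inj; rewrite /= /bump /= -sji.
    rewrite tpermL -(E i) -(E j) (e (hi j) (lo i)) ?hh ?lh //.
    by rewrite mulrN1 opprK addrA subrK.
  rewrite tpermD; first last.
  + by rewrite inj !hh eqSS neq_ltn ji orbT.
  + by rewrite inj hh lh eq_sym.
  by rewrite E mulr0 subr0.
- rewrite tpermL tpermR -(E i) /= mulr_natr mulr2n.
  by rewrite opprD addrA subrr add0r opprB.
Qed.

End Weights.

(* The group ring Z[Lambda]. Its multiplication is not provided by the library,
   which makes {malg G[K]} a ring only when no element of K but the unit is
   invertible. *)
Notation gring l := {malg int[weight l]}.

Section GroupRing.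
Variable l : nat.
Implicit Types (lam mu x : weight l) (g : gring l).

Definition ebasis x : gring l := mkmalgU x 1.

Definition gmul g1 g2 : gring l :=
  \sum_(x <- msupp g1) \sum_(y <- msupp g2)
    (g1@_x * g2@_y) *: ebasis (x + y).

Definition gweyl (s : 'S_l.+1) g : gring l :=
  \sum_(x <- msupp g) g@_x *: ebasis (weyl_act s x).

Definition invariant g : Prop := forall s, gweyl s g = g.

Definition orbit_sum lam : gring l := \sum_(x \in weyl_orbit lam) ebasis x.

(* n_lam(x) is the coefficient (f lam)@_x; the values of f at non-dominant
   weights are irrelevant. *)
Definition adapted_family (f : weight l -> gring l) : Prop :=
  forall lam, dominant lam ->
    [/\ invariant (f lam),
        f lam = \sum_(mu \in PiPlus lam) (f lam)@_mu *: orbit_sum mu,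
        f lam = \sum_(x \in Pi lam) (f lam)@_x *: ebasis x,
        (f lam)@_lam = 1 &
        forall x, ~ Pi lam x -> (f lam)@_x = 0].

Definition invariant_basis (f : weight l -> gring l) : Prop :=
  (forall lam, dominant lam -> invariant (f lam)) /\
  forall g, invariant g ->
    exists! c : gring l,
      (forall lam, c@_lam != 0 -> dominant lam) /\
      g = \sum_(lam <- msupp c) c@_lam *: f lam.

Definition product_coefs (f : weight l -> gring l) mu nu
    (c : weight l -> int) : Prop :=
  gmul (f mu) (f nu) = \sum_(lam \in PiPlus (mu + nu)) c lam *: f lam /\
  forall lam, ~ PiPlus (mu + nu) lam -> c lam = 0.

End GroupRing.

(* Finite-dimensional modules over sl_(l+1)(F), that is, Lie algebra
   homomorphisms to gl_d(F) acting on column vectors; the values of slact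
   outside the trace-zero matrices are irrelevant. *)
Section Modules.
Variables (F : fieldType) (l : nat).

Record slrep := SlRep {
  sldim : nat;
  slact :> 'M[F]_l.+1 -> 'M[F]_sldim;
  slact_linear : forall a x y, \tr x = 0 -> \tr y = 0 ->
    slact (a *: x + y) = a *: slact x + slact y;
  slact_bracket : forall x y, \tr x = 0 -> \tr y = 0 ->
    slact (x *m y - y *m x) = slact x *m slact y - slact y *m slact x
}.

Definition slhom (M N : slrep) (P : 'M[F]_(sldim N, sldim M)) : Prop :=
  forall x, \tr x = 0 -> P *m M x = N x *m P.

Definition sliso (M N : slrep) : Prop :=
  exists2 P : 'M[F]_(sldim N, sldim M), slhom P & row_free P && row_full P.

(* Matrix subspaces are row spaces, whence the transpositions below. *)
Definition slirr (M : slrep) : Prop :=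
  (0 < sldim M)%N /\
  forall U : 'M[F]_(sldim M),
    (forall x, \tr x = 0 -> stablemx U (M x)^T) -> U != 0 -> row_full U.

Definition coroot (i : 'I_l) : 'M[F]_l.+1 :=
  delta_mx (lo i) (lo i) - delta_mx (hi i) (hi i).

Definition weight_space (M : slrep) (x : weight l) : 'M[F]_(sldim M) :=
  (\bigcap_(i < l) eigenspace (M (coroot i))^T (x 0 i)%:~R)%MS.

Definition weight_mult (M : slrep) (x : weight l) : nat :=
  \rank (weight_space M x).

Definition highest_weight (M : slrep) (lam : weight l) : Prop :=
  exists v : 'cV[F]_(sldim M),
    [/\ v != 0,
        forall i j : 'I_l.+1, (i < j)%N -> M (delta_mx i j) *m v = 0 &
        forall i : 'I_l, M (coroot i) *m v = (lam 0 i)%:~R *: v].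

Definition is_weyl_module (lam : weight l) (M : slrep) : Prop :=
  slirr M /\ highest_weight M lam.

Definition slch (lam : weight l) (M : slrep) : gring l :=
  \sum_(x \in Pi lam) (weight_mult M x)%:Z *: ebasis x.

Section Tensor.
Variables M N : slrep.

Definition tens_act (x : 'M[F]_l.+1) : 'M[F]_(sldim M * sldim N) :=
  M x *t 1%:M + 1%:M *t N x.

Lemma tens_act_linear a x y : \tr x = 0 -> \tr y = 0 ->
  tens_act (a *: x + y) = a *: tens_act x + tens_act y.
Proof.
move=> x0 y0; rewrite /tens_act !slact_linear //.
by apply/matrixP => i j; rewrite !mxE; ring.
Qed.

Lemma tens_act_bracket x y : \tr x = 0 -> \tr y = 0 ->
  tens_act (x *m y - y *m x)
    = tens_act x *m tens_act y - tens_act y *m tens_act x.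
Proof.
move=> x0 y0; rewrite /tens_act !slact_bracket //.
rewrite !mulmxDl !mulmxDr !tensmx_mul !mulmx1 !mul1mx.
by apply/matrixP => i j; rewrite !mxE; ring.
Qed.

Definition sltens : slrep := SlRep tens_act_linear tens_act_bracket.

End Tensor.

(* M is the direct sum of the images of the irreducible modules S i under the
   P i, and exactly c of the S i are isomorphic to L. *)
Definition is_multiplicity (L M : slrep) (c : nat) : Prop :=
  exists (k : nat) (S : 'I_k -> slrep)
         (P : forall i, 'M[F]_(sldim M, sldim (S i))),
    [/\ forall i, slirr (S i),
        forall i, slhom (P i),
        row_free (\mxrow_i P i) && row_full (\mxrow_i P i) &
        #|[set i | `[< sliso (S i) L >]]%SET| = c].

End Modules.

(* Main.v *)
Require Import Defs.
From mathcomp Require Import all_boot all_order all_algebra all_fingroup.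
From mathcomp Require Import finmap boolp classical_sets cardinality fsbigop reals.
From mathcomp Require Import complex mxtens zify ring.
From mathcomp.multinomials Require Import monalg.

Set Implicit Arguments.
Unset Strict Implicit.
Unset Printing Implicit Defensive.

Import Order.TTheory GRing.Theory Num.Theory.

Local Open Scope classical_set_scope.
Local Open Scope ring_scope.

(** The first two claims express triangularity: [f lam] is [orbit_sum lam] plus
    multiples of orbit sums of smaller dominant weights, so an invariant is expanded by
    clearing its highest dominant terms ([invariant_expand]), and a linear
    relation among the [f lam] fails at a weight of greatest height
    ([lincomb_inj]).

    For the last claim, the family of Weyl characters is itself unitriangular,
    and its structure constants, the Littlewood-Richardson coefficients [c], have
    the symmetry assumed of [n]. It remains to see that two unitriangular
    families [f] and [g] with this symmetry coincide when they agree on all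
    pairs [(lam, mu)] such that [lam - mu] misses a simple root
    ([structure_constants_determine]). The coefficients of [f mu * f nu] at
    weights [z] for which [mu + nu - z] misses a simple root only involve
    coefficients of [f mu] and [f nu] of the same kind. Hence [n mu nu lam] and
    [c mu nu lam] agree when [mu + nu - lam] misses a simple root
    ([partial_support_coef]). Now let [nu] be a fundamental weight [omega i]. Where
    the coefficients do not vanish, the differences [beta = mu + omega i - lam]
    and [beta' = lam - w0 (omega i) - mu] are sums of simple roots. They add up to
    [omega i - w0 (omega i)], in which the first simple root has coefficient one.
    So one of [beta] and [beta'] misses that root, and the symmetry exchanges the
    two: the Pieri coefficients agree for all [mu] and [lam] ([pieri_coef]). A
    nonzero dominant weight has the form [mu + omega i], and the expansion of
    [f mu * f (omega i)] then determines [f (mu + omega i)] by induction on the height.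

    The facts about modules are proved from first principles. Irreducible modules
    have a highest weight vector, from which lowering operators generate a basis
    of weight vectors ([highest_vec_exists], [irr_weight_basis]); two with the
    same highest weight are isomorphic ([highest_vec_iso]); and weight
    multiplicities are invariant under the Weyl group ([weight_mult_weyl]).
    Semisimplicity of tensor products comes from unitarity. Tensor powers of the
    natural module are compatible with conjugate transposition, and the vectors
    of minors in them have the fundamental weights ([minor_highest_vec]); so each
    Weyl module embeds in such a tensor product, and orthogonal complements
    decompose all submodules ([unitarizable_decomposition]). Finally, contraction
    turns independent homomorphisms from [L] to the tensor product of [A] and [B]
    into independent homomorphisms from the tensor product of [L] and the dual of
    [B] to [A], and by Schur's lemma this compares multiplicities
    ([multiplicity_le]). *)

(** * The weight lattice in epsilon coordinates *)

Section Lattice.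
Variable l : nat.
Implicit Types (x y z lam mu nu : weight l) (s t : 'S_l.+1) (b : 'I_l.+1 -> int).

(** The class of [b] modulo constant functions. On this quotient the Weyl group
    permutes coordinates, whereas [epscoord] picks the representative that
    vanishes at the last index. *)
Definition of_eps b : weight l := \row_i (b (lo i) - b (hi i)).

Lemma epscoordK lam : of_eps (epscoord lam) = lam.
Proof. by apply/rowP => i; rewrite mxE epscoord_lohi. Qed.

Lemma epscoord_of_eps b k : epscoord (of_eps b) k = b k - b ord_max.
Proof.
rewrite /epscoord.
have -> : \sum_(j < l | (k <= j)%N) of_eps b 0 j =
          \sum_(k <= j < l) (b (inord j) - b (inord j.+1)).
  rewrite big_geq_mkord; apply: eq_bigr => j _; rewrite mxE; congr (b _ - b _);
  by apply: val_inj; rewrite /= inordK ?ltnS ?(ltnW (ltn_ord j)) ?ltn_ord.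
have kl : (k <= l)%N by rewrite -ltnS.
have := telescope_sumr (fun j => - b (inord j)) kl.
rewrite (eq_bigr (fun j => b (inord j) - b (inord j.+1))); last first.
  by move=> j _; rewrite opprK addrC.
move=> ->; rewrite opprK addrC inord_val.
by congr (_ - b _); apply: val_inj; rewrite /= inordK.
Qed.

Lemma weyl_act_of_eps s b : weyl_act s (of_eps b) = of_eps (fun k => b (s^-1 k)%g).
Proof.
by apply/rowP => i; rewrite !mxE !epscoord_of_eps opprB addrA subrK.
Qed.

Lemma weyl_act1 x : weyl_act 1 x = x.
Proof. by rewrite -[x]epscoordK weyl_act_of_eps; apply/rowP => i;
  rewrite !mxE invg1 !perm1. Qed.

Lemma weyl_actM s t x : weyl_act s (weyl_act t x) = weyl_act (t * s)%g x.
Proof.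
rewrite -[x]epscoordK !weyl_act_of_eps; apply/rowP => i.
by rewrite !mxE invMg !permM.
Qed.

Lemma weyl_actK s : cancel (@weyl_act l s) (weyl_act s^-1%g).
Proof. by move=> x; rewrite weyl_actM mulgV weyl_act1. Qed.

Lemma weyl_actKV s : cancel (@weyl_act l s^-1%g) (weyl_act s).
Proof. by move=> x; rewrite weyl_actM mulVg weyl_act1. Qed.

Lemma epscoordD x y k : epscoord (x + y) k = epscoord x k + epscoord y k.
Proof. by rewrite /epscoord -big_split; apply: eq_bigr => i _; rewrite mxE. Qed.

Lemma epscoordN x k : epscoord (- x) k = - epscoord x k.
Proof. by rewrite /epscoord -sumrN; apply: eq_bigr => i _; rewrite mxE. Qed.

Lemma weyl_actD s x y : weyl_act s (x + y) = weyl_act s x + weyl_act s y.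
Proof. by apply/rowP => i; rewrite !mxE !epscoordD; ring. Qed.

Lemma weyl_actN s x : weyl_act s (- x) = - weyl_act s x.
Proof. by apply/rowP => i; rewrite !mxE !epscoordN; ring. Qed.

(** A row of the Cartan matrix is a second difference; the boundary values turn
    the truncated rows at both ends into ordinary ones. *)
Lemma cartanA_sum (F : nat -> int) (j : 'I_l) : F 0%N = 0 -> F l.+1 = 0 ->
  \sum_m cartanA j m * F m.+1 = 2 * F j.+1 - F j - F j.+2.
Proof.
move=> F0 Fl.
have E (m : 'I_l) : cartanA j m * F m.+1 =
    (if m == j then 2 * F j.+1 else 0) - (if m.+1 == j then F j else 0)
    - (if m == j.+1 :> nat then F j.+2 else 0).
  rewrite /cartanA [j == m]eq_sym [m == j.+1 :> nat]eq_sym -val_eqE /=.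
  case: (ltngtP m j) => [mj|jm|->].
  - rewrite [j.+1 == m]gtn_eqF ?(ltn_trans mj) //= sub0r subr0.
    by case: eqP => [<-|_]; rewrite ?mulN1r ?mul0r ?oppr0.
  - rewrite [m.+1 == j]gtn_eqF ?(ltn_trans jm) //= orbF subr0 sub0r.
    by case: eqP => [<-|_]; rewrite ?mulN1r ?mul0r ?oppr0.
  - by rewrite !gtn_eqF // !subr0.
rewrite (eq_bigr _ (fun m _ => E m)) !sumrB -!big_mkcond big_pred1_eq /=.
congr (_ - _ - _).
- case jE : (nat_of_ord j) => [|j'] /=; first by rewrite big_pred0.
  have lt : (j' < l)%N by rewrite (leq_trans _ (ltn_ord j)) // jE.
  by rewrite (big_pred1 (Ordinal lt)).
- case: (ltnP j.+1 l) => lt; first by rewrite (big_pred1 (Ordinal lt)).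
  rewrite big_pred0; first by have -> : j.+2 = l.+1 by have := ltn_ord j; lia.
  by move=> m; apply/negbTE; rewrite neq_ltn (leq_trans (ltn_ord m) lt).
Qed.

Lemma cartanA_sym (i j : 'I_l) : cartanA i j = cartanA j i.
Proof. by rewrite /cartanA eq_sym orbC. Qed.

(** Abel summation: since [sroot i] is the class of [eps_i - eps_(i+1)], the
    coefficients are the partial sums of [b]. *)
Lemma of_eps_sroot b : \sum_k b k = 0 ->
  of_eps b = \sum_(i < l) (\sum_(k < l.+1 | (k <= i)%N) b k) *: sroot i.
Proof.
move=> b0; apply/rowP => j; rewrite summxE mxE.
pose F m : int := \sum_(k < l.+1 | (k < m)%N) b k.
have F0 : F 0%N = 0 by rewrite /F big_pred0.
have Fl : F l.+1 = 0 by rewrite -[RHS]b0; apply: eq_bigl => k; rewrite ltn_ord.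
have FS (k : 'I_l.+1) : F k.+1 = F k + b k.
  rewrite /F (bigD1 k) //= addrC; congr (_ + _); apply: eq_bigl => i.
  by rewrite ltnS andbC -ltn_neqAle.
transitivity (\sum_m cartanA j m * F m.+1); last first.
  by apply: eq_bigr => m _; rewrite !mxE cartanA_sym mulrC.
have hj : hi j = j.+1 :> nat by [].
have lj : lo j = j :> nat by [].
rewrite cartanA_sum //.
by have := FS (lo j); have := FS (hi j); rewrite hj lj; lia.
Qed.

(** The pairing with the sum of the positive coroots. It is integral on all
    weights, positive on fundamental weights and equal to 2 on simple roots, and
    so serves as a measure for inductions on weights. *)
Definition height x : int := \sum_(j < l) x 0 j * (j.+1 * (l - j))%:Z.

(** [l.+1] times the coefficient of the simple root [i]: the factor clears the
    denominators of the inverse Cartan matrix, so that supports can be read off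
    by an integral linear form on all weights. *)
Definition rootcoef (i : 'I_l) x : int :=
  \sum_(j < l) x 0 j * ((minn i j).+1 * (l - maxn i j))%:Z.

Lemma heightD x y : height (x + y) = height x + height y.
Proof. by rewrite /height -big_split; apply: eq_bigr => i _; rewrite mxE mulrDl. Qed.
Lemma heightN x : height (- x) = - height x.
Proof. by rewrite /height -sumrN; apply: eq_bigr => i _; rewrite mxE mulNr. Qed.
Lemma heightZ a x : height (a *: x) = a * height x.
Proof. by rewrite /height mulr_sumr; apply: eq_bigr => i _; rewrite mxE mulrA. Qed.
Lemma height_sroot i : height (sroot i) = 2.
Proof.
rewrite /height; pose F m : int := m%:Z * (l.+1%:Z - m%:Z).
rewrite (eq_bigr (fun m : 'I_l => cartanA i m * F m.+1)); last first.
  by move=> m _; rewrite mxE /F; congr (_ * _); have := ltn_ord m; nia.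
by rewrite cartanA_sum /F; first nia; rewrite ?mul0r // subrr mulr0.
Qed.

Lemma rootcoefD i x y : rootcoef i (x + y) = rootcoef i x + rootcoef i y.
Proof. by rewrite /rootcoef -big_split; apply: eq_bigr => j _; rewrite mxE mulrDl. Qed.
Lemma rootcoefN i x : rootcoef i (- x) = - rootcoef i x.
Proof. by rewrite /rootcoef -sumrN; apply: eq_bigr => j _; rewrite mxE mulNr. Qed.
Lemma rootcoefB i x y : rootcoef i (x - y) = rootcoef i x - rootcoef i y.
Proof. by rewrite rootcoefD rootcoefN. Qed.
Lemma rootcoefZ i a x : rootcoef i (a *: x) = a * rootcoef i x.
Proof. by rewrite /rootcoef mulr_sumr; apply: eq_bigr => j _; rewrite mxE mulrA. Qed.
Lemma rootcoef_sroot i j : rootcoef i (sroot j) = if i == j then l.+1%:Z else 0.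
Proof.
rewrite /rootcoef; pose F m : int :=
  if (m <= i)%N then m%:Z * (l%:Z - i%:Z) else i.+1%:Z * (l.+1%:Z - m%:Z).
rewrite (eq_bigr (fun m : 'I_l => cartanA j m * F m.+1)); last first.
  move=> m _; rewrite mxE /F; congr (_ * _); have ml := ltn_ord m; have il := ltn_ord i.
  by case: (ltnP m i) => h; nia.
rewrite cartanA_sum /F; last 2 first.
- by rewrite mul0r.
- by rewrite subrr mulr0 ifN // -ltnNge ltnS ltnW.
rewrite -val_eqE /=; have jl := ltn_ord j; have il := ltn_ord i.
by case: (ltngtP i j) => h; case: (leqP j.+1 i) => h1; case: (leqP j i) => h2;
  case: (leqP j.+2 i) => h3; nia.
Qed.

End Lattice.

(** * The root order and dominant weights *)

Section RootOrder.
Variable l : nat.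
Implicit Types (x y z lam mu nu : weight l) (s t : 'S_l.+1).

Lemma height_sum (k : 'I_l -> nat) :
  height (\sum_i sroot i *+ k i) = 2 * (\sum_i k i)%:Z.
Proof.
rewrite (big_morph _ (@heightD l) (id1 := 0)); last first.
  by rewrite -(subrr 0) heightD heightN subrr.
rewrite -natz natr_sum mulr_sumr; apply: eq_bigr => i _.
by rewrite -scaler_nat heightZ height_sroot mulrC.
Qed.

Lemma rootcoef_sum i (k : 'I_l -> nat) :
  rootcoef i (\sum_i sroot i *+ k i) = (l.+1 * k i)%:Z.
Proof.
rewrite (big_morph _ (@rootcoefD l i) (id1 := 0)); last first.
  by rewrite -(subrr 0) rootcoefD rootcoefN subrr.
rewrite (bigD1 i) //= big1 ?addr0 => [|j ji];
  rewrite -scaler_nat rootcoefZ rootcoef_sroot.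
  by rewrite eqxx; lia.
by rewrite eq_sym (negbTE ji) mulr0.
Qed.

Lemma root_le_refl x : root_le x x.
Proof.
by exists (fun=> 0%N); rewrite subrr big1 // => i _; rewrite mulr0n.
Qed.

Lemma root_le_trans y x z : root_le x y -> root_le y z -> root_le x z.
Proof.
move=> [k xy] [k' yz]; exists (fun i => k' i + k i)%N.
rewrite -[z](subrK y) -addrA xy yz -big_split.
by apply: eq_bigr => i _; rewrite mulrnDr.
Qed.

Lemma root_leD x y x' y' : root_le x y -> root_le x' y' -> root_le (x + x') (y + y').
Proof.
move=> [k xy] [k' xy']; exists (fun i => k i + k' i)%N.
rewrite opprD addrACA xy xy' -big_split.
by apply: eq_bigr => i _; rewrite mulrnDr.
Qed.

Lemma root_le_height x y : root_le x y -> height x <= height y ?= iff (x == y).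
Proof.
move=> [k xy]; have := congr1 (@height l) xy.
rewrite heightD heightN height_sum => H; split; first by lia.
apply/eqP/eqP => [e|->//]; have : (\sum_i k i == 0)%N by lia.
rewrite sum_nat_eq0 => /forallP k0.
move: xy; rewrite big1 => [/eqP|i _]; first by rewrite subr_eq0 => /eqP.
by move/(_ i): k0 => /implyP/(_ isT)/eqP->; rewrite mulr0n.
Qed.

Lemma root_le_anti x y : root_le x y -> root_le y x -> x = y.
Proof.
move=> /root_le_height[xy e] /root_le_height[yx _]; apply/eqP.
by rewrite -e eq_le xy yx.
Qed.

Lemma root_le_rootcoef i x y : root_le x y -> rootcoef i x <= rootcoef i y.
Proof.
move=> [k xy]; have := congr1 (rootcoef i) xy.
by rewrite rootcoefD rootcoefN rootcoef_sum; lia.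
Qed.

Lemma dominant_height x : dominant x -> 0 <= height x.
Proof. by move=> dx; apply: sumr_ge0 => i _; rewrite mulr_ge0. Qed.

Lemma dominantD x y : dominant x -> dominant y -> dominant (x + y).
Proof. by move=> dx dy i; rewrite mxE addr_ge0. Qed.

(** The coefficient of the simple root [i] in [y - s y] is the sum of the first
    [i.+1] epsilon coordinates of [y] minus a sum of equally many of its
    coordinates; for dominant [y] the coordinates decrease, and the first ones are the
    largest. *)
Lemma dominant_weyl_le s y : dominant y -> root_le (weyl_act s y) y.
Proof.
move=> dy; pose b := epscoord y.
have bmono (j k : 'I_l.+1) : (j <= k)%N -> b k <= b j.
  move=> jk; rewrite /b /epscoord [leRHS](bigID (fun i : 'I_l => (k <= i)%N)) /=.
  rewrite [X in _ <= X + _](eq_bigl (fun i : 'I_l => (k <= i)%N)).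
    by rewrite lerDl sumr_ge0.
  by move=> i; case: (leqP k i) => ki; rewrite ?andbF // andbT (leq_trans jk).
have sh (c : 'I_l.+1 -> int) : \sum_k c k = \sum_k c (s^-1 k)%g.
  by rewrite (reindex_inj (@perm_inj _ s^-1%g)).
pose d k := b k - b (s^-1 k)%g.
have d0 : \sum_k d k = 0 by rewrite sumrB -sh subrr.
have yE : y - weyl_act s y = of_eps d.
  rewrite -[y]epscoordK weyl_act_of_eps; apply/rowP => i.
  by rewrite !mxE /d /b; ring.
have dge0 (i : 'I_l) : 0 <= \sum_(k < l.+1 | (k <= i)%N) d k.
  (* Subtracting the coordinate at [i] from all coordinates changes nothing, as
     [chi] and [psi] have the same sum, and makes every term nonnegative. *)
  pose chi (k : 'I_l.+1) : int := (k <= i)%N%:R; pose psi k := chi (s k).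
  have -> : \sum_(k < l.+1 | (k <= i)%N) d k = \sum_k (chi k - psi k) * (b k - b (lo i)).
    have -> : \sum_k (chi k - psi k) * (b k - b (lo i)) =
        \sum_k (chi k * b k) - \sum_k (psi k * b k)
        - (\sum_k chi k - \sum_k psi k) * b (lo i).
      by rewrite -!sumrB mulr_suml -sumrB; apply: eq_bigr => k _; ring.
    rewrite (_ : \sum_k chi k = \sum_k psi k); last first.
      by rewrite (sh psi); apply: eq_bigr => k _; rewrite /psi permKV.
    rewrite subrr mul0r subr0 (sh (fun k => psi k * b k)) -sumrB big_mkcond.
    apply: eq_bigr => k _; rewrite /psi permKV /chi /d; case: (_ <= _)%N;
      rewrite ?mul1r //.
    by rewrite !mul0r subrr.
  apply: sumr_ge0 => k _; rewrite /psi /chi.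
  case: (leqP k i) => ki; case: (leqP (s k) i) => ski; rewrite ?subrr ?mul0r //.
    by rewrite subr0 mul1r subr_ge0 bmono.
  by rewrite sub0r mulN1r oppr_ge0 subr_le0 bmono // ltnW.
exists (fun i => absz (\sum_(k < l.+1 | (k <= i)%N) d k)).
rewrite yE of_eps_sroot //; apply: eq_bigr => i _.
by rewrite -scaler_nat natz gez0_abs.
Qed.

(** Two dominant conjugates lie below each other. *)
Lemma dominant_conj_unique s y : dominant y -> dominant (weyl_act s y) ->
  weyl_act s y = y.
Proof.
move=> dy dsy; apply: root_le_anti; first exact: dominant_weyl_le.
by have := dominant_weyl_le s^-1%g dsy; rewrite weyl_actK.
Qed.

(** Reflecting at a negative coordinate increases the height, and an orbit is
    finite; the induction counts the conjugates of greater height. *)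
Lemma raising_ind (P : weight l -> Prop) :
    (forall y, dominant y -> P y) ->
    (forall x i, x 0 i < 0 -> P (weyl_act (tperm (lo i) (hi i)) x) -> P x) ->
  forall x, P x.
Proof.
move=> Pdom Prefl x; rewrite -[x]weyl_act1; move: 1%g => u.
pose A u := [set s | height (weyl_act u x) < height (weyl_act s x)]%SET.
have [n le_n] := ubnP #|A u|; elim: n => // n IH in u le_n *.
have [dom|/existsNP [i /negP]] := pselect (dominant (weyl_act u x)); first exact: Pdom.
rewrite -ltNge => xi; apply: (Prefl _ i xi); rewrite weyl_actM.
have H : height (weyl_act u x) < height (weyl_act (u * tperm (lo i) (hi i))%g x).
  rewrite -weyl_actM weyl_act_sreflection heightD heightN heightZ height_sroot; lia.
apply: IH; apply: leq_trans (proper_card _) _; last exact: le_n.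
apply/properP; split; first by apply/fintype.subsetP=> s; rewrite !inE; apply: lt_trans.
by exists (u * tperm (lo i) (hi i))%g; rewrite !inE ?ltxx.
Qed.

Lemma dominant_conj x : exists s, dominant (weyl_act s x).
Proof.
apply: (raising_ind (P :=
  fun x => exists s, dominant (weyl_act s x))) => [y dy|{}x i _ [s ds]].
  by exists 1%g; rewrite weyl_act1.
by exists (tperm (lo i) (hi i) * s)%g; rewrite -weyl_actM.
Qed.

End RootOrder.

(** * Saturated sets and the duality of weights *)

Section Saturated.
Variable l : nat.
Implicit Types (x y z lam mu nu : weight l) (s t : 'S_l.+1).

Lemma Pi_weyl lam s x : Pi lam x -> Pi lam (weyl_act s x).
Proof.
move=> [y [dy [t yx] le]]; exists y; split=> //.
by exists (s^-1 * t)%g; rewrite -weyl_actM weyl_actK.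
Qed.

Lemma Pi_le lam x : Pi lam x -> root_le x lam.
Proof.
move=> [y [dy [s ys] le]]; apply: root_le_trans le.
by rewrite -[x](weyl_actK s) -ys; apply: dominant_weyl_le.
Qed.

Lemma Pi_dominant lam y : dominant y -> root_le y lam -> Pi lam y.
Proof. by move=> dy le; exists y; split=> //; exists 1%g; rewrite weyl_act1. Qed.

Lemma PiPlusP lam y : PiPlus lam y <-> dominant y /\ root_le y lam.
Proof.
split=> [[/Pi_le le dy]|[dy le]] //; split=> //; exact: Pi_dominant.
Qed.

(** The dominant conjugate of [x + y] is a sum of conjugates of [x] and [y],
    which lie below [mu] and [nu]. *)
Lemma PiD mu nu x y : Pi mu x -> Pi nu y -> Pi (mu + nu) (x + y).
Proof.
move=> xmu ynu; have [s ds] := dominant_conj (x + y).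
rewrite -[x + y](weyl_actK s); apply/Pi_weyl/Pi_dominant => //.
by rewrite weyl_actD; apply: root_leD; apply/Pi_le/Pi_weyl.
Qed.

Lemma PiPlus_finite lam : finite_set (PiPlus lam).
Proof.
pose N := absz (height lam).
pose F (k : {ffun 'I_l -> 'I_N.+1}) := lam - \sum_i sroot i *+ k i.
apply: (@sub_finite_set _ _ (F @` setT)); last by apply: finite_image;
  apply: finite_finset.
move=> y /PiPlusP[dy [k yk]].
have := congr1 (@height l) yk; rewrite heightD heightN height_sum => hk.
have := dominant_height dy => h0.
have kN i : (k i < N.+1)%N.
  suff : (k i <= \sum_i k i)%N by rewrite /N; lia.
  by rewrite (bigD1 i) //= leq_addr.
exists [ffun i => Ordinal (kN i)] => //; rewrite /F -[y](subKr lam) yk.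
by congr (_ - _); apply: eq_bigr => i _; rewrite ffunE.
Qed.

Lemma weyl_orbit_finite lam : finite_set (weyl_orbit lam).
Proof.
apply: (@sub_finite_set _ _ ((fun s => weyl_act s lam) @` setT)).
  by move=> x [s ->]; exists s.
by apply: finite_image; apply: finite_finset.
Qed.

Lemma Pi_finite lam : finite_set (Pi lam).
Proof.
apply: (@sub_finite_set _ _ (\bigcup_(y in PiPlus lam) weyl_orbit y)).
  move=> x [y [dy [s ys] le]]; exists y; first exact/PiPlusP.
  by exists s^-1%g; rewrite ys weyl_actK.
apply: bigcup_finite; first exact: PiPlus_finite.
by move=> y _; apply: weyl_orbit_finite.
Qed.

(** The counted set is given as a classical set; this is the same cardinal for
    the finite set. *)
Lemma weyl_lengthE s :
  weyl_length s = #|[set p : 'I_l.+1 * 'I_l.+1 | (p.1 < p.2)%N && (s p.2 < s p.1)%N]%SET|.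
Proof. by apply: eq_card => p; rewrite !inE; apply/asboolP/idP. Qed.

(** The reversal makes all positive roots negative, so an element of maximal
    length does so too, that is, it is strictly decreasing. *)
Lemma longestE (k0 : 'I_l.+1) : longest l k0 = rev_ord k0.
Proof.
have perm_rev_inj : injective (@rev_ord l.+1) by exact: rev_ord_inj.
have desc (i j : 'I_l.+1) : (i < j)%N -> (longest l j < longest l i)%N.
  rewrite /longest; case: arg_maxnP => // s _ smax ij.
  have sub : [set p : 'I_l.+1 * 'I_l.+1 | (p.1 < p.2)%N && (s p.2 < s p.1)%N]%SET
      \subset [set p : 'I_l.+1 * 'I_l.+1 | (p.1 < p.2)%N]%SET.
    by apply/fintype.subsetP => p; rewrite !inE => /andP[].
  have le : (weyl_length (perm perm_rev_inj) <= weyl_length s)%N := smax _ isT.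
  rewrite !weyl_lengthE in le.
  have ge : (#|[set p : 'I_l.+1 * 'I_l.+1 | (p.1 < p.2)%N]%SET|
      <= #|[set p : 'I_l.+1 * 'I_l.+1 | (p.1 < p.2)%N && (s p.2 < s p.1)%N]%SET|)%N.
    apply: (leq_trans _ le); apply/subset_leq_card/fintype.subsetP => p.
    rewrite !inE !permE /= => lt; rewrite lt /=.
    by move: (ltn_ord p.2) => ltl; apply: ltn_sub2l; rewrite ?ltnS // (leq_trans lt).
  have := eqEcard [set p : 'I_l.+1 * 'I_l.+1 | (p.1 < p.2)%N && (s p.2 < s p.1)%N]%SET
     [set p : 'I_l.+1 * 'I_l.+1 | (p.1 < p.2)%N]%SET.
  by rewrite sub ge => /eqP/setP/(_ (i, j)); rewrite !inE /= ij /= => ->.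
(* Strict decrease bounds the values from above, going up from 0, and from below,
   going down from [l]. *)
have up m : forall k : ordinal l.+1, k = m :> nat -> (longest l k + k <= l)%N.
  elim: m => [|m IH] k km; first by rewrite km addn0 -ltnS.
  have lt : (m < l.+1)%N by rewrite (leq_trans _ (ltn_ord k)) // km.
  have := IH (Ordinal lt) erefl; have /= := desc (Ordinal lt) k.
  by rewrite km ltnSn => /(_ isT); lia.
have down m : forall k : 'I_l.+1, (k + m = l)%N -> (l <= longest l k + k)%N.
  elim: m => [|m IH] k km; first by move: km; rewrite addn0 => ->; rewrite leq_addl.
  have lt : (k.+1 < l.+1)%N by lia.
  have := IH (Ordinal lt); have /= := desc k (Ordinal lt).
  by rewrite ltnSn => /(_ isT); lia.
apply: val_inj => /=; have := up _ _ (erefl (k0 : nat)).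
by have := down (l - k0)%N k0; have := ltn_ord k0; lia.
Qed.

(** The highest weight of the dual of the module of highest weight [x]. *)
Definition dual_weight x : weight l := - weyl_act (longest l) x.

Lemma dual_weightE x i : dual_weight x 0 i = x 0 (rev_ord i).
Proof.
rewrite -[x in LHS]epscoordK /dual_weight weyl_act_of_eps !mxE opprB.
have longV (k : 'I_l.+1) : ((longest l)^-1)%g k = rev_ord k.
  by apply: (@perm_inj _ (longest l)); rewrite permKV longestE rev_ordK.
rewrite !longV -epscoord_lohi.
by congr (epscoord x _ - epscoord x _); apply: val_inj; rewrite /= /bump /=;
  have := ltn_ord i; lia.
Qed.

Lemma dual_weightK : involutive dual_weight.
Proof. by move=> x; apply/rowP => i; rewrite !dual_weightE rev_ordK. Qed.

Lemma dual_weightD x y : dual_weight (x + y) = dual_weight x + dual_weight y.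
Proof. by rewrite /dual_weight weyl_actD opprD. Qed.

Lemma dual_weight_dominant x : dominant x -> dominant (dual_weight x).
Proof. by move=> dx i; rewrite dual_weightE. Qed.

Lemma dual_weight_root_le x y : root_le x y -> root_le (dual_weight x) (dual_weight y).
Proof.
have sr i : dual_weight (sroot i) = sroot (rev_ord i).
  apply/rowP => j; rewrite dual_weightE !mxE /cartanA -(inj_eq rev_ord_inj) rev_ordK.
  case: eqP => // _; congr (if _ then _ else _).
  rewrite orbC /=; have := ltn_ord i; have := ltn_ord j; lia.
move=> [k xy]; exists (fun i => k (rev_ord i)).
have -> : dual_weight y - dual_weight x = dual_weight (y - x).
  by rewrite dual_weightD [dual_weight (- x)]/dual_weight weyl_actN.
have s0 : dual_weight 0 = 0 by apply: (addrI (dual_weight 0));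
  rewrite -dual_weightD !addr0.
rewrite xy (big_morph _ dual_weightD s0) (reindex_inj rev_ord_inj) /=.
apply: eq_bigr => i _.
have sn (z : weight l) m : dual_weight (z *+ m) = dual_weight z *+ m.
  by elim: m => [|m IH]; rewrite ?mulr0n // !mulrS dual_weightD IH.
by rewrite sn sr rev_ordK.
Qed.

End Saturated.

(** * The group ring and unitriangular families *)

(* The name also denotes a predicate on functions. *)
Local Notation invariant := Defs.invariant.

Section GroupRingLemmas.
Variable l : nat.
Implicit Types (x y z lam mu nu : weight l) (s t : 'S_l.+1) (g c : gring l).
Implicit Types (f : weight l -> gring l).

Lemma ebasisE x y : (ebasis x)@_y = (x == y)%:R.
Proof. by rewrite mcoeffU; case: eqP. Qed.

Lemma gweylE s g z : (gweyl s g)@_z = g@_(weyl_act s^-1%g z).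
Proof.
rewrite raddf_sum /=.
have [zin|zout] := boolP (weyl_act s^-1%g z \in msupp g).
  rewrite (bigD1_seq _ zin) ?fset_uniq //= big1 => [|x xz].
    by rewrite mcoeffZ ebasisE weyl_actKV eqxx mulr1 addr0.
  rewrite mcoeffZ ebasisE; case: (_ =P z) xz => [<-|_ _]; last by rewrite mulr0.
  by rewrite weyl_actK eqxx.
rewrite (mcoeff_outdom zout) big_seq big1 // => x xg.
rewrite mcoeffZ ebasisE; case: (_ =P z) zout => [<-|_ _]; last by rewrite mulr0.
by rewrite weyl_actK xg.
Qed.

Lemma invariantP g : invariant g <-> forall s x, g@_(weyl_act s x) = g@_x.
Proof.
split=> [inv s x|inv s]; first by rewrite -[in LHS](inv s) gweylE weyl_actK.
by apply/malgP => x; rewrite gweylE inv.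
Qed.

Lemma gmulE g1 g2 z : (gmul g1 g2)@_z = \sum_(x <- msupp g1) g1@_x * g2@_(z - x).
Proof.
rewrite raddf_sum /=; apply: eq_bigr => x _; rewrite raddf_sum /=.
have [zin|zout] := boolP (z - x \in msupp g2).
  rewrite (bigD1_seq _ zin) ?fset_uniq //= big1 => [|y yz].
    by rewrite mcoeffZ ebasisE [x + _]addrC subrK eqxx mulr1 addr0.
  rewrite mcoeffZ ebasisE; case: (_ =P z) yz => [<-|_ _]; last by rewrite mulr0.
  by rewrite [_ - x]addrC addKr eqxx.
rewrite (mcoeff_outdom zout) mulr0 big_seq big1 // => y yg.
rewrite mcoeffZ ebasisE; case: (_ =P z) zout => [<-|_ _]; last by rewrite mulr0.
by rewrite [_ - x]addrC addKr yg.
Qed.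

(** Summing over a larger set lets two products be compared term by term. *)
Lemma gmulE_wide (D : {fset weight l}) g1 g2 z : (msupp g1 `<=` D)%fset ->
  (gmul g1 g2)@_z = \sum_(x <- D) g1@_x * g2@_(z - x).
Proof.
move=> sub; rewrite gmulE; apply: big_fset_incl => // x xD xg.
by rewrite (mcoeff_outdom xg) mul0r.
Qed.

Lemma gmul_neq0 g1 g2 z : (gmul g1 g2)@_z != 0 ->
  exists x, g1@_x != 0 /\ g2@_(z - x) != 0.
Proof.
rewrite gmulE => nz; apply: contrapT => no; case/negP: nz; apply/eqP/big1 => x _.
apply/eqP; rewrite mulf_eq0; apply: contrapT => /negP; rewrite negb_or => /andP h.
by apply: no; exists x.
Qed.

Lemma gmul_invariant g1 g2 : invariant g1 -> invariant g2 -> invariant (gmul g1 g2).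
Proof.
move=> /invariantP inv1 /invariantP inv2; apply/invariantP => s z; rewrite !gmulE.
have wi : injective (@weyl_act l s) by apply: can_inj (weyl_actK s).
rewrite [LHS](perm_big [seq weyl_act s x | x <- msupp g1]) /=.
  rewrite big_map; apply: eq_bigr => x _.
  by rewrite inv1 -weyl_actN -weyl_actD inv2.
apply: uniq_perm; rewrite ?map_inj_uniq ?fset_uniq // => x.
rewrite -[x in RHS](weyl_actKV s) mem_map // -!mcoeff_neq0.
by rewrite -[in LHS](weyl_actKV s x) inv1.
Qed.

(** The part of [adapted_family] that determines the other two conditions; it is
    also what is checked for the Weyl characters. *)
Definition unitriangular f := forall lam, dominant lam ->
  [/\ invariant (f lam), (f lam)@_lam = 1 & forall x, ~ Pi lam x -> (f lam)@_x = 0].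

Definition lincomb f c : gring l := \sum_(lam <- msupp c) c@_lam *: f lam.

Lemma lincomb_wide (D : {fset weight l}) f c : (msupp c `<=` D)%fset ->
  lincomb f c = \sum_(lam <- D) c@_lam *: f lam.
Proof.
move=> sub; apply: big_fset_incl => // x xD xg.
by rewrite (mcoeff_outdom xg) scale0r.
Qed.

Lemma lincombD f c c' : lincomb f (c + c') = lincomb f c + lincomb f c'.
Proof.
rewrite (lincomb_wide f (msuppD_le c c')) (lincomb_wide f (fsubsetUl (msupp c) (msupp
  c'))).
rewrite (lincomb_wide f (fsubsetUr (msupp c) (msupp c'))) -big_split.
by apply: eq_bigr => x _; rewrite mcoeffD scalerDl.
Qed.

Lemma lincombN f c : lincomb f (- c) = - lincomb f c.
Proof.
rewrite /lincomb msuppN -sumrN; apply: eq_bigr => x _.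
by rewrite mcoeffN scaleNr.
Qed.

Lemma lincomb_invariant f c : unitriangular f ->
  (forall lam, c@_lam != 0 -> dominant lam) -> invariant (lincomb f c).
Proof.
move=> uf dc; apply/invariantP => s x; rewrite !raddf_sum /=.
rewrite !big_seq; apply: eq_bigr => lam;
  rewrite -mcoeff_neq0 => /dc/uf[/invariantP inv _ _].
by rewrite !mcoeffZ inv.
Qed.

(** Among the members of the family with index of height at most that of [y],
    only [f y] has [y] in its support. *)
Lemma lincomb_top f c y : unitriangular f ->
    (forall lam, c@_lam != 0 -> dominant lam /\ height lam <= height y) ->
  (lincomb f c)@_y = c@_y.
Proof.
move=> uf hc; rewrite raddf_sum /=.
have Z lam : lam \in msupp c -> lam != y -> (c@_lam *: f lam)@_y = 0.
  rewrite -mcoeff_neq0 mcoeffZ => /hc[/uf[_ _ f0] le] lamy; rewrite f0 ?mulr0 //.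
  move=> /Pi_le/root_le_height[le' e]; case/negP: lamy.
  by rewrite eq_sym -e eq_le le' le.
have [yc|yc] := boolP (y \in msupp c).
  rewrite (bigD1_seq _ yc) ?fset_uniq //= big_seq_cond big1 ?addr0 => [|lam /andP[]];
    last exact: Z.
  by move: yc; rewrite -mcoeff_neq0 mcoeffZ => /hc[/uf[_ -> _] _]; rewrite mulr1.
rewrite (mcoeff_outdom yc) big_seq big1 // => lam lamc; apply: Z => //.
by apply: contraNneq yc => <-.
Qed.

Lemma seq_argmax (T : eqType) (F : T -> int) (s : seq T) : s != [::] ->
  exists2 a, a \in s & forall b, b \in s -> F b <= F a.
Proof.
elim: s => // a [|b s] IH _; first by exists a; rewrite ?mem_head // => y /[!inE] /eqP->.
have [x xs xmax] := IH isT; have [le|lt] := leP (F a) (F x).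
  by exists x; rewrite 1?in_cons ?xs ?orbT // => y; rewrite inE => /orP[/eqP->|/xmax].
exists a; rewrite ?mem_head // => y; rewrite inE => /orP[/eqP->//|/xmax ym].
by rewrite (le_trans ym) // ltW.
Qed.

Lemma lincomb_inj f c : unitriangular f -> (forall lam, c@_lam != 0 -> dominant lam) ->
  lincomb f c = 0 -> c = 0.
Proof.
move=> uf dc c0; have [e|nz] := eqVneq (msupp c : seq _) [::].
  apply/malgP => x; rewrite mcoeff0; apply: mcoeff_outdom.
  by rewrite -[_ \in _]/(x \in (msupp c : seq _)) e.
have [y yc ymax] := @seq_argmax _ (@height l) _ nz.
have := congr1 (mcoeff y) c0; rewrite lincomb_top // => [|lam lc].
  by move: yc; rewrite mcoeff0 -mcoeff_neq0 => /eqP.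
by split; [exact: dc | apply: ymax; rewrite -mcoeff_neq0].
Qed.

Lemma invariant0 g : invariant g -> (forall y, dominant y -> g@_y = 0) -> g = 0.
Proof.
move=> /invariantP inv g0; apply/malgP => x; have [s ds] := dominant_conj x.
by rewrite mcoeff0 -(inv s) g0.
Qed.

Lemma invariantB g g' : invariant g -> invariant g' -> invariant (g - g').
Proof.
move=> /invariantP i /invariantP i'; apply/invariantP => s x.
by rewrite !mcoeffB i i'.
Qed.

(** By induction on a strict bound [N] for the heights of the dominant weights in
    the support. The bound on the support of [c] is what places the structure
    constants of a product in a saturated set. *)
Lemma invariant_expand f g : unitriangular f -> invariant g ->
  exists2 c : gring l, g = lincomb f c &
    forall lam, c@_lam != 0 -> dominant lam /\ exists2 x, g@_x != 0 & root_le lam x.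
Proof.
move=> uf inv.
have [N hN] : exists N : nat, forall y, dominant y -> g@_y != 0 -> height y < N%:Z.
  exists (\sum_(x <- msupp g) `|height x|%N).+1 => y dy; rewrite mcoeff_neq0 => yg.
  rewrite (bigD1_seq _ yg) ?fset_uniq //=; lia.
elim: N => [|N IH] in g inv hN *.
  have -> : g = 0.
    apply: invariant0 => // y dy; apply: contrapT => /eqP/(hN _ dy).
    by rewrite ltNge dominant_height.
  by exists 0; [rewrite /lincomb msupp0 big_nil | move=> lam; rewrite mcoeff0 eqxx].
pose c0 : gring l := [malg x in msupp g =>
  if `[<dominant x>] && (height x == N) then g@_x else 0].
have c0E x : c0@_x = if `[<dominant x>] && (height x == N) then g@_x else 0.
  rewrite mcoeffE; case: (boolP (x \in msupp g)) => // xg.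
  by rewrite (mcoeff_outdom xg) if_same.
have c0P lam : c0@_lam != 0 -> [/\ dominant lam, height lam = N & g@_lam != 0].
  by rewrite c0E; case: ifP => [/andP[/asboolP ? /eqP ?]|]; rewrite ?eqxx.
have inv0 : invariant (lincomb f c0) by apply: lincomb_invariant => // lam /c0P[].
have [|y dy|c gc cP] := IH (g - lincomb f c0); first exact: invariantB.
  rewrite mcoeffB => ny; rewrite ltNge; apply/negP => hy.
  case/negP: ny; rewrite lincomb_top // => [|lam /c0P[? -> _]] //.
  rewrite c0E; case: ifP => [|/negbT]; first by rewrite subrr.
  rewrite negb_and; have -> /= : `[<dominant y>] by apply/asboolP.
  move=> ne; rewrite subr0; apply/eqP; apply: contrapT => /eqP/(hN y dy).
  lia.
exists (c0 + c); first by rewrite lincombD -gc addrC subrK.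
have sub lam : c0@_lam != 0 -> dominant lam /\ exists2 x, g@_x != 0 & root_le lam x.
  by case/c0P => *; split=> //; exists lam => //; apply: root_le_refl.
move=> lam; have [/eqP c00|nz _] := boolP (c0@_lam == 0); last exact: sub.
rewrite mcoeffD c00 add0r => /cP[dl [x xg le]]; split=> //.
have [/eqP gx0|gx] := boolP (g@_x == 0); last by exists x.
move: xg; rewrite mcoeffB gx0 sub0r oppr_eq0 raddf_sum /= => nz.
have [kap [kc fk]] : exists kap, c0@_kap != 0 /\ (f kap)@_x != 0.
  apply: contrapT => /forallNP no; case/negP: nz; apply/eqP/big1 => k _.
  rewrite mcoeffZ; apply/eqP; rewrite mulf_eq0; apply: contrapT => /negP.
  by rewrite negb_or => /andP h; apply: (no k).
have [dk _ gk] := c0P _ kc; exists kap => //; apply: root_le_trans le _.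
apply: Pi_le; apply: contrapT => nP.
by have [_ _ f0] := uf _ dk; case/eqP: fk; apply: f0.
Qed.

End GroupRingLemmas.

(** * Structure constants determine the family *)

Lemma eq_sum_seq (I : eqType) (V : nmodType) (s : seq I) (P : pred I) (F G : I -> V) :
  (forall i, i \in s -> P i -> F i = G i) ->
  \sum_(i <- s | P i) F i = \sum_(i <- s | P i) G i.
Proof.
by move=> FG; rewrite big_seq_cond [RHS]big_seq_cond; apply: eq_bigr => i /andP[];
  apply: FG.
Qed.

(** Stated abstractly so that unification never has to compare two expansions in
    the group ring. *)
Lemma monic_summand_eq (R : pzRingType) (V : lmodType R) (a b : R) (u v s t : V) :
  a = 1 -> b = 1 -> s = t -> a *: u + s = b *: v + t -> u = v.
Proof. by move=> -> -> ->; rewrite !scale1r => /addIr. Qed.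

Section StructureConstants.
Variable l : nat.
Implicit Types (x y z lam mu nu kap : weight l) (s t : 'S_l.+1) (g c : gring l).
Implicit Types (f : weight l -> gring l).

Lemma adapted_unitriangular f : adapted_family f -> unitriangular f.
Proof. by move=> af lam /af[]. Qed.

Lemma unitriangular_basis f : unitriangular f -> invariant_basis f.
Proof.
move=> uf; split=> [lam /uf[]//|g inv].
have [c gc cP] := invariant_expand uf inv; exists c; split; first by split=> // lam /cP[].
move=> c' [dc' gc']; apply/eqP; rewrite eq_sym -subr_eq0; apply/eqP.
apply: (lincomb_inj uf); last by rewrite lincombD lincombN -gc -[lincomb f c']gc' subrr.
move=> lam; rewrite mcoeffB => nz; apply: contrapT => nd; case/negP: nz; apply/eqP.
have z0 (d : gring l) : (forall lam, d@_lam != 0 -> dominant lam) -> d@_lam = 0.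
  by move=> hd; apply: contrapT => /eqP/hd.
by rewrite !z0 ?subrr // => k /cP[].
Qed.

Local Notation PiPlus_fset lam := (fset_set (PiPlus lam)).

Lemma in_PiPlus_fset lam y : (y \in PiPlus_fset lam) = `[<PiPlus lam y>].
Proof. by rewrite in_fset_set //; exact: PiPlus_finite. Qed.

Lemma fsum_PiPlus lam (F : weight l -> gring l) :
  \sum_(y \in PiPlus lam) F y = \sum_(y <- PiPlus_fset lam) F y.
Proof. by rewrite fsbig_finite //=; exact: PiPlus_finite. Qed.

Lemma product_coefs_sum f mu nu (c : weight l -> int) : product_coefs f mu nu c ->
  gmul (f mu) (f nu) = \sum_(lam <- PiPlus_fset (mu + nu)) c lam *: f lam.
Proof. by case=> pc _; apply: etrans pc (fsum_PiPlus _ _). Qed.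

Lemma product_coefE f mu nu (c : weight l -> int) z : product_coefs f mu nu c ->
  (gmul (f mu) (f nu))@_z = \sum_(lam <- PiPlus_fset (mu + nu)) c lam * (f lam)@_z.
Proof.
move=> /product_coefs_sum->; rewrite raddf_sum /=; apply: eq_bigr => lam _.
by rewrite mcoeffZ.
Qed.

(** The support of a product of members lies in [Pi (mu + nu)], by [PiD], and the
    expansion of an invariant stays below its support. *)
Lemma product_coef_exists f mu nu : unitriangular f -> dominant mu -> dominant nu ->
  exists! c : weight l -> int, product_coefs f mu nu c.
Proof.
move=> uf dmu dnu; have [imu _ smu] := uf _ dmu; have [inu _ snu] := uf _ dnu.
have inv := gmul_invariant imu inu.
have [c gc cP] := invariant_expand uf inv.
have cPP lam : c@_lam != 0 -> PiPlus (mu + nu) lam.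
  case/cP => dlam [x gx le]; apply/PiPlusP; split=> //.
  apply: (root_le_trans le); have [y [fy fz]] := gmul_neq0 gx.
  rewrite -(subrK y x) addrC; apply/Pi_le/PiD; apply: contrapT.
    by move/smu => y0; rewrite y0 eqxx in fy.
  by move/snu => y0; rewrite y0 eqxx in fz.
have sub : (msupp c `<=` PiPlus_fset (mu + nu))%fset.
  by apply/fsubsetP => x; rewrite -mcoeff_neq0 in_PiPlus_fset => /cPP h; apply/asboolP.
exists (fun lam => c@_lam); split.
  split; first by apply/esym/(etrans (fsum_PiPlus _ _)); rewrite gc (lincomb_wide f sub).
  by move=> lam nP; apply: contrapT => /eqP/cPP.
move=> c' pc'; apply/funext => lam.
pose d : gring l := [malg x in PiPlus_fset (mu + nu) => c' x - c@_x].
have dE x : d@_x = c' x - c@_x.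
  rewrite mcoeffE in_PiPlus_fset; case: asboolP => // nP; rewrite (proj2 pc') // sub0r.
  by apply/eqP; rewrite eq_sym oppr_eq0; apply: contrapT => /negP/cPP.
have d0 : d = 0.
  apply: (lincomb_inj uf).
    move=> k; rewrite dE => nz; have [[_ dk]//|nP] := pselect (PiPlus (mu + nu) k).
    case/negP: nz; rewrite (proj2 pc') // sub0r oppr_eq0.
    by apply: contrapT => /negP/cPP.
  have sd : (msupp d `<=` PiPlus_fset (mu + nu))%fset.
    apply/fsubsetP => x; rewrite -mcoeff_neq0 mcoeffE.
    by case: ifP => //; rewrite eqxx.
  rewrite (lincomb_wide f sd); apply/eqP.
  rewrite (eq_bigr (fun x => c' x *: f x - c@_x *: f x)); last first.
    by move=> x _; rewrite dE scalerBl.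
  rewrite sumrB subr_eq0; apply/eqP.
  apply: etrans (esym (product_coefs_sum pc')) _.
  exact: etrans gc (lincomb_wide f sub).
by have := dE lam; rewrite d0 mcoeff0 => /esym/eqP; rewrite subr_eq0 => /eqP.
Qed.

Definition omega (i : 'I_l) : weight l := \row_j (i == j)%:R.

Lemma omega_dominant i : dominant (omega i).
Proof. by move=> j; rewrite mxE; case: eqP. Qed.

Lemma dual_weight_omega i : dual_weight (omega i) = omega (rev_ord i).
Proof. by apply/rowP => j; rewrite dual_weightE !mxE -(inj_eq rev_ord_inj) rev_ordK. Qed.

Lemma dominant_sub_omega lam : dominant lam -> lam != 0 ->
  exists i mu, [/\ dominant mu, lam = mu + omega i &
    0 <= height mu /\ height mu < height lam].
Proof.
move=> dl nz.
have [i li] : exists i, 0 < lam 0 i.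
  apply: contrapT => /forallNP no; case/eqP: nz; apply/rowP => i; rewrite mxE.
  by apply/eqP; rewrite eq_le dl andbT leNgt; apply/negP/no.
have lamE : lam = (lam - omega i) + omega i by rewrite subrK.
have dmu : dominant (lam - omega i).
  by move=> j; rewrite !mxE; case: eqP => [<-|_]; rewrite ?subr0 // subr_ge0 -gtz0_ge1.
exists i, (lam - omega i); split=> //; split; first exact: dominant_height.
have hpos : 0 < height (omega i).
  rewrite /height (bigD1 i) //= big1 ?addr0 => [|j ji];
    last by rewrite mxE eq_sym (negbTE ji) mul0r.
  by rewrite mxE eqxx mul1r; have := ltn_ord i; nia.
by rewrite [X in _ < height X]lamE [ltRHS]heightD ltrDl.
Qed.

Section Uniqueness.
Variables (f g : weight l -> gring l) (n c : weight l -> weight l -> weight l -> int).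
Hypothesis l_gt0 : (0 < l)%N.
Hypotheses (uf : unitriangular f) (ug : unitriangular g).
Hypothesis fn : forall mu nu, dominant mu -> dominant nu ->
  product_coefs f mu nu (n mu nu).
Hypothesis gc : forall mu nu, dominant mu -> dominant nu ->
  product_coefs g mu nu (c mu nu).
Hypothesis n_sym : forall lam mu nu, dominant lam -> dominant mu -> dominant nu ->
  n mu nu lam = n lam (dual_weight nu) mu.
Hypothesis c_sym : forall lam mu nu, dominant lam -> dominant mu -> dominant nu ->
  c mu nu lam = c lam (dual_weight nu) mu.

(** The support of [lam - x] is not the whole set of simple roots. *)
Definition partial_support lam x := exists i : 'I_l, rootcoef i (lam - x) = 0.

Hypothesis fg : forall lam mu, dominant lam -> dominant mu -> root_le mu lam ->
  partial_support lam mu -> (f lam)@_mu = (g lam)@_mu.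

Let i0 : 'I_l := Ordinal l_gt0.

(** The dominant conjugate of [x] lies between [x] and [lam], so its difference
    to [lam] misses the same simple root, and invariance carries the agreement
    over to [x]. *)
Lemma partial_support_agree lam x : dominant lam -> partial_support lam x ->
  (f lam)@_x = (g lam)@_x.
Proof.
move=> dl [i ri]; have [If _ sf] := uf dl; have [Ig _ sg] := ug dl.
have [px|px] := pselect (Pi lam x); last by rewrite sf // sg.
have [s ds] := dominant_conj x.
rewrite -((invariantP _).1 If s) -((invariantP _).1 Ig s); apply: fg => //.
  exact/Pi_le/Pi_weyl.
exists i; apply/eqP; move: ri; rewrite !rootcoefB => ri.
have := root_le_rootcoef i (Pi_le (Pi_weyl s px)).
have le : root_le x (weyl_act s x).
  by rewrite -[X in root_le X _](weyl_actK s); apply: dominant_weyl_le.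
by have := root_le_rootcoef i le; lia.
Qed.

(** In a term [x + y = z] with [x] below [mu] and [y] below [nu], the differences
    [mu - x] and [nu - y] add up to [mu + nu - z] and miss the same simple
    root. *)
Lemma partial_support_product mu nu z : dominant mu -> dominant nu ->
  partial_support (mu + nu) z ->
  (gmul (f mu) (f nu))@_z = (gmul (g mu) (g nu))@_z.
Proof.
move=> dmu dnu [i ri].
rewrite [LHS](gmulE_wide _ _ (fsubsetUl (msupp (f mu)) (msupp (g mu)))).
rewrite [RHS](gmulE_wide _ _ (fsubsetUr (msupp (f mu)) (msupp (g mu)))).
have [_ _ sf] := uf dmu; have [_ _ sg] := ug dmu.
have [_ _ tf] := uf dnu; have [_ _ tg] := ug dnu.
apply: eq_bigr => x _.
have [px|px] := pselect (Pi mu x); last by rewrite sf // sg // !mul0r.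
have [pz|pz] := pselect (Pi nu (z - x)); last by rewrite tf // tg // !mulr0.
have h1 := root_le_rootcoef i (Pi_le px); have h2 := root_le_rootcoef i (Pi_le pz).
move: ri h2; rewrite !rootcoefB rootcoefD => ri h2.
rewrite (partial_support_agree (x := x) dmu); last by exists i; rewrite rootcoefB; lia.
by rewrite (partial_support_agree (x := z - x) dnu) //; exists i; rewrite !rootcoefB; lia.
Qed.

(** By induction on the height of [mu + nu - lam]: compare the coefficients at
    [lam] in both expansions. The other indices that contribute are strictly
    above [lam]. *)
Lemma partial_support_coef mu nu lam : dominant mu -> dominant nu -> dominant lam ->
  partial_support (mu + nu) lam -> n mu nu lam = c mu nu lam.
Proof.
move=> dmu dnu.
have [m] := ubnP (absz (height (mu + nu) - height lam)).
elim: m lam => // m IH lam hm dl ps.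
have [pl|pl] := pselect (PiPlus (mu + nu) lam); last first.
  by rewrite (proj2 (fn dmu dnu)) // (proj2 (gc dmu dnu)).
have lin : lam \in PiPlus_fset (mu + nu) by rewrite in_PiPlus_fset; apply/asboolP.
have := partial_support_product dmu dnu ps.
rewrite [X in X = _ -> _](product_coefE _ (fn dmu dnu)).
rewrite [X in _ = X -> _](product_coefE _ (gc dmu dnu)).
rewrite !(bigD1_seq _ lin) ?fset_uniq //=.
have [_ -> _] := uf dl; have [_ -> _] := ug dl; rewrite !mulr1.
rewrite [X in _ = _ + X ->
  _](_ : _ = \sum_(k <- PiPlus_fset (mu + nu) | k != lam) n mu nu k * (f k)@_lam).
  by move/addIr.
apply/esym; rewrite big_seq_cond [RHS]big_seq_cond; apply: eq_bigr => k.
rewrite in_PiPlus_fset => /andP[/asboolP/PiPlusP[dk le] kl].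
have [_ _ sf] := uf dk; have [_ _ sg] := ug dk.
have [pkl|pkl] := pselect (Pi k lam); last by rewrite sf // sg // !mulr0.
have [i ri] := ps; move: ri; rewrite rootcoefB => ri.
have h1 := root_le_rootcoef i le; have h2 := root_le_rootcoef i (Pi_le pkl).
rewrite IH //; first rewrite (partial_support_agree (x := lam) dk) //.
- by exists i; rewrite rootcoefB; lia.
- have [a1 _] := root_le_height le; have [a2 e2] := root_le_height (Pi_le pkl).
  move: e2; rewrite [lam == k]eq_sym (negbTE kl) => /eqP e2.
  by move: hm; rewrite !ltnS => hm; apply: leq_trans hm; lia.
- by exists i; rewrite rootcoefB; lia.
Qed.

Lemma rootcoef_omega i : rootcoef i0 (omega i) = (l - i)%:Z.
Proof.
rewrite /rootcoef (bigD1 i) //= big1 => [|j ji];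
  first by rewrite mxE eqxx min0n max0n addr0; lia.
by rewrite mxE eq_sym (negbTE ji) mul0r.
Qed.

(** Either [mu + omega i - lam] misses the first simple root, or the symmetry
    leads to a difference that does. *)
Lemma pieri_coef mu lam i : dominant mu -> dominant lam ->
  n mu (omega i) lam = c mu (omega i) lam.
Proof.
move=> dmu dl; have di := omega_dominant i.
have [/PiPlusP[_ le]|pl] := pselect (PiPlus (mu + omega i) lam); last first.
  by rewrite (proj2 (fn dmu di)) // (proj2 (gc dmu di)).
have [z0|nz] := eqVneq (rootcoef i0 (mu + omega i - lam)) 0.
  by apply: partial_support_coef => //; exists i0.
rewrite n_sym // c_sym //; have dsi := dual_weight_dominant di.
have [/PiPlusP[_ le']|pl] := pselect (PiPlus (lam + dual_weight (omega i)) mu);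
  last first.
  by rewrite (proj2 (fn dl dsi)) // (proj2 (gc dl dsi)).
apply: partial_support_coef => //; exists i0.
move: nz; have [k] := le => /(congr1 (rootcoef i0)); rewrite rootcoef_sum => kE.
have [k'] := le' => /(congr1 (rootcoef i0)); rewrite rootcoef_sum => kE'.
rewrite kE kE'.
move: kE kE'; rewrite dual_weight_omega !rootcoefB !rootcoefD !rootcoef_omega /=.
have il := ltn_ord i => kE kE' nz.
(* The two differences add up to a sum of roots in which the first simple root
   has coefficient one. *)
have /eqP : (l.+1 * (k i0 + k' i0) = l.+1 * 1)%N by rewrite mulnDr; lia.
rewrite eqn_pmul2l // => /eqP kk.
have k0 : k i0 <> 0%N by move=> k0; move: nz; rewrite k0 muln0 eqxx.
have k0' : k' i0 = 0%N by lia.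
by rewrite k0' muln0.
Qed.

(** A dominant weight below [omega i] differs from it by a sum without the first
    simple root, because [rootcoef i0] is nonnegative on dominant weights and less
    than [l.+1] at [omega i]. *)
Lemma omega_agree i : f (omega i) = g (omega i).
Proof.
have di := omega_dominant i; have [If _ sf] := uf di; have [Ig _ sg] := ug di.
apply/eqP; rewrite -subr_eq0; apply/eqP/invariant0; first exact: invariantB.
move=> y dy; apply/eqP; rewrite mcoeffB subr_eq0; apply/eqP.
have [py|py] := pselect (Pi (omega i) y); last by rewrite sf // sg.
apply: partial_support_agree => //; exists i0.
have [k] := Pi_le py => /(congr1 (rootcoef i0)); rewrite rootcoef_sum => kE.
have : 0 <= rootcoef i0 y by apply: sumr_ge0 => j _; rewrite mulr_ge0.
rewrite rootcoefB rootcoef_omega in kE *; rewrite kE => y0.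
case: (posnP (k i0)) => [->|kpos]; first by rewrite muln0.
by have := leq_pmulr l.+1 kpos; have := ltn_ord i; lia.
Qed.

Lemma zero_agree : f 0 = g 0.
Proof.
have d0 : dominant (0 : weight l) by move=> i; rewrite mxE.
have [If f0 sf] := uf d0; have [Ig g0 sg] := ug d0.
apply/eqP; rewrite -subr_eq0; apply/eqP/invariant0; first exact: invariantB.
move=> y dy; apply/eqP; rewrite mcoeffB subr_eq0; apply/eqP.
have [py|py] := pselect (Pi 0 y); last by rewrite sf // sg.
have [le e] := root_le_height (Pi_le py).
have /eqP-> : y == 0; last by rewrite f0 g0.
rewrite -e eq_le le; apply: le_trans (dominant_height dy).
by rewrite /height big1 // => j _; rewrite mxE mul0r.
Qed.

Lemma top_product f' mu nu : unitriangular f' -> dominant mu -> dominant nu ->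
  (gmul (f' mu) (f' nu))@_(mu + nu) = 1.
Proof.
move=> uf' dmu dnu; rewrite gmulE; have [_ f1 sf] := uf' _ dmu;
  have [_ g1 sg] := uf' _ dnu.
have muin : mu \in msupp (f' mu) by rewrite -mcoeff_neq0 f1.
rewrite (bigD1_seq _ muin) ?fset_uniq //= big1 ?addr0 => [|x xmu].
  by rewrite f1 [mu + nu]addrC addrK g1 mulr1.
have [px|px] := pselect (Pi mu x); last by rewrite sf // !mul0r.
have [pz|pz] := pselect (Pi nu (mu + nu - x)); last by rewrite sg // !mulr0.
have [h1 e1] := root_le_height (Pi_le px); have [h2 _] := root_le_height (Pi_le pz).
case/negP: xmu; rewrite -e1; move: h2; rewrite !heightD heightN; lia.
Qed.

Lemma top_coef f' mu nu (c' : weight l -> int) : unitriangular f' -> dominant mu ->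
  dominant nu ->
  product_coefs f' mu nu c' -> c' (mu + nu) = 1.
Proof.
move=> uf' dmu dnu pc; rewrite -(top_product uf' dmu dnu) (product_coefE _ pc).
have dmn := dominantD dmu dnu.
have lin : (mu + nu) \in PiPlus_fset (mu + nu).
  by rewrite in_PiPlus_fset; apply/asboolP/PiPlusP; split=> //; apply: root_le_refl.
have [_ f1 _] := uf' _ dmn.
rewrite (bigD1_seq _ lin) ?fset_uniq //= f1 mulr1 big_seq_cond big1 ?addr0 // => k.
rewrite in_PiPlus_fset => /andP[/asboolP/PiPlusP[dk le] kl].
have [_ _ sk] := uf' _ dk; rewrite sk ?mulr0 // => /Pi_le le'.
by case/eqP: kl; apply: root_le_anti.
Qed.

(** In the expansions of [f mu * f (omega i)] and [g mu * g (omega i)] all terms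
    but the highest ones agree, by [pieri_coef] and induction, and the highest
    ones have coefficient one. *)
Theorem structure_constants_determine lam : dominant lam -> f lam = g lam.
Proof.
have [m] := ubnP (absz (height lam)); elim: m lam => // m IH lam hm dl.
have [->|nz] := eqVneq lam 0; first exact: zero_agree.
have [i [mu [dmu lamE [hmu hlt]]]] := dominant_sub_omega dl nz.
have di := omega_dominant i.
have fgmu : f mu = g mu.
  by apply: IH => //; move: hm; rewrite ltnS => hm; apply: leq_trans hm; lia.
have pf := fn dmu di; have pg := gc dmu di.
have lin : lam \in PiPlus_fset (mu + omega i).
  by rewrite in_PiPlus_fset -lamE; apply/asboolP/PiPlusP; split=> //; apply: root_le_refl.
have Ef := product_coefs_sum pf; have Eg := product_coefs_sum pg.
have : \sum_(k <- PiPlus_fset (mu + omega i)) n mu (omega i) k *: f k =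
    \sum_(k <- PiPlus_fset (mu + omega i)) c mu (omega i) k *: g k.
  by apply: etrans (esym Ef) (etrans _ Eg); rewrite fgmu omega_agree.
have D (F : weight l -> gring l) : \sum_(k <- PiPlus_fset (mu + omega i)) F k =
    F lam + \sum_(k <- PiPlus_fset (mu + omega i) | k != lam) F k.
  by rewrite (bigD1_seq _ lin) ?fset_uniq.
move/(etrans (esym (D _)))/esym/(etrans (esym (D _))).
move=> e.
have n1 : n mu (omega i) lam = 1 by rewrite lamE; apply: top_coef pf.
have c1 : c mu (omega i) lam = 1 by rewrite lamE; apply: top_coef pg.
refine (monic_summand_eq n1 c1 _ (esym e)).
clear e; apply: eq_sum_seq => k;
  rewrite in_PiPlus_fset -lamE => /asboolP/PiPlusP[dk le] kl.
suff fgk : f k = g k.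
  exact: (f_equal2 (fun a u => a *: u) (pieri_coef i dmu dk) fgk).
apply: IH => //.
move: hm; rewrite ltnS => hm; apply: leq_trans hm.
have [h e] := root_le_height le; move: e; rewrite (negbTE kl) => /eqP e.
by have := dominant_height dk; lia.
Qed.

End Uniqueness.

End StructureConstants.

(** * The Lie algebra and weight vectors *)

Section RepBasics.
Variables (C : numClosedFieldType) (l : nat).
Implicit Types (M N : slrep C l) (x y : 'M[C]_l.+1) (i j : 'I_l) (lam mu w : weight l).

(** Subspaces are row spaces, so the operators act on row vectors from the
    right. Transposition reverses products. *)
Definition op M x : 'M[C]_(sldim M) := (M x)^T.

Lemma op0 M : op M 0 = 0.
Proof.
have := @slact_linear _ _ M (-1) 0 0 (mxtrace0 _ _) (mxtrace0 _ _).
by rewrite scaler0 addr0 scaleN1r addNr /op => ->; rewrite trmx0.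
Qed.

Lemma op_linear M a x y : \tr x = 0 -> \tr y = 0 ->
  op M (a *: x + y) = a *: op M x + op M y.
Proof. by move=> x0 y0; rewrite /op slact_linear // linearD linearZ. Qed.

Lemma opZ M a x : \tr x = 0 -> op M (a *: x) = a *: op M x.
Proof. by move=> x0; rewrite -[a *: x]addr0 op_linear ?mxtrace0 // op0 addr0. Qed.

Lemma op_bracket M x y : \tr x = 0 -> \tr y = 0 ->
  op M (x *m y - y *m x) = op M y *m op M x - op M x *m op M y.
Proof. by move=> x0 y0; rewrite /op slact_bracket // linearB /= !trmx_mul. Qed.

Lemma tr_bracket x y : \tr (x *m y - y *m x) = 0.
Proof. by rewrite linearB /= mxtrace_mulC subrr. Qed.

Lemma tr_delta (a b : 'I_l.+1) : a != b -> \tr (delta_mx a b : 'M[C]_l.+1) = 0.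
Proof.
move=> ab; rewrite /mxtrace big1 // => k _; rewrite mxE.
by case: eqP => // ->; rewrite (negbTE ab).
Qed.

Definition raise i : 'M[C]_l.+1 := delta_mx (lo i) (hi i).
Definition lower i : 'M[C]_l.+1 := delta_mx (hi i) (lo i).

Lemma lo_neq_hi i : lo i != hi i.
Proof. by rewrite -val_eqE /= /bump /= neq_ltn ltnSn. Qed.

Lemma tr_raise i : \tr (raise i) = 0. Proof. exact/tr_delta/lo_neq_hi. Qed.
Lemma tr_lower i : \tr (lower i) = 0. Proof. by rewrite tr_delta // eq_sym lo_neq_hi. Qed.

Lemma corootE i : coroot C i = raise i *m lower i - lower i *m raise i.
Proof. by rewrite !mul_delta_mx. Qed.

Lemma tr_coroot i : \tr (coroot C i) = 0.
Proof. by rewrite corootE tr_bracket. Qed.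

(** The simple root vectors generate the Lie algebra: other root vectors are
    brackets of root vectors of smaller height, and the diagonal matrices of trace
    zero are combinations of the brackets [E_a0, E_0a]. *)
Lemma sl_gen_ind (P : 'M[C]_l.+1 -> Prop) : P 0 ->
    (forall a x y, \tr x = 0 -> \tr y = 0 -> P x -> P y -> P (a *: x + y)) ->
    (forall x y, \tr x = 0 -> \tr y = 0 -> P x -> P y -> P (x *m y - y *m x)) ->
    (forall i, P (raise i)) -> (forall i, P (lower i)) ->
  forall x, \tr x = 0 -> P x.
Proof.
move=> P0 Plin Pbr Pr Pl.
have up d : forall a b : 'I_l.+1, (b = a + d.+1 :> nat)%N ->
    P (delta_mx a b) /\ P (delta_mx b a).
  elim: d => [|d IH] a b ab.
    have al : (a < l)%N by have := ltn_ord b; rewrite ab; lia.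
    have -> : a = lo (Ordinal al) by apply: val_inj.
    have -> : b = hi (Ordinal al) by apply: val_inj; rewrite /= /bump ab /=; lia.
    by split; [apply: Pr | apply: Pl].
  have cl : (a + d.+1 < l.+1)%N by have := ltn_ord b; rewrite ab; lia.
  pose c := Ordinal cl; have [ac ca] := IH a c erefl.
  have al : (c < l)%N by have := ltn_ord b; rewrite ab /=; lia.
  have cE : c = lo (Ordinal al) by apply: val_inj.
  have bE : b = hi (Ordinal al) by apply: val_inj; rewrite /= /bump ab /=; lia.
  have nac : a != c by rewrite -val_eqE /=; lia.
  have nab : a != b by rewrite -val_eqE /=; lia.
  have ncb : c != b by rewrite -val_eqE /=; lia.
  have -> : delta_mx a b =
    delta_mx a c *m delta_mx c b - delta_mx c b *m delta_mx a c :> 'M[C]_l.+1.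
    by rewrite mul_delta_mx mul_delta_mx_0 1?eq_sym // subr0.
  have -> : delta_mx b a =
    delta_mx b c *m delta_mx c a - delta_mx c a *m delta_mx b c :> 'M[C]_l.+1.
    by rewrite mul_delta_mx mul_delta_mx_0 // subr0.
  have [Pcb Pbc] : P (delta_mx c b) /\ P (delta_mx b c) 
    by have := Pr (Ordinal al); have := Pl (Ordinal al); rewrite /raise /lower -bE -cE.
  by split; apply: Pbr; rewrite ?tr_delta // eq_sym.
have off (a b : 'I_l.+1) : a != b -> P (delta_mx a b).
  move=> nab; case: (ltngtP a b) => [ab|ba|/val_inj e]; last by rewrite e eqxx in nab.
    have e : (b = a + (b - a.+1).+1 :> nat)%N by lia.
    by case: (up _ _ _ e).
  have e : (a = b + (a - b.+1).+1 :> nat)%N by lia.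
  by case: (up _ _ _ e).
have dg (a : 'I_l.+1) : P (delta_mx a a - delta_mx ord0 ord0).
  have [->|a0] := eqVneq a ord0; first by rewrite subrr.
  have -> : delta_mx a a - delta_mx ord0 ord0 =
     delta_mx a (ord0 : 'I_l.+1) *m delta_mx ord0 a - delta_mx ord0 a *m
       delta_mx a ord0 :> 'M[C]_l.+1.
    by rewrite !mul_delta_mx.
  by apply: Pbr; rewrite ?tr_delta //; try apply: off; rewrite // eq_sym.
move=> x x0; pose Q y := \tr y = 0 /\ P y.
suff : Q x by case.
(* As the trace is zero, subtracting [E_00] from the diagonal units does not
   change the sum. *)
pose D a b : 'M[C]_l.+1 := delta_mx a b - (if a == b then delta_mx ord0 ord0 else 0).
have -> : x = \sum_a \sum_b x a b *: D a b.
  rewrite [LHS]matrix_sum_delta; apply/eqP; rewrite -subr_eq0 -sumrB.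
  apply/eqP; transitivity ((\sum_a x a a) *: delta_mx ord0 ord0 : 'M[C]_l.+1).
    rewrite scaler_suml; apply: eq_bigr => a _;
      rewrite -sumrB (bigD1 a) //= big1 => [|b ba].
      by rewrite /D eqxx scalerBr subKr addr0.
    by rewrite /D eq_sym (negbTE ba) subr0 subrr.
  by rewrite -/(\tr x) x0 scale0r.
have Qadd y z : Q y -> Q z -> Q (y + z).
  move=> [y0 Py] [z0 Pz]; split; first by rewrite linearD /= y0 z0 addr0.
  by rewrite -[y]scale1r; apply: Plin.
have Q0 : Q 0 by split; rewrite ?mxtrace0.
apply: (big_ind Q) => // a _; apply: (big_ind Q) => // b _.
have tr1 (k : 'I_l.+1) : \tr (delta_mx k k : 'M[C]_l.+1) = 1.
  rewrite /mxtrace (bigD1 k) //= big1 ?addr0 => [|i /negbTE ni];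
    first by rewrite mxE eqxx.
  by rewrite mxE ni.
have [tD PD] : Q (D a b).
  rewrite /D; case: eqP => [->|/eqP ab]; last by rewrite subr0; split;
    [apply: tr_delta|apply: off].
  by split; [rewrite linearB /= !tr1 subrr|apply: dg].
split; first by rewrite linearZ /= tD mulr0.
by rewrite -[_ *: _]addr0; apply: Plin; rewrite ?mxtrace0.
Qed.

Definition stable M m (U : 'M[C]_(m, sldim M)) : Prop :=
  forall x, \tr x = 0 -> (U *m op M x <= U)%MS.

Lemma stable_gen M m (U : 'M[C]_(m, sldim M)) :
  (forall i, (U *m op M (raise i) <= U)%MS) ->
    (forall i, (U *m op M (lower i) <= U)%MS) ->
  stable U.
Proof.
move=> Ur Ul; apply: sl_gen_ind => //.
- by rewrite op0 mulmx0 sub0mx.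
- move=> a x y x0 y0 Ux Uy; rewrite op_linear // mulmxDr -scalemxAr.
  by rewrite addmx_sub ?scalemx_sub.
- move=> x y x0 y0 Ux Uy; rewrite op_bracket // mulmxBr !mulmxA.
  rewrite addmx_sub ?eqmx_opp //; first exact: submx_trans (submxMr _ Uy) Ux.
  exact: submx_trans (submxMr _ Ux) Uy.
Qed.

Definition wtvec M w (v : 'rV[C]_(sldim M)) : Prop :=
  forall i, v *m op M (coroot C i) = (w 0 i)%:~R *: v.

Lemma weight_spaceP M w m (A : 'M[C]_(m, sldim M)) :
  reflect (forall i, A *m op M (coroot C i) = (w 0 i)%:~R *: A)
    (A <= weight_space M w)%MS.
Proof.
apply: (iffP sub_bigcapmxP) => h i; first exact/eigenspaceP/h.
by move=> _; apply/eigenspaceP/h.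
Qed.

Lemma coroot_bracket i (a b : 'I_l.+1) :
  coroot C i *m delta_mx a b - delta_mx a b *m coroot C i =
  ((lo i == a)%:R - (hi i == a)%:R - (lo i == b)%:R + (hi i == b)%:R) *: delta_mx a b.
Proof.
have L (c : 'I_l.+1) : delta_mx c c *m delta_mx a b =
  (c == a)%:R *: delta_mx a b :> 'M[C]_l.+1.
  by case: eqP => [->|/eqP ca]; rewrite ?mul_delta_mx ?scale1r ?mul_delta_mx_0 ?scale0r.
have R (c : 'I_l.+1) : delta_mx a b *m delta_mx c c =
  (c == b)%:R *: delta_mx a b :> 'M[C]_l.+1.
  by case: eqP => [->|/eqP cb];
    rewrite ?mul_delta_mx ?scale1r ?mul_delta_mx_0 ?scale0r // eq_sym.
by rewrite /coroot mulmxBl mulmxBr !L !R -!scalerBl opprB addrA addrAC.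
Qed.

Lemma coroot_raise i j : coroot C i *m raise j - raise j *m coroot C i
  = (sroot j 0 i)%:~R *: raise j.
Proof.
rewrite coroot_bracket; congr (_ *: _); rewrite mxE /cartanA.
rewrite -!val_eqE /= /bump /= !add1n eqSS.
case: (ltngtP i j) => [ij|ji|->].
- by rewrite [i == j.+1 :> nat]ltn_eqF ?ltnS ?(ltnW ij) //= [j.+1 == i :> nat]gtn_eqF
    ?ltnS ?(ltnW ij) //=;
  case: eqP => _; rewrite ?sub0r ?subr0 ?addr0 ?oppr0 ?add0r.
- by rewrite [i.+1 == j :> nat]gtn_eqF ?ltnS ?(ltnW ji) //= orbF [j.+1 == i :> nat]eq_sym;
  case: eqP => _; rewrite ?sub0r ?subr0 ?addr0 ?oppr0 ?add0r.
- by rewrite [j.+1 == j :> nat]gtn_eqF ?ltnSn // [j == j.+1 :> nat]ltn_eqF ?ltnSn //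
    !subr0 -natrD.
Qed.

End RepBasics.

(** * sl2-triples and the Weyl symmetry of multiplicities *)

Section Sl2.
Variables (C : numClosedFieldType) (d : nat).
Implicit Types (A E F H : 'M[C]_d) (v u : 'rV[C]_d).

(** The source of nilpotency: raising or lowering an eigenvector gives
    eigenvalues in an arithmetic progression, which must end. *)
Lemma finite_spectrum A (a : nat -> C) : injective a -> exists n, ~~ eigenvalue A (a n).
Proof.
move=> inja; apply: contrapT => /forallNP ev.
have ev' n : eigenvalue A (a n) by apply: contrapT => /negP/ev.
have := @max_poly_roots _ (char_poly A) [seq a i | i <- iota 0 d.+1].
rewrite size_map size_iota size_char_poly ltnn => h.
have : false; last by []. apply: h.
- by rewrite -size_poly_eq0 size_char_poly.
- by apply/allP => _ /mapP[i _ ->]; rewrite -eigenvalue_root_char.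
- by rewrite map_inj_uniq ?iota_uniq.
Qed.

Lemma affine_inj (t c : C) : c != 0 -> injective (fun n : nat => t + n%:R * c).
Proof.
by move=> c0 m n /addrI /(mulIf c0) /eqP; rewrite eqr_nat => /eqP.
Qed.

Lemma eigenvector_eigenvalue A a v : v != 0 -> v *m A = a *: v -> eigenvalue A a.
Proof. by move=> v0 va; apply/eigenvalueP; exists v. Qed.

Definition mpow A k : 'M[C]_d := iter k (mulmxr A) 1%:M.

Lemma mpowS A k : mpow A k.+1 = mpow A k *m A. Proof. by []. Qed.

Lemma mpowSl A k : mpow A k.+1 = A *m mpow A k.
Proof.
elim: k => [|k IH]; first by rewrite /mpow /= mul1mx mulmx1.
by rewrite mpowS {1}IH -mulmxA -mpowS.
Qed.

(** The usual relations [e,f] = h, [h,e] = 2e, [h,f] = -2f, with the products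
    reversed because operators act on the right. *)
Definition sl2 E F H := [/\ F *m E - E *m F = H, E *m H - H *m E = 2 *: E &
  F *m H - H *m F = - 2 *: F].

Lemma sl2_sym E F H : sl2 E F H -> sl2 F E (- H).
Proof.
case=> h1 h2 h3; split; first by rewrite -h1 opprB.
- by apply: oppr_inj; rewrite mulmxN mulNmx opprK opprD opprK -scaleNr -h3.
- by rewrite mulmxN mulNmx opprK scaleNr -h2 opprB addrC.
Qed.

Section Triple.
Variables (E F H : 'M[C]_d).
Hypothesis s : sl2 E F H.

Lemma sl2_lower_weight1 a v : v *m H = a *: v -> (v *m F) *m H = (a - 2) *: (v *m F).
Proof.
case: s => _ _ FH va; rewrite -mulmxA -[F *m H](subrK (H *m F)) FH mulmxDr mulmxA va.
by rewrite -scalemxAr -scalemxAl scaleNr scalerBl addrC -scalerBl scalerBl.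
Qed.

Lemma sl2_raise_weight1 a v : v *m H = a *: v -> (v *m E) *m H = (a + 2) *: (v *m E).
Proof.
case: s => _ EH _ va; rewrite -mulmxA -[E *m H](subrK (H *m E)) EH mulmxDr mulmxA va.
by rewrite -scalemxAr -scalemxAl addrC -scalerDl.
Qed.

Lemma sl2_lower_weight a v k : v *m H = a *: v ->
  (v *m mpow F k) *m H = (a - k%:R * 2) *: (v *m mpow F k).
Proof.
move=> va; elim: k => [|k IH]; first by rewrite /mpow /= mulmx1 mul0r subr0.
rewrite mpowS mulmxA (sl2_lower_weight1 IH); congr (_ *: _); rewrite -natr1; ring.
Qed.

Lemma sl2_raise_weight a v k : v *m H = a *: v ->
  (v *m mpow E k) *m H = (a + k%:R * 2) *: (v *m mpow E k).
Proof.
move=> va; elim: k => [|k IH]; first by rewrite /mpow /= mulmx1 mul0r addr0.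
rewrite mpowS mulmxA (sl2_raise_weight1 IH); congr (_ *: _); rewrite -natr1; ring.
Qed.

(** Commuting [E] past [k.+1] factors [F]; on a highest weight vector the first
    term vanishes. *)
Lemma sl2_lower_raise a v k : v *m H = a *: v ->
  v *m mpow F k.+1 *m E = (v *m E *m F + (k.+1%:R * (a - k%:R)) *: v) *m mpow F k.
Proof.
move=> va; have FE : F *m E = E *m F + H by case: s => <- _ _; rewrite addrC subrK.
elim: k => [|k IH].
  by rewrite mpowS /mpow /= mulmx1 mul1mx -mulmxA FE mulmxDr mulmxA va subr0 mul1r.
rewrite mpowS mulmxA -[_ *m F *m E]mulmxA FE mulmxDr mulmxA IH (sl2_lower_weight _ va).
rewrite -[_ *m mpow F k *m F]mulmxA -mpowS !mulmxDl -!scalemxAl -addrA -scalerDl.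
congr (_ + _ *: _); rewrite -!natr1; ring.
Qed.

Lemma sl2_lower_nilpotent a v : v != 0 -> v *m H = a *: v ->
  exists2 k, v *m mpow F k != 0 & v *m mpow F k.+1 = 0.
Proof.
move=> v0 va; have two0 : (- 2 : C) != 0 by rewrite oppr_eq0 pnatr_eq0.
have [n hn] := finite_spectrum H (@affine_inj a _ two0).
have ex : exists n, v *m mpow F n == 0.
  exists n; apply: contraNT hn => nz.
  by apply: (eigenvector_eigenvalue nz); rewrite mulrN; apply: sl2_lower_weight.
have [[|k] /eqP k0 kmin] := ex_minnP ex; first by move: v0;
  rewrite -k0 /mpow /= mulmx1 eqxx.
by exists k => //; apply/negP => /kmin; rewrite ltnn.
Qed.

Lemma sl2_raise_nilpotent a v : v *m H = a *: v -> exists k, v *m mpow E k = 0.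
Proof.
move=> va; have two0 : (2 : C) != 0 by rewrite pnatr_eq0.
have [n hn] := finite_spectrum H (@affine_inj a _ two0).
exists n; apply/eqP; apply: contraNT hn => nz.
by apply: (eigenvector_eigenvalue nz); apply: sl2_raise_weight.
Qed.

(** If [k] is the last exponent with [v F^k <> 0], then [sl2_lower_raise] gives
    [(k + 1)(a - k) = 0]. *)
Lemma sl2_highest_weight a v : v != 0 -> v *m H = a *: v -> v *m E = 0 ->
  exists m : nat, a = m%:R.
Proof.
move=> v0 va ve; have [k nk zk] := sl2_lower_nilpotent v0 va.
exists k; have := sl2_lower_raise k va; rewrite zk mul0mx ve mul0mx add0r -scalemxAl.
move=> /esym/eqP; rewrite scaler_eq0 (negbTE nk) orbF mulf_eq0 pnatr_eq0 /= subr_eq0.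
by move/eqP.
Qed.

(** On a vector of nonnegative weight [E F] (first raise, then lower) has no
    negative eigenvalue, since raising such an eigenvector produces another one,
    and this cannot go on. *)
Lemma sl2_no_negative n v c k : v *m mpow E n = 0 -> v *m H = k%:R *: v -> 0 < c ->
  v *m E *m F = - c *: v -> v = 0.
Proof.
elim: n v c k => [|n IH] v c k vn vk c0 vc; first by rewrite /mpow /= mulmx1 in vn.
have EF : E *m F = F *m E - H by case: s => <- _ _; rewrite opprB addrC subrK.
suff e0 : v *m E = 0.
  move/eqP: vc; rewrite e0 mul0mx eq_sym scaler_eq0 oppr_eq0 gt_eqF //= => /eqP//.
have vE := sl2_raise_weight1 vk; rewrite -natrD in vE.
(* The raised vector has eigenvalue [- (c + k + 2)]. *)
apply: (IH _ (c + (k + 2)%:R) (k + 2)%N) => //; first by rewrite -mulmxA -mpowSl.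
  by rewrite ltr_wpDr // ler0n.
rewrite -mulmxA EF mulmxBr mulmxA vc vE -scalemxAl -scalerBl; congr (_ *: _); ring.
Qed.

(** On the weight space of weight [k], applying [F] and then [E] a total of
    [j <= k] times each is a product of operators [E F + c] with [c > 0], all of
    them injective by [sl2_no_negative]. *)
Lemma sl2_lower_inj k v : v *m H = k%:R *: v -> v *m mpow F k = 0 -> v = 0.
Proof.
move=> vk vF.
suff inj j u : (j <= k)%N -> u *m H = k%:R *: u -> u *m mpow F j *m mpow E j = 0 -> u = 0.
  by apply: (inj k) => //; rewrite vF mul0mx.
elim: j u => [|j IH] u jk uk; first by rewrite /mpow /= !mulmx1.
rewrite [mpow E _]mpowSl mulmxA (sl2_lower_raise _ uk) => z.
have : u *m E *m F + (j.+1%:R * (k%:R - j%:R)) *: u = 0.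
  apply: IH => //; first exact: ltnW.
  have := sl2_lower_weight1 (sl2_raise_weight1 uk); rewrite addrK => h.
  by rewrite mulmxDl h -scalemxAl uk scalerDr; congr (_ + _);
    rewrite !scalerA [in LHS]mulrC.
have [n un] := sl2_raise_nilpotent uk.
move/eqP; rewrite addr_eq0 -scaleNr => /eqP; apply: sl2_no_negative un uk _.
by rewrite mulr_gt0 ?ltr0n // -natrB ?(ltnW jk) // ltr0n subn_gt0.
Qed.

End Triple.
End Sl2.

Section Reflection.
Variables (C : numClosedFieldType) (l : nat).
Implicit Types (M N : slrep C l) (i j : 'I_l) (lam mu w : weight l).

Lemma sl2_root M i : sl2 (op M (raise C i)) (op M (lower C i)) (op M (coroot C i)).
Proof.
have R : coroot C i *m raise C i - raise C i *m coroot C i = 2 *: raise C i.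
  by rewrite coroot_raise mxE /cartanA eqxx.
have L : coroot C i *m lower C i - lower C i *m coroot C i = - 2 *: lower C i.
  rewrite coroot_bracket !eqxx [hi i == lo i]eq_sym (negbTE (lo_neq_hi i)).
  by congr (_ *: _); rewrite /= mulr0n mulr1n sub0r addr0 -opprD.
split; first by rewrite -op_bracket ?tr_raise ?tr_lower // -corootE.
- by rewrite -op_bracket ?tr_raise ?tr_coroot // R opZ ?tr_raise.
- by rewrite -op_bracket ?tr_lower ?tr_coroot // L opZ ?tr_lower.
Qed.

(** The eigenvalues [a] are arbitrary scalars, since integrality is only known
    once a highest weight vector has been found. *)
Lemma eigen_raise M (a : 'I_l -> C) i (v : 'rV_(sldim M)) :
  (forall j, v *m op M (coroot C j) = a j *: v) -> forall j,
  v *m op M (raise C i) *m op M (coroot C j) =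
    (a j + (sroot i 0 j)%:~R) *: (v *m op M (raise C i)).
Proof.
move=> wv j; rewrite -mulmxA.
have -> : op M (raise C i) *m op M (coroot C j) =
    op M (coroot C j) *m op M (raise C i) + (sroot i 0 j)%:~R *: op M (raise C i).
  rewrite -opZ ?tr_raise // -coroot_raise op_bracket ?tr_raise ?tr_coroot //.
  by rewrite addrC subrK.
by rewrite mulmxDr mulmxA wv -scalemxAl -scalemxAr -scalerDl.
Qed.

Lemma wtvec_raise M w i (v : 'rV_(sldim M)) :
  wtvec w v -> wtvec (w + sroot i) (v *m op M (raise C i)).
Proof. by move=> wv j; rewrite (eigen_raise i wv) [(w + _) 0 j]mxE intrD. Qed.

Lemma coroot_lower i j : coroot C i *m lower C j - lower C j *m coroot C i
  = - (sroot j 0 i)%:~R *: lower C j.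
Proof.
apply: trmx_inj; rewrite linearB linearZ /= !trmx_mul trmx_delta -/(raise C j).
have -> : (coroot C i)^T = coroot C i by rewrite /coroot linearB /= !trmx_delta.
by rewrite scaleNr -coroot_raise opprB.
Qed.

Lemma wtvec_lower M w i (v : 'rV_(sldim M)) :
  wtvec w v -> wtvec (w - sroot i) (v *m op M (lower C i)).
Proof.
move=> wv j; rewrite -mulmxA.
have -> : op M (lower C i) *m op M (coroot C j) =
    op M (coroot C j) *m op M (lower C i) - (sroot i 0 j)%:~R *: op M (lower C i).
  rewrite -scaleNr -opZ ?tr_lower // -coroot_lower op_bracket ?tr_lower ?tr_coroot //.
  by rewrite addrC subrK.
rewrite mulmxBr mulmxA wv -scalemxAl -scalemxAr -scalerBl.
by rewrite [(w - _) 0 j]mxE [fun_of_matrix (- _) _ _]mxE intrB.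
Qed.

Lemma weight_space_row M w (v : 'rV_(sldim M)) : (v <= weight_space M w)%MS <-> wtvec w v.
Proof. by split=> [/weight_spaceP|h] //; apply/weight_spaceP. Qed.

(** The power of a lowering operator, or of a raising operator for negative
    [w 0 i], that carries the weight space of [w] to the reflected one is
    injective. *)
Lemma weight_mult_le_reflection M w i :
  (weight_mult M w <= weight_mult M (w - w 0 i *: sroot i)%R)%N.
Proof.
rewrite /weight_mult.
suff [P sub inj] : exists2 P : 'M_(sldim M),
    forall v, wtvec w v -> wtvec (w - w 0 i *: sroot i) (v *m P) &
    forall v, wtvec w v -> v *m P = 0 -> v = 0.
  rewrite -(mxrank_mul_ker (weight_space M w) P).
  have -> : (weight_space M w :&: kermx P = 0)%MS.
    apply/eqP/rowV0P => v; rewrite sub_capmx => /andP[/weight_space_row wv /sub_kermxP].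
    exact: inj.
  rewrite mxrank0 addn0; apply/mxrankS/row_subP => r; rewrite row_mul.
  by apply/weight_space_row/sub/weight_space_row/row_sub.
have iter_wt (g : 'M_(sldim M)) (dl : weight l) k :
    (forall u v, wtvec u v -> wtvec (u + dl) (v *m g)) ->
    forall v, wtvec w v -> wtvec (w + k%:Z *: dl) (v *m mpow g k).
  move=> step; elim: k => [|k IH] v wv; first by rewrite scale0r addr0 /mpow /= mulmx1.
  by rewrite mpowS mulmxA intS scalerDl scale1r [dl + _]addrC addrA; apply/step/IH.
have S := sl2_root M i.
have [wi|wi] := leP 0 (w 0 i).
  exists (mpow (op M (lower C i)) (absz (w 0 i))) => [v wv|v wv].
    rewrite -scalerN -{1}[w 0 i]gez0_abs //; apply: iter_wt => // u u';
      exact: wtvec_lower.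
  by apply: (sl2_lower_inj S); rewrite wv -[in LHS](gez0_abs wi).
exists (mpow (op M (raise C i)) (absz (w 0 i))) => [v wv|v wv].
  rewrite -scaleNr -[- _]ltz0_abs //; apply: iter_wt => // u u'; exact: wtvec_raise.
apply: (sl2_lower_inj (sl2_sym S)); rewrite mulmxN wv -scaleNr.
by congr (_ *: _); rewrite -intrN -ltz0_abs.
Qed.

(** Reflections raise each weight to its dominant conjugate without changing the
    multiplicity, and that conjugate only depends on the orbit. *)
Lemma weight_mult_weyl M w s : weight_mult M (weyl_act s w) = weight_mult M w.
Proof.
have refl x i : weight_mult M (weyl_act (tperm (lo i) (hi i)) x) = weight_mult M x.
  apply/eqP; rewrite eqn_leq; apply/andP; split; last first.
    by rewrite weyl_act_sreflection weight_mult_le_reflection.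
  rewrite -{2}(weyl_actK (tperm (lo i) (hi i)) x) tpermV.
  by rewrite [X in (_ <= weight_mult M X)%N]weyl_act_sreflection
    weight_mult_le_reflection.
have top x : exists2 y, dominant y & (exists t, y = weyl_act t x) /\ weight_mult M y =
  weight_mult M x.
  elim/(@raising_ind l): x => [y dy|x i _ [y dy [[t yt] my]]].
    by exists y => //; split=> //; exists 1%g; rewrite weyl_act1.
  by exists y => //; split; [exists (tperm (lo i) (hi i) * t)%g;
    rewrite -weyl_actM | rewrite my refl].
have [y dy [[t yt] <-]] := top w; have [y' dy' [[t' yt'] <-]] := top (weyl_act s w).
suff -> : y' = y by [].
move: dy'; rewrite yt' -[w](weyl_actK t) -yt !weyl_actM => dy'.
exact: dominant_conj_unique.
Qed.

End Reflection.

(** * Highest weight vectors *)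

Section SpanBasis.
Variables (C : fieldType) (d : nat).

(** A maximal linearly independent choice of vectors with the property [P]; since
    the basis consists of such vectors, weight vectors give bases of weight
    vectors. *)
Lemma span_basis (P : 'rV[C]_d -> Prop) : exists r (B : 'M[C]_(r, d)),
  [/\ row_free B, forall k, P (row k B) & forall u, P u -> (u <= B)%MS].
Proof.
pose Q r := `[< exists B : 'M[C]_(r, d), row_free B /\ forall k, P (row k B) >].
have Q0 : exists r, Q r.
  exists 0%N; apply/asboolP; exists 0; split; last by case.
  by rewrite -row_leq_rank leq0n.
have Qd r : Q r -> (r <= d)%N.
  by move=> /asboolP[B [fB _]]; rewrite -(eqP fB) rank_leq_col.
have [r /asboolP[B [fB PB]] rmax] := ex_maxnP Q0 Qd.
exists r, B; split=> // u Pu; apply: contraT => nu.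
have : Q (1 + r)%N.
  apply/asboolP; exists (col_mx u B); split.
    rewrite -row_leq_rank -(addsmxE u B) add1n -[X in (X < _)%N](eqP fB).
    have : (B < u + B)%MS by rewrite ltmxE addsmxSr addsmx_sub (negbTE nu).
    by rewrite ltmxErank => /andP[].
  move=> k; case: (split_ordP k) => j ->; last by rewrite rowKd.
  by rewrite rowKu ord1 row_id.
by move/rmax; rewrite add1n ltnn.
Qed.

Lemma row_free_rowsub m (A : 'M[C]_(m, d)) k (f : 'I_k -> 'I_m) :
  injective f -> row_free A -> row_free (rowsub f A).
Proof.
move=> injf /row_freeP[A' AA']; apply/row_freeP; exists (A' *m colsub f 1%:M).
have -> : rowsub f A = rowsub f 1%:M *m A.
  apply/matrixP => a b; rewrite !mxE (bigD1 (f a)) //= big1 ?mxE ?eqxx ?mul1r ?addr0 //.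
  by move=> j ja; rewrite !mxE eq_sym (negbTE ja) mul0r.
rewrite -!mulmxA [A *m (A' *m _)]mulmxA AA' mul1mx.
apply/matrixP => a b; rewrite !mxE (bigD1 (f a)) //= big1 ?addr0.
  by rewrite !mxE eqxx mul1r (inj_eq injf).
by move=> j ja; rewrite !mxE eq_sym (negbTE ja) mul0r.
Qed.

End SpanBasis.

Section HighestWeight.
Variables (C : numClosedFieldType) (l : nat).
Implicit Types (M N : slrep C l) (i j : 'I_l) (lam mu w : weight l).

Definition highest_vec M lam (v : 'rV[C]_(sldim M)) : Prop :=
  [/\ v != 0, wtvec lam v & forall i, v *m op M (raise C i) = 0].

Lemma coroot_comm M i j : comm_mx (op M (coroot C i)) (op M (coroot C j)).
Proof.
have Z (a : 'I_l.+1) : coroot C j *m delta_mx a a - delta_mx a a *m coroot C j = 0.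
  by rewrite coroot_bracket [X in X *: _](_ : _ = 0) ?scale0r //; ring.
have E : coroot C j *m coroot C i - coroot C i *m coroot C j = 0.
  transitivity ((coroot C j *m delta_mx (lo i) (lo i) - delta_mx (lo i) (lo i) *m
    coroot C j) -
    (coroot C j *m delta_mx (hi i) (hi i) - delta_mx (hi i) (hi i) *m coroot C j)).
    rewrite [coroot C i]/coroot; move: (coroot C j) => X.
    by rewrite mulmxBr mulmxBl !opprD !opprK addrACA.
  by rewrite !Z subrr.
by apply/eqP; rewrite -subr_eq0 -op_bracket ?tr_coroot // E op0.
Qed.

(** Start from a common eigenvector of the coroots and raise it as long as
    possible. *)
Lemma highest_vec_exists M : (0 < sldim M)%N -> exists lam v, @highest_vec M lam v.
Proof.
move=> d0; pose cev (v : 'rV_(sldim M)) (a : 'I_l -> C) :=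
  v != 0 /\ forall j, v *m op M (coroot C j) = a j *: v.
have [v0 [a0 cev0]] : exists v a, cev v a.
  have [|v vn0 /allP ev] :=
    @common_eigenvector _ _ [seq op M (coroot C i) | i <- enum 'I_l] d0.
    move=> A B /mapP[i _ ->] /mapP[j _ ->]; exact: coroot_comm.
  have /choice[a aP] : forall j, exists c, v *m op M (coroot C j) = c *: v.
    by move=> j; apply/sub_rVP/ev/map_f; rewrite mem_enum.
  by exists v, a.
(* The operator [A] is the sum of the positive coroots; raising increases its
   eigenvalue by 2. *)
pose c (j : 'I_l) : int := (j.+1 * (l - j))%:Z.
pose A := \sum_j (c j)%:~R *: op M (coroot C j).
pose t (a : 'I_l -> C) := \sum_j (c j)%:~R * a j.
have cevA v a : cev v a -> v *m A = t a *: v.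
  move=> [_ va]; rewrite mulmx_sumr scaler_suml; apply: eq_bigr => j _.
  by rewrite -scalemxAr va scalerA.
have two0 : (2 : C) != 0 by rewrite pnatr_eq0.
have [[v [a [[vn va] vr]]]|no] :=
  pselect (exists v a, cev v a /\ forall i, v *m op M (raise C i) = 0).
  have ai i : exists m : nat, a i = m%:R by apply: (sl2_highest_weight (sl2_root M i) vn).
  have /choice[m mP] := ai; exists (\row_i (m i)%:Z), v; split=> // i.
  by rewrite va mP mxE.
have chain n : exists v a, cev v a /\ t a = t a0 + n%:R * 2.
  elim: n => [|n [v [a [cv ta]]]]; first by exists v0, a0; rewrite mul0r addr0.
  have [i ri] : exists i, v *m op M (raise C i) != 0.
    apply: contrapT => /forallNP h; apply: no; exists v, a; split=> // i.
    by apply/eqP; apply: contrapT => /negP; apply: h.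
  exists (v *m op M (raise C i)), (fun j => a j + (sroot i 0 j)%:~R).
  split; first by split=> //; apply: eigen_raise; case: cv.
  rewrite -natr1 mulrDl mul1r addrA -ta /t.
  rewrite (eq_bigr (fun j => (c j)%:~R * a j + (c j * sroot i 0 j)%:~R)); last first.
    by move=> j _; rewrite mulrDr intrM.
  rewrite big_split /=; congr (_ + _); rewrite -rmorph_sum /=.
  have := height_sroot i; rewrite /height => h.
  by rewrite (eq_bigr (fun j => sroot i 0 j * c j)) ?h // => j _; rewrite mulrC.
have [n] := finite_spectrum A (@affine_inj C (t a0) 2 two0).
have [v [a [cv <-]]] := chain n.
by case/negP; apply: eigenvector_eigenvalue (cevA _ _ cv); case: cv.
Qed.

Lemma highest_vec_dominant M lam v : @highest_vec M lam v -> dominant lam.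
Proof.
move=> [v0 wv vr] i; have [m] := sl2_highest_weight (sl2_root M i) v0 (wv i) (vr i).
by move/eqP; rewrite -[m%:R]/((m%:Z)%:~R) eqr_int => /eqP->.
Qed.

(** The vectors obtained from [v] by words in the lowering operators, with their
    weights. *)
Inductive lowered M lam (v : 'rV[C]_(sldim M)) : weight l -> 'rV[C]_(sldim M) -> Prop :=
| lowered_nil : lowered lam v lam v
| lowered_cons w u i : lowered lam v w u ->
    lowered lam v (w - sroot i) (u *m op M (lower C i)).

Lemma lowered_wt M lam v w u : @highest_vec M lam v -> lowered lam v w u ->
  [/\ wtvec w u, root_le w lam & w = lam -> u = v].
Proof.
move=> [v0 wv vr]; elim=> [|{}w {}u i _ [wu le _]]; first by split=> //;
  apply: root_le_refl.
have le1 : root_le (w - sroot i) w.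
  exists (fun j => (j == i)); rewrite subKr (bigD1 i) //= eqxx big1 ?addr0 // => j ji.
  by rewrite (negbTE ji) mulr0n.
split; first exact: wtvec_lower; first exact: root_le_trans le1 le.
move=> e; have [h _] := root_le_height le.
by move: h; rewrite -e heightD heightN height_sroot; lia.
Qed.

Definition wt_rows M r (B : 'M[C]_(r, sldim M)) (w : 'I_r -> weight l) : Prop :=
  row_free B /\ forall k, wtvec (w k) (row k B).

(** The span of the lowered vectors is stable under the raising operators by
    induction on the word, since a raising operator commutes with a lowering
    operator up to a coroot. A nonempty word strictly decreases the height, so
    [v] is the only word of weight [lam]. *)
Lemma highest_vec_span M lam v : @highest_vec M lam v ->
  exists r (B : 'M[C]_(r, sldim M)) (w : 'I_r -> weight l),
    [/\ wt_rows B w, stable B, (v <= B)%MS, forall k, root_le (w k) lam &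
        forall k, w k = lam -> row k B = v].
Proof.
move=> hv; have [v0 wv vr] := hv.
have [r [B [fB PB sB]]] := span_basis (fun u => exists w, lowered lam v w u).
have /choice[w wP] := PB; exists r, B, w.
have sub w' u : lowered lam v w' u -> (u <= B)%MS by move=> h; apply: sB; exists w'.
have lowB i : (B *m op M (lower C i) <= B)%MS.
  apply/row_subP => k; rewrite row_mul; apply: sub; exact: lowered_cons (wP k).
have raiseB i w' u : lowered lam v w' u -> (u *m op M (raise C i) <= B)%MS.
  elim=> [|{}w' {}u j lu IH]; first by rewrite vr sub0mx.
  have -> : u *m op M (lower C j) *m op M (raise C i) =
      u *m op M (raise C i) *m op M (lower C j) + (i == j)%:R *: (u *m op M (coroot C i)).
    rewrite -!mulmxA scalemxAr -mulmxDr; congr (_ *m _); apply/eqP.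
    rewrite addrC -subr_eq -op_bracket ?tr_raise ?tr_lower //; apply/eqP.
    have [<-|ij] := eqVneq i j; first by rewrite scale1r corootE.
    rewrite scale0r /raise /lower !mul_delta_mx_0 ?subrr ?op0 //.
      by apply: contraNneq ij => e; apply/eqP/val_inj; have := congr1 val e;
        rewrite /= /bump /=; lia.
  rewrite addmx_sub ?scalemx_sub //; first by apply: submx_trans (submxMr _ IH) (lowB j).
  by have [wu _ _] := lowered_wt hv lu; rewrite wu scalemx_sub // (sub _ _ lu).
split.
- by split=> // k; have [] := lowered_wt hv (wP k).
- apply: stable_gen => // i; apply/row_subP => k; rewrite row_mul; exact: raiseB (wP k).
- exact/sub/lowered_nil.
- by move=> k; have [] := lowered_wt hv (wP k).
- by move=> k; have [] := lowered_wt hv (wP k).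
Qed.

(** Weight vectors of distinct weights are independent. *)
Lemma wt_rows_coef M r (B : 'M[C]_(r, sldim M)) (w : 'I_r -> weight l) x (c : 'rV_r) :
  wt_rows B w -> wtvec x (c *m B) -> forall k, c 0 k != 0 -> w k = x.
Proof.
move=> [fB wB] wc k ck; apply/rowP => i.
have E : (\row_k (c 0 k * (w k 0 i)%:~R) : 'rV[C]_r) = (x 0 i)%:~R *: c.
  apply: (row_free_inj fB);
    rewrite -scalemxAl -(wc i) [LHS]mulmx_sum_row [c *m B]mulmx_sum_row mulmx_suml.
  by apply: eq_bigr => j _; rewrite mxE -scalemxAl wB scalerA.
have := congr1 (fun u : 'rV_r => u 0 k) E; rewrite !mxE mulrC.
by move/(mulIf ck)/eqP; rewrite eqr_int => /eqP.
Qed.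

Lemma wt_rows_mult M r (B : 'M[C]_(r, sldim M)) (w : 'I_r -> weight l) x :
  wt_rows B w -> row_full B ->
  weight_mult M x = #|[set k | w k == x]%SET|.
Proof.
move=> wB fullB; have [fB wvB] := wB; set A := [set k | _]%SET.
have /eqP <- := row_free_rowsub (@enum_val_inj _ (mem A)) fB.
apply: eqmx_rank; apply/andP; split; last first.
  apply/row_subP => k; rewrite row_rowsub; apply/weight_space_row.
  by have := enum_valP k; rewrite inE => /eqP <-.
apply/rV_subP => u /weight_space_row wu.
have /submxP[c uc] : (u <= B)%MS by apply: submx_full.
rewrite uc in wu *; rewrite mulmx_sum_row summx_sub // => k _.
have [->|ck] := eqVneq (c 0 k) 0; first by rewrite scale0r sub0mx.
have kA : k \in A by rewrite inE (wt_rows_coef wB wu ck).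
rewrite scalemx_sub // -(enum_rankK_in kA kA) -row_rowsub; exact: row_sub.
Qed.

Lemma irr_full M m (U : 'M[C]_(m, sldim M)) : slirr M -> stable U -> U != 0 -> row_full U.
Proof.
move=> [_ irr] sU U0; have := irr <<U>>%MS; 
rewrite (eqmx_eq0 (genmxE U)) /row_full genmxE; apply=> // x x0.
by rewrite (eqmxMr _ (genmxE U)) genmxE; apply: sU.
Qed.

Lemma irr_weight_basis M lam v : slirr M -> highest_vec lam v ->
  exists r (B : 'M[C]_(r, sldim M)) (w : 'I_r -> weight l),
    [/\ wt_rows B w, row_full B, forall k, root_le (w k) lam &
        forall k, w k = lam -> row k B = v].
Proof.
move=> irr hv; have [r [B [w [wB sB vle le top]]]] := highest_vec_span hv.
exists r, B, w; split=> //; apply: irr_full => //; have [v0 _ _] := hv.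
by apply: contraNneq v0 => B0; apply/eqP/(@submx0null _ _ r); rewrite -B0.
Qed.

Lemma irr_weight_le M lam v x : slirr M -> @highest_vec M lam v ->
  (0 < weight_mult M x)%N -> root_le x lam.
Proof.
move=> irr hv; have [r [B [w [wB fB le _]]]] := irr_weight_basis irr hv.
by rewrite (wt_rows_mult x wB fB) card_gt0 => /set0Pn[k]; rewrite inE => /eqP<-.
Qed.

(** The dominant conjugate of a weight is again a weight, hence below [lam]. *)
Lemma irr_weight_Pi M lam v x : slirr M -> @highest_vec M lam v ->
  (0 < weight_mult M x)%N -> Pi lam x.
Proof.
move=> irr hv mx; have [s ds] := dominant_conj x.
rewrite -[x](weyl_actK s); apply/Pi_weyl/Pi_dominant => //.
by apply: (irr_weight_le irr hv); rewrite weight_mult_weyl.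
Qed.

Lemma irr_weight_top M lam v : slirr M -> @highest_vec M lam v ->
  weight_mult M lam = 1%N /\ (weight_space M lam <= v)%MS.
Proof.
move=> irr hv; have [r [B [w [wB fB le top]]]] := irr_weight_basis irr hv.
have [v0 wv _] := hv.
have sub : (weight_space M lam <= v)%MS.
  apply/rV_subP => u /weight_space_row wu.
  have /submxP[c uc] : (u <= B)%MS by apply: submx_full.
  rewrite uc in wu *; rewrite mulmx_sum_row summx_sub // => k _.
  have [->|ck] := eqVneq (c 0 k) 0; first by rewrite scale0r sub0mx.
  by rewrite (top k) ?scalemx_sub //; apply: wt_rows_coef wB wu k ck.
split=> //; have e : (weight_space M lam == v)%MS.
  by apply/andP; split=> //; apply/weight_space_row.
by rewrite /weight_mult (eqmx_rank e) rank_rV v0.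
Qed.

End HighestWeight.

(** * Schur's lemma and uniqueness of irreducible modules *)

Section Schur.
Variables (C : numClosedFieldType) (l : nat).
Implicit Types (M N : slrep C l) (i j : 'I_l) (lam mu w : weight l).

Definition intertwines M N (Q : 'M[C]_(sldim M, sldim N)) : Prop :=
  forall x, \tr x = 0 -> op M x *m Q = Q *m op N x.

Lemma slhom_intertwines M N (P : 'M[C]_(sldim N, sldim M)) :
  slhom P <-> intertwines P^T.
Proof.
split=> h x x0; first by rewrite /op -!trmx_mul h.
by apply: trmx_inj; rewrite !trmx_mul; apply: h.
Qed.

Lemma intertwines_comp M N K (Q : 'M[C]_(sldim M, sldim N)) (Q' : 'M[C]_(sldim N,
  sldim K)) :
  intertwines Q -> intertwines Q' -> @intertwines M K (Q *m Q').
Proof. by move=> h h' x x0; rewrite mulmxA h // -!mulmxA h'. Qed.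

Lemma intertwines_pinv M N (Q : 'M[C]_(sldim M, sldim N)) :
  intertwines Q -> row_free Q -> row_full Q -> @intertwines N M (pinvmx Q).
Proof.
move=> h fQ fuQ x x0; apply: (row_free_inj fQ).
have := mulVpmx fuQ; move: (pinvmx Q) => P e.
by rewrite -!mulmxA h // e mulmx1 mulmxA e mul1mx.
Qed.

(** Kernel and image are submodules. *)
Lemma schur_bij M N (Q : 'M[C]_(sldim M, sldim N)) : slirr M -> slirr N ->
  intertwines Q -> Q != 0 -> row_free Q && row_full Q.
Proof.
move=> iM iN h Q0; apply/andP; split; last first.
  by apply: irr_full => // x x0; rewrite -h // submxMl.
rewrite -kermx_eq0; apply: contraT => K0.
have : row_full (kermx Q).
  apply: irr_full K0 => // x x0; apply/sub_kermxP.
  by rewrite -mulmxA h // mulmxA mulmx_ker mul0mx.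
move=> /row_fullP[D DK]; case/negP: Q0.
by rewrite -[Q]mul1mx -DK -mulmxA mulmx_ker mulmx0.
Qed.

(** An eigenspace of the endomorphism obtained by inverting [Q] is a nonzero
    submodule. *)
Lemma schur_scalar M N (Q Q' : 'M[C]_(sldim M, sldim N)) : slirr M -> slirr N ->
  intertwines Q -> intertwines Q' -> Q != 0 -> exists c, Q' = c *: Q.
Proof.
move=> iM iN h h' Q0; have /andP[fQ fuQ] := schur_bij iM iN h Q0.
have [T hT ->] : exists2 T, @intertwines M M T & Q' = T *m Q.
  exists (Q' *m pinvmx Q); first exact: intertwines_comp h' (intertwines_pinv h fQ fuQ).
  by rewrite -mulmxA mulVpmx // mulmx1.
have [d0 _] := iM; have [a ev] := eigenvalue_closed T d0.
exists a; have fuE : row_full (eigenspace T a).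
  apply: irr_full => // x x0; apply/eigenspaceP.
  have := eigenspaceP (submx_refl (eigenspace T a)); move: (eigenspace T a) => K KT.
  by rewrite -mulmxA hT // mulmxA KT scalemxAl.
have /eigenspaceP : (1%:M <= eigenspace T a)%MS by rewrite sub1mx.
by rewrite mul1mx => ->; rewrite -scalemxAl mul1mx.
Qed.

Lemma sliso_intertwines M N :
  sliso M N <-> exists Q : 'M[C]_(sldim M, sldim N), [/\ intertwines Q,
    row_free Q & row_full Q].
Proof.
have rt m n (A : 'M[C]_(m, n)) : row_free A^T = row_full A by rewrite /row_free mxrank_tr.
have rt' m n (A : 'M[C]_(m, n)) : row_full A^T = row_free A
  by rewrite /row_full mxrank_tr.
split=> [[P /slhom_intertwines hP /andP[f fu]]|[Q [hQ f fu]]].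
  by exists P^T; rewrite rt rt'.
by exists Q^T; rewrite ?rt ?rt' ?f ?fu //; apply/slhom_intertwines; rewrite trmxK.
Qed.

Lemma sliso_sym M N : sliso M N -> sliso N M.
Proof.
move=> /sliso_intertwines[Q [h f fu]]; apply/sliso_intertwines; exists (pinvmx Q).
split; first exact: intertwines_pinv.
  by apply/row_freeP; exists Q; rewrite mulVpmx.
by apply/row_fullP; exists Q; rewrite mulmxVp.
Qed.

Lemma sliso_highest_vec M N lam v : sliso M N -> @highest_vec C l M lam v ->
  exists u, @highest_vec C l N lam u.
Proof.
move=> /sliso_intertwines[Q [h f fu]] [v0 wv vr]; exists (v *m Q); split.
- by apply: contraNneq v0 => /eqP; rewrite mulmx_free_eq0.
- by move=> i; rewrite -mulmxA -h ?tr_coroot // mulmxA wv scalemxAl.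
- by move=> i; rewrite -mulmxA -h ?tr_raise // mulmxA vr mul0mx.
Qed.

Lemma sliso_weight_mult M N w : sliso M N -> weight_mult M w = weight_mult N w.
Proof.
have le (A B : slrep C l) : sliso A B -> (weight_mult A w <= weight_mult B w)%N.
  move=> /sliso_intertwines[Q [h f fu]]; rewrite /weight_mult -(mxrankMfree _ f).
  apply/mxrankS/weight_spaceP => i; rewrite -mulmxA -h ?tr_coroot // mulmxA.
  by rewrite (weight_spaceP _ _ (submx_refl _)) scalemxAl.
by move=> iso; apply/eqP; rewrite eqn_leq !le //; apply: sliso_sym.
Qed.

(** Each of the two highest weights is a weight, hence below the other. *)
Lemma irr_highest_weight_unique M lam mu v u : slirr M ->
  @highest_vec C l M lam v -> @highest_vec C l M mu u -> lam = mu.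
Proof.
move=> iM hv hu; apply: root_le_anti.
  by apply: (irr_weight_le iM hu); have [->] := irr_weight_top iM hv.
by apply: (irr_weight_le iM hv); have [->] := irr_weight_top iM hu.
Qed.

Section DirectSum.
Variables M N : slrep C l.

Definition dsum_act (x : 'M[C]_l.+1) : 'M[C]_(sldim M + sldim N) :=
  block_mx (M x) 0 0 (N x).

Lemma dsum_act_linear a x y : \tr x = 0 -> \tr y = 0 ->
  dsum_act (a *: x + y) = a *: dsum_act x + dsum_act y.
Proof.
by move=> x0 y0; rewrite /dsum_act !slact_linear // scale_block_mx add_block_mx !scaler0
  !addr0.
Qed.

Lemma dsum_act_bracket x y : \tr x = 0 -> \tr y = 0 ->
  dsum_act (x *m y - y *m x) = dsum_act x *m dsum_act y - dsum_act y *m dsum_act x.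
Proof.
move=> x0 y0; rewrite /dsum_act !slact_bracket // !mulmx_block opp_block_mx add_block_mx.
by rewrite !mul0mx !mulmx0 !addr0 !add0r !oppr0.
Qed.

(** The ambient module in which [highest_vec_iso] constructs a graph. *)
Definition sldsum : slrep C l := SlRep dsum_act_linear dsum_act_bracket.

Lemma op_dsum m (A : 'M[C]_(m, sldim M)) (B : 'M[C]_(m, sldim N)) x :
  (row_mx A B : 'M_(m, sldim sldsum)) *m op sldsum x = row_mx (A *m op M x) (B *m op N x).
Proof. by rewrite /op tr_block_mx !trmx0 mul_row_block !mulmx0 addr0 add0r. Qed.

End DirectSum.

(** The submodule of the direct sum generated by the pair [(v, u)] is the graph of
    an isomorphism: its weight space at [lam] is the line of [(v, u)], so it meets
    the second summand trivially. By irreducibility it projects isomorphically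
    onto the first one, and the resulting homomorphism is nonzero. *)
Lemma highest_vec_iso M N lam v u : slirr M -> slirr N ->
  @highest_vec C l M lam v -> @highest_vec C l N lam u -> sliso M N.
Proof.
move=> iM iN hv hu; have [v0 wv vr] := hv; have [u0 wu ur] := hu.
pose vu : 'rV_(sldim (sldsum M N)) := row_mx v u.
have hvu : @highest_vec C l (sldsum M N) lam vu.
  split.
  - apply: contraNneq v0 => /(congr1 lsubmx); rewrite row_mxKl => ->.
    by rewrite linear0.
  - by move=> i; rewrite op_dsum wv wu scale_row_mx.
  - by move=> i; rewrite op_dsum vr ur row_mx0.
have [r [B [w [wB sB vuB _ top]]]] := highest_vec_span hvu.
have [fB _] := wB.
pose B1 : 'M_(r, sldim M) := lsubmx (B : 'M_(r, sldim M + sldim N)).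
pose B2 : 'M_(r, sldim N) := rsubmx (B : 'M_(r, sldim M + sldim N)).
have BE : B = row_mx B1 B2 by rewrite hsubmxK.
have CB x : \tr x = 0 -> exists D, B1 *m op M x = D *m B1 /\ B2 *m op N x = D *m B2.
  move=> x0; have /submxP[D] := sB x x0;
    rewrite BE op_dsum mul_mx_row => /eq_row_mx[e1 e2].
  by exists D.
have [c1 vc] : exists c, vu = c *m B by apply/submxP.
move: vc; rewrite BE mul_mx_row => /eq_row_mx[vc uc].
have fu1 : row_full B1.
  apply: irr_full => // [x x0|].
    by have [D [-> _]] := CB x x0; rewrite submxMl.
  by apply: contraNneq v0 => e; rewrite vc e mulmx0.
(* If the kernel of the first projection is nonzero, it gives all of [N] and
   contains [(0, u)], which has weight [lam] but is no multiple of [(v, u)]. *)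
have f1 : row_free B1.
  rewrite -kermx_eq0; apply/eqP/(row_free_inj fB); rewrite mul0mx BE mul_mx_row mulmx_ker.
  suff -> : kermx B1 *m B2 = 0 by rewrite row_mx0.
  apply/eqP; apply: contraT => K0.
  have /row_fullP[D DK] : row_full (kermx B1 *m B2).
    apply: irr_full K0 => // x x0; have [D [e1 e2]] := CB x x0.
    rewrite -mulmxA e2 mulmxA; apply: submxMr; apply/sub_kermxP.
    by rewrite -mulmxA -e1 mulmxA mulmx_ker mul0mx.
  pose c := u *m D *m kermx B1.
  have cB : c *m B = row_mx 0 u.
    rewrite BE mul_mx_row /c; congr row_mx; first by rewrite -mulmxA mulmx_ker mulmx0.
    by rewrite -mulmxA -mulmxA DK mulmx1.
  have wc : @wtvec C l (sldsum M N) lam (c *m B).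
    by move=> i; rewrite cB op_dsum wu mul0mx scale_row_mx scaler0.
  have : (row_mx 0 u <= vu)%MS.
    rewrite -cB mulmx_sum_row summx_sub // => k _.
    have [->|ck] := eqVneq (c 0 k) 0; first by rewrite scale0r sub0mx.
    by rewrite (top k) ?scalemx_sub //; apply: wt_rows_coef wB wc k ck.
  move=> /sub_rVP[a]; rewrite scale_row_mx => /eq_row_mx[/esym/eqP].
  rewrite scaler_eq0 (negbTE v0) orbF => /eqP-> /eqP.
  by rewrite scale0r (negbTE u0).
have [P P1 P2] : exists2 P, P *m B1 = 1%:M & B1 *m P = 1%:M.
  by exists (pinvmx B1); [apply: mulVpmx | apply: mulmxVp].
pose Q := P *m B2.
have hQ : intertwines Q.
  move=> x x0; have [D [e1 e2]] := CB x x0.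
  have eM : op M x = P *m D *m B1 by rewrite -mulmxA -e1 mulmxA P1 mul1mx.
  by rewrite /Q eM -!mulmxA e2 [B1 *m (P *m _)]mulmxA P2 mul1mx.
have Q0 : Q != 0.
  apply: contraNneq u0 => e; apply/eqP; rewrite uc -[B2]mul1mx -P2 -mulmxA -/Q e.
  by rewrite !mulmx0.
by have /andP[f fu] := schur_bij iM iN hQ Q0; apply/sliso_intertwines; exists Q.
Qed.

End Schur.

(** * Direct sum decompositions and tensor products *)

Section Decomposition.
Variables (C : numClosedFieldType) (l : nat).
Implicit Types (M N : slrep C l) (lam mu w : weight l).

Definition decomposition M k (S : 'I_k -> slrep C l)
    (P : forall a, 'M[C]_(sldim M, sldim (S a))) :=
  [/\ forall a, slirr (S a), forall a, slhom (P a) &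
      row_free (\mxrow_a P a) && row_full (\mxrow_a P a)].

Section Fixed.
Variables (M : slrep C l) (k : nat) (S : 'I_k -> slrep C l).
Variable (P : forall a, 'M[C]_(sldim M, sldim (S a))).
Hypothesis decP : decomposition P.
Local Notation Q := (\mxcol_a (P a)^T).

Lemma decomposition_rank : row_free Q /\ row_full Q.
Proof.
case: decP => _ _ /andP[f fu].
by rewrite /row_free /row_full -tr_mxrow mxrank_tr.
Qed.

Lemma decomposition_intertwines a : intertwines (P a)^T.
Proof. by case: decP => _ /(_ a) h _; apply/slhom_intertwines. Qed.

Lemma decomposition_free m (c : forall a, 'M_(m, sldim (S a))) :
  \sum_a c a *m (P a)^T = 0 -> forall a, c a = 0.
Proof.
move=> c0 a; have [f _] := decomposition_rank.
have : \mxrow_a c a = 0 by apply: (row_free_inj f); rewrite mul_mxrow_mxcol mul0mx.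
by move/(congr1 (fun A => submxrow A a)); rewrite mxrowK submxrow0.
Qed.

Lemma decomposition_full m (v : 'M_(m, sldim M)) :
  exists c : forall a, 'M_(m, sldim (S a)), v = \sum_a c a *m (P a)^T.
Proof.
have [_ fu] := decomposition_rank; have /submxP[c vc] : (v <= Q)%MS by apply: submx_full.
by exists (submxrow c); rewrite -mul_mxrow_mxcol submxrowK.
Qed.

Lemma decomposition_op m (c : forall a, 'M_(m, sldim (S a))) x : \tr x = 0 ->
  (\sum_a c a *m (P a)^T) *m op M x = \sum_a (c a *m op (S a) x) *m (P a)^T.
Proof.
move=> x0; rewrite mulmx_suml; apply: eq_bigr => a _.
by rewrite -!mulmxA decomposition_intertwines.
Qed.

Lemma decomposition_eigen m (c : forall a, 'M_(m, sldim (S a))) x z : \tr x = 0 ->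
  (\sum_a c a *m (P a)^T) *m op M x = z *: (\sum_a c a *m (P a)^T) ->
  forall a, c a *m op (S a) x = z *: c a.
Proof.
move=> x0; rewrite decomposition_op // scaler_sumr => /eqP;
  rewrite -subr_eq0 -sumrB => /eqP e a.
apply/eqP; rewrite -subr_eq0; apply/eqP.
apply: (decomposition_free (c := fun a => c a *m op (S a) x - z *: c a)).
by rewrite -[RHS]e; apply: eq_bigr => b _; rewrite mulmxBl scalemxAl.
Qed.

(** In the coordinates of the decomposition the weight space is block
    diagonal. *)
Lemma decomposition_mult w : weight_mult M w = (\sum_a weight_mult (S a) w)%N.
Proof.
have [f fu] := decomposition_rank.
rewrite /weight_mult -rank_mxdiag -(mxrankMfree _ f) mul_mxdiag_mxcol.
apply: eqmx_rank; apply/andP; split.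
  rewrite eqmx_col; apply/rV_subP => v /weight_space_row wv.
  have [c vc] := decomposition_full v; rewrite vc; apply: summx_sub => a _.
  apply: (submx_trans _ (sumsmx_sup a isT (submx_refl _))); rewrite genmxE;
    apply: submxMr.
  apply/weight_space_row => i; apply: (decomposition_eigen (tr_coroot C i)).
  by rewrite -vc wv.
rewrite eqmx_col; apply/sumsmx_subP => a _; rewrite genmxE; apply/weight_spaceP => i.
rewrite -mulmxA -decomposition_intertwines ?tr_coroot // mulmxA.
by rewrite (weight_spaceP _ _ (submx_refl _)) scalemxAl.
Qed.

(** Every nonzero component of a highest weight vector is one. *)
Lemma decomposition_highest_vec lam v : @highest_vec C l M lam v ->
  exists a u, @highest_vec C l (S a) lam u.
Proof.
move=> [v0 wv vr]; have [c vc] := decomposition_full v.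
have [a ca] : exists a, c a != 0.
  apply: contrapT => /forallNP no; case/negP: v0; rewrite vc; apply/eqP/big1 => a _.
  by have /negP := no a; rewrite negbK => /eqP ->; rewrite mul0mx.
exists a, (c a); split=> // i.
  by apply: (decomposition_eigen (tr_coroot C i)); rewrite -vc wv.
rewrite -[RHS](scale0r (c a)); apply: (decomposition_eigen (tr_raise C i)).
by rewrite -vc vr scale0r.
Qed.

(** The kernel of one block is a relation among all of them. *)
Lemma decomposition_inj a : row_free (P a)^T.
Proof.
rewrite -kermx_eq0; apply/eqP.
(* The kernel placed in the block [a]; the cast is along an equation [a = a]. *)
pose c b : 'M_(sldim (S a), sldim (S b)) :=
  if a =P b is ReflectT e then castmx (erefl, congr1 (fun b =>
    sldim (S b)) e) (kermx (P a)^T) else 0.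
have : c a = 0.
  apply: (decomposition_free (c := c)); rewrite (bigD1 a) //= big1 => [|b ba].
    by rewrite /c; case: eqP => // e; rewrite (eq_axiomK e) castmx_id mulmx_ker addr0.
  rewrite /c; case: eqP => [e|_]; last by rewrite mul0mx.
  by rewrite e eqxx in ba.
by rewrite /c; case: eqP => // e; rewrite (eq_axiomK e) castmx_id.
Qed.

End Fixed.

Lemma sum_tens m n (F : 'I_(m * n) -> C) :
  \sum_i F i = \sum_a \sum_b F (mxtens_index (a, b)).
Proof.
rewrite pair_big /= (reindex (@mxtens_index m n)) /=; first by apply: eq_bigr => -[].
by exists (@mxtens_unindex _ _) => ? _; rewrite ?mxtens_indexK ?mxtens_unindexK.
Qed.

Lemma tensmx1 m n : (1%:M : 'M[C]_m) *t (1%:M : 'M[C]_n) = 1%:M.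
Proof.
apply/matrixP => i j; rewrite -(mxtens_unindexK i) -(mxtens_unindexK j).
case: (mxtens_unindex i) => a b; case: (mxtens_unindex j) => a' b'.
rewrite tensmxE !mxE (can_eq (@mxtens_indexK m n)) xpair_eqE -mulnb natrM.
by case: eqP; case: eqP.
Qed.

Lemma op_tens M N x : op (sltens M N) x = op M x *t 1%:M + 1%:M *t op N x.
Proof. by rewrite /op /= /tens_act linearD /= !trmx_tens !trmx1. Qed.

(** Products of weight vectors form a basis of weight vectors of the tensor
    product. *)
Lemma tens_mult M N r r' (B : 'M[C]_(r, sldim M)) (B' : 'M[C]_(r', sldim N))
    (w : 'I_r -> weight l) (w' : 'I_r' -> weight l) z :
  wt_rows B w -> row_full B -> wt_rows B' w' -> row_full B' ->
  weight_mult (sltens M N) z = #|[set p : 'I_r * 'I_r' | w p.1 + w' p.2 == z]%SET|.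
Proof.
move=> [fB wB] fuB [fB' wB'] fuB'.
pose BB : 'M_(r * r', sldim (sltens M N)) := B *t B'.
pose ww (k : 'I_(r * r')) := w (mxtens_unindex k).1 + w' (mxtens_unindex k).2.
have diag_row (K : slrep C l) r0 (A : 'M_(r0, sldim K)) u i : (forall k,
  wtvec (u k) (row k A)) ->
    A *m op K (coroot C i) = diag_mx (\row_k (u k 0 i)%:~R) *m A.
  by move=> h; apply/row_matrixP => k; rewrite row_mul h; apply/rowP => j;
    rewrite mul_diag_mx !mxE.
have wBB : wt_rows BB ww.
  split.
    have /row_freeP[A AB] := fB; have /row_freeP[A' AB'] := fB'.
    by apply/row_freeP; exists (A *t A'); rewrite /BB tensmx_mul AB AB' tensmx1.
  move=> k i; rewrite -row_mul op_tens mulmxDr /BB !tensmx_mul !mulmx1.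
  rewrite (diag_row M r B w i wB) (diag_row N r' B' w' i wB').
  apply/rowP => j; rewrite /ww -(mxtens_unindexK j) -(mxtens_unindexK k).
  case: (mxtens_unindex j) => c d; case: (mxtens_unindex k) => a b.
  by rewrite !mul_diag_mx !mxE !mxtens_indexK /= intrD; ring.
have fuBB : row_full BB.
  have /row_fullP[A AB] := fuB; have /row_fullP[A' AB'] := fuB'.
  by apply/row_fullP; exists (A *t A'); rewrite /BB tensmx_mul AB AB' tensmx1.
rewrite (wt_rows_mult z wBB fuBB) -(card_imset _ (can_inj (@mxtens_unindexK r r'))).
apply: eq_card => p; rewrite !inE; apply/imsetP/idP => [[k]|pz].
  by rewrite inE => kz ->.
by exists (mxtens_index p); rewrite ?inE /ww ?mxtens_indexK.
Qed.

End Decomposition.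

(** * Semisimplicity of unitarizable modules *)

Section Unitary.
Variables (C : numClosedFieldType) (l : nat).
Implicit Types (M N : slrep C l) (lam mu w : weight l).

Local Notation conjT A := (map_mx Num.conj (A^T)).

(** The action is compatible with conjugate transposition for the standard
    Hermitian form; equivalently, the compact form of the group acts by unitary
    matrices. *)
Definition star_rep N : Prop := forall x, \tr x = 0 -> op N (conjT x) = conjT (op N x).

(** Embedding into a compatible module, rather than carrying a positive form, makes
    this notion stable under submodules and tensor products at no cost. *)
Definition unitarizable M : Prop := exists N, star_rep N /\
  exists Q : 'M[C]_(sldim M, sldim N), intertwines Q /\ row_free Q.

Lemma tr_conjT n (x : 'M[C]_n) : \tr x = 0 -> \tr (conjT x) = 0.
Proof.
by rewrite /mxtrace => x0; under eq_bigr do rewrite !mxE; rewrite -rmorph_sum x0 rmorph0.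
Qed.

Lemma conjT_mul m n p (A : 'M[C]_(m, n)) (B : 'M[C]_(n, p)) : conjT (A *m B) =
  conjT B *m conjT A.
Proof. by rewrite trmx_mul map_mxM. Qed.

Lemma conjTK m n (A : 'M[C]_(m, n)) : conjT (conjT A) = A.
Proof. by apply/matrixP => i j; rewrite !mxE conjCK. Qed.

Lemma conjT_rank m n (A : 'M[C]_(m, n)) : \rank (conjT A) = \rank A.
Proof. by rewrite mxrank_map mxrank_tr. Qed.

Lemma self_ortho0 n (u : 'rV[C]_n) : u *m conjT u = 0 -> u = 0.
Proof.
move=> /(congr1 (fun A : 'M_1 => A 0 0)); rewrite !mxE => /eqP.
under eq_bigr do rewrite !mxE -normCK.
rewrite psumr_eq0 => [/allP h|i _]; last by rewrite exprn_ge0.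
apply/rowP => j; have := h j; rewrite mem_index_enum mxE => /(_ isT) /=.
by rewrite expf_eq0 /= normr_eq0 => /eqP.
Qed.

Lemma stable_cap M (A B : 'M[C]_(sldim M)) : stable A -> stable B -> stable (A :&: B)%MS.
Proof.
move=> sA sB x x0; rewrite sub_capmx.
rewrite (submx_trans (submxMr _ (capmxSl A B)) (sA x x0)).
exact: submx_trans (submxMr _ (capmxSr A B)) (sB x x0).
Qed.

Definition irr_sub M (A : 'M[C]_(sldim M)) : Prop :=
  [/\ stable A, A != 0 & forall B : 'M_(sldim M), stable B -> (B <= A)%MS ->
    B != 0 -> (A <= B)%MS].

Lemma irr_sub_exists M (U : 'M[C]_(sldim M)) : stable U -> U != 0 ->
  exists2 A, irr_sub A & (A <= U)%MS.
Proof.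
move=> sU U0.
pose Pr r := `[< exists A : 'M_(sldim M), [/\ stable A, A != 0,
  (A <= U)%MS & \rank A = r] >].
have ex : exists r, Pr r by exists (\rank U); apply/asboolP; exists U.
have [r /asboolP[A [sA A0 AU rA]] rmin] := ex_minnP ex.
exists A => //; split=> // B sB BA B0; rewrite -(geq_leqif (mxrank_leqif_sup BA)) rA.
by apply: rmin; apply/asboolP; exists B; split=> //; apply: submx_trans AU.
Qed.

Section Reducibility.
Variables (M N : slrep C l) (Q : 'M[C]_(sldim M, sldim N)).
Hypotheses (starN : star_rep N) (hQ : intertwines Q) (fQ : row_free Q).

(** The orthogonal complement of [A] for the form induced by the embedding [Q]. *)
Definition perp (A : 'M[C]_(sldim M)) : 'M[C]_(sldim M) := kermx (Q *m conjT (A *m Q)).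

Lemma perpP m (v : 'M_(m, sldim M)) A :
  reflect (v *m Q *m conjT (A *m Q) = 0) (v <= perp A)%MS.
Proof. by rewrite -mulmxA; apply: sub_kermxP. Qed.

Lemma perp_stable A : stable A -> stable (perp A).
Proof.
move=> sA x x0; apply/perpP.
have /perpP : (perp A <= perp A)%MS by [].
move: (perp A) => B BA; rewrite -[B *m _ *m Q]mulmxA hQ // mulmxA -mulmxA.
have -> : op N x *m conjT (A *m Q) = conjT (A *m op M (conjT x) *m Q).
  by rewrite -[A *m _ *m Q]mulmxA hQ ?tr_conjT // starN // mulmxA [RHS]conjT_mul conjTK.
have /submxP[D ->] := sA _ (tr_conjT x0).
by rewrite -[D *m A *m Q]mulmxA conjT_mul mulmxA BA mul0mx.
Qed.

Lemma perp_disjoint A : (A :&: perp A = 0)%MS.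
Proof.
apply/eqP/rowV0P => v; rewrite sub_capmx => /andP[/submxP[c vc] /perpP].
move/(congr1 (fun B => B *m conjT c)); rewrite mul0mx -mulmxA -conjT_mul mulmxA -vc.
by move/self_ortho0/eqP; rewrite mulmx_free_eq0 // => /eqP.
Qed.

Lemma perp_rank A : (sldim M - \rank A <= \rank (perp A))%N.
Proof.
rewrite mxrank_ker leq_sub2l //; apply: leq_trans (mxrankM_maxr _ _) _.
by rewrite conjT_rank mxrankM_maxl.
Qed.

(** The modular law for [A <= U], obtained here by counting dimensions. *)
Lemma stable_split (A U : 'M[C]_(sldim M)) : (A <= U)%MS ->
  (A + (U :&: perp A) :=: U)%MS /\ (\rank A + \rank (U :&: perp A)%MS)%N = \rank U.
Proof.
move=> AU.
have dis : (A :&: (U :&: perp A) = 0)%MS.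
  by apply/eqP; rewrite -submx0 -[X in (_ <= X)%MS](perp_disjoint A) capmxS ?capmxSr.
have sub : (A + (U :&: perp A) <= U)%MS by rewrite addsmx_sub AU capmxSl.
have r1 := mxrank_sum_cap A (U :&: perp A)%MS; rewrite dis mxrank0 addn0 in r1.
have r2 := mxrank_sum_cap U (perp A); have r3 := perp_rank A.
have r4 := rank_leq_row (U + perp A)%MS; have r5 := mxrankS sub;
  have r6 := rank_leq_row A.
split; last by rewrite -r1; lia.
apply/eqmxP; rewrite sub /= -(geq_leqif (mxrank_leqif_sup sub)); lia.
Qed.

(** Split off an irreducible submodule and its orthogonal complement, by induction
    on the dimension. *)
Lemma semisimple_sub (U : 'M[C]_(sldim M)) : stable U -> exists s : seq 'M[C]_(sldim M),
  [/\ forall A, A \in s ->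
    irr_sub A, (\sum_(A <- s) A :=: U)%MS & (\sum_(A <- s) \rank A)%N = \rank U].
Proof.
have [n] := ubnP (\rank U); elim: n U => // n IH U rU sU.
have [->|U0] := eqVneq U 0; first by exists [::]; rewrite !big_nil mxrank0.
have [A iA AU] := irr_sub_exists sU U0; have [sA A0 _] := iA.
have [e r] := stable_split AU.
have rA : (0 < \rank A)%N by rewrite lt0n mxrank_eq0.
have [|s [irr es rs]] := IH (U :&: perp A)%MS _ (stable_cap sU (perp_stable sA));
  first lia.
exists (A :: s); split.
- by move=> B; rewrite inE => /orP[/eqP->|/irr].
- by rewrite big_cons; apply: eqmx_trans e; apply: adds_eqmx.
- by rewrite big_cons rs.
Qed.

End Reducibility.

Section Subrep.
Variables (M : slrep C l) (U : 'M[C]_(sldim M)).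
Hypothesis sU : stable U.
Let B := row_base U.
Definition sub_op (x : 'M[C]_l.+1) : 'M[C]_(\rank U) := B *m op M x *m pinvmx B.

Lemma sub_opE x : \tr x = 0 -> sub_op x *m B = B *m op M x.
Proof.
move=> x0; rewrite mulmxKpV //; have := sU x0.
by rewrite -(eqmxMr _ (eq_row_base U)) => h; rewrite (submx_trans h) // eq_row_base.
Qed.

Lemma sub_act_linear a x y : \tr x = 0 -> \tr y = 0 ->
  (sub_op (a *: x + y))^T = a *: (sub_op x)^T + (sub_op y)^T.
Proof.
move=> x0 y0; rewrite /sub_op op_linear // mulmxDr mulmxDl -scalemxAr -scalemxAl.
by rewrite linearD linearZ.
Qed.

Lemma sub_act_bracket x y : \tr x = 0 -> \tr y = 0 ->
  (sub_op (x *m y - y *m x))^T =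
    (sub_op x)^T *m (sub_op y)^T - (sub_op y)^T *m (sub_op x)^T.
Proof.
move=> x0 y0; rewrite -!trmx_mul -linearB /=; congr (_^T).
apply: (row_free_inj (row_base_free U)).
rewrite -/B mulmxBl sub_opE ?tr_bracket // op_bracket // mulmxBr.
rewrite -[sub_op y *m _ *m B]mulmxA -[sub_op x *m _ *m B]mulmxA !sub_opE //.
rewrite [sub_op y *m (B *m _)]mulmxA [sub_op x *m (B *m _)]mulmxA !sub_opE //.
by rewrite [B *m (op M y *m _)]mulmxA [B *m (op M x *m _)]mulmxA.
Qed.

(** The module carried by the row space of [U], in the basis [row_base U]. *)
Definition subrep : slrep C l := SlRep sub_act_linear sub_act_bracket.

Lemma subrep_intertwines : @intertwines C l subrep M B.
Proof. by move=> x x0; rewrite [op _ _]trmxK sub_opE. Qed.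

Lemma subrep_irr : irr_sub U -> slirr subrep.
Proof.
move=> [_ U0 irr]; split=> [|A sA A0]; first by rewrite /= lt0n mxrank_eq0.
have sAB : stable <<A *m B>>%MS.
  move=> x x0; rewrite (eqmxMr _ (genmxE _)) genmxE -mulmxA -subrep_intertwines // mulmxA.
  by apply: submxMr; apply: sA.
have := irr _ sAB; rewrite genmxE (submx_trans (submxMl _ _)) ?eq_row_base //.
rewrite (eqmx_eq0 (genmxE _)) mulmx_free_eq0 ?row_base_free // => /(_ isT A0) /mxrankS.
rewrite genmxE (mxrankMfree _ (row_base_free U)) => h.
by rewrite /row_full eqn_leq rank_leq_col.
Qed.

End Subrep.

Lemma unitarizable_decomposition M : unitarizable M ->
  exists k (S : 'I_k -> slrep C l) (P : forall a, 'M[C]_(sldim M, sldim (S a))),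
    decomposition P.
Proof.
move=> [N [starN [Q [hQ fQ]]]].
have s1 : @stable C l M _ 1%:M by move=> x _; rewrite submx1.
have [s [irr es rs]] := semisimple_sub starN hQ fQ s1.
have st (a : 'I_(size s)) : irr_sub (nth 0 s a) by apply: irr; apply: mem_nth.
have sst (a : 'I_(size s)) : stable (nth 0 s a) by case: (st a).
exists (size s), (fun a => subrep (sst a)), (fun a => (row_base (nth 0 s a))^T); split.
- by move=> a; apply: subrep_irr.
- by move=> a; apply/slhom_intertwines; rewrite trmxK; apply: subrep_intertwines.
have rk : \rank (\mxrow_(a < size s) (row_base (nth 0 s a))^T) = sldim M.
  rewrite -mxrank_tr tr_mxrow; under eq_mxcol do rewrite trmxK.
  rewrite eqmx_col ; apply: etrans (mxrank1 C _); rewrite -es; apply: eqmx_rank.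
  rewrite (big_nth 0) big_mkord; apply/eqmxP/eqmx_sums => a _.
  by apply: eqmx_trans (genmxE _) _; apply: eq_row_base.
rewrite /row_free /row_full rk eqxx /=; apply/eqP.
by apply: etrans (esym (mxrank1 C _)) _; rewrite -rs (big_nth 0) big_mkord.
Qed.

Lemma unitarizable_sub M N (Q : 'M[C]_(sldim M, sldim N)) :
  intertwines Q -> row_free Q -> unitarizable N -> unitarizable M.
Proof.
move=> hQ fQ [K [sK [Q' [hQ' fQ']]]]; exists K; split=> //; exists (Q *m Q'); split.
  exact: intertwines_comp.
by rewrite /row_free mxrankMfree.
Qed.

Lemma star_rep_tens M N : star_rep M -> star_rep N -> star_rep (sltens M N).
Proof.
move=> sM sN x x0; rewrite !op_tens sM // sN // linearD /= map_mxD !trmx_tens !map_mxT.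
by rewrite !trmx1 !map_mx1.
Qed.

Lemma star_unitarizable M : star_rep M -> unitarizable M.
Proof.
move=> sM; exists M; split=> //; exists 1%:M; split;
  last by rewrite row_free_unit unitmx1.
by move=> x x0; rewrite mulmx1 mul1mx.
Qed.

Lemma unitarizable_tens M N : unitarizable M -> unitarizable N ->
  unitarizable (sltens M N).
Proof.
move=> [K [sK [Q [hQ fQ]]]] [K' [sK' [Q' [hQ' fQ']]]]; exists (sltens K K').
split; first exact: star_rep_tens.
exists (Q *t Q'); split.
  by move=> x x0; rewrite !op_tens mulmxDl mulmxDr !tensmx_mul !mul1mx !mulmx1 hQ // hQ'.
have /row_freeP[A QA] := fQ; have /row_freeP[A' QA'] := fQ'.
by apply/row_freeP; exists (A *t A'); rewrite tensmx_mul QA QA' tensmx1.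
Qed.

End Unitary.

(** * Unitarizability of Weyl modules *)

Section Fundamental.
Variables (C : numClosedFieldType) (l : nat).
Implicit Types (M N : slrep C l) (lam mu w : weight l) (x y : 'M[C]_l.+1).

Lemma triv_act_linear a x y : \tr x = 0 -> \tr y = 0 -> (0 : 'M[C]_1) = a *: 0 + 0.
Proof. by rewrite scaler0 addr0. Qed.

Lemma triv_act_bracket x y : \tr x = 0 -> \tr y = 0 ->
  (0 : 'M[C]_1) = (0 : 'M[C]_1) *m (0 : 'M[C]_1) - (0 : 'M[C]_1) *m (0 : 'M[C]_1).
Proof. by rewrite mulmx0 subrr. Qed.

Definition sltriv : slrep C l := SlRep (slact :=
  fun=> 0) triv_act_linear triv_act_bracket.

Definition slnat : slrep C l :=
  SlRep (slact := id) (fun a x y _ _ => erefl (a *: x + y)) (fun x y _ _ =>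
    erefl (x *m y - y *m x)).

Fixpoint tensor_power k : slrep C l :=
  if k is k'.+1 then sltens slnat (tensor_power k') else sltriv.

Lemma star_rep_triv : star_rep sltriv.
Proof. by move=> x _; rewrite /op /= !trmx0 map_mx0. Qed.

Lemma star_rep_nat : star_rep slnat.
Proof. by move=> x _; rewrite /op /= map_trmx. Qed.

Lemma star_rep_tensor_power k : star_rep (tensor_power k).
Proof. by elim: k => [|k IH];
  [apply: star_rep_triv | apply: star_rep_tens star_rep_nat IH]. Qed.

(** The position, in the iterated Kronecker product, of the basis vector whose
    factor [p] is the basis vector [s p] of the natural module. The first
    factor of the product belongs to the largest [p]. *)
Fixpoint tensor_index k (s : nat -> 'I_l.+1) : 'I_(sldim (tensor_power k)) :=
  if k is k'.+1 then mxtens_index (s k', tensor_index k' s) else ord0.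

(** The inverse of [tensor_index], with a default value from [k] on. *)
Fixpoint tensor_digits k : 'I_(sldim (tensor_power k)) -> nat -> 'I_l.+1 :=
  if k is k'.+1 then fun i p =>
    if p == k' then (@mxtens_unindex l.+1 (sldim (tensor_power k')) i).1
    else tensor_digits (@mxtens_unindex l.+1 (sldim (tensor_power k')) i).2 p
  else fun _ _ => ord0.

Lemma eq_tensor_index k s t : (forall p, (p < k)%N -> s p = t p) ->
  tensor_index k s = tensor_index k t.
Proof.
elim: k => // k IH st /=; rewrite st // IH // => p pk.
by apply: st; rewrite ltnS ltnW.
Qed.

Lemma tensor_digitsK k (i : 'I_(sldim (tensor_power k))) : tensor_index k (tensor_digits
  i) = i.
Proof.
elim: k i => [|k IH] i; first by rewrite /= (ord1 i).
rewrite /= eqxx -[RHS](@mxtens_unindexK l.+1 (sldim (tensor_power k)));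
  congr mxtens_index.
rewrite [RHS]surjective_pairing -[in RHS](IH (mxtens_unindex i).2); congr (_, _).
by apply: eq_tensor_index => p pk; rewrite ltn_eqF.
Qed.

Lemma tensor_indexK k s p : (p < k)%N -> tensor_digits (tensor_index k s) p = s p.
Proof.
elim: k => // k IH; rewrite ltnS leq_eqVlt.
have -> : tensor_digits (tensor_index k.+1 s) p =
  if p == k then s k else tensor_digits (tensor_index k s) p.
  rewrite -[LHS]/(if p == k then (mxtens_unindex (mxtens_index (s k, tensor_index k s))).1
    else tensor_digits (mxtens_unindex (mxtens_index (s k, tensor_index k s))).2 p).
  by rewrite mxtens_indexK.
by case: eqP => [->|_] //= /IH.
Qed.

Definition update (s : nat -> 'I_l.+1) p c := fun q => if q == p then c else s q.

(** The Leibniz rule in coordinates. *)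
Lemma tensor_power_op k x (v : 'rV[C]_(sldim (tensor_power k))) s :
  (v *m op (tensor_power k) x) 0 (tensor_index k s) =
  \sum_(p < k) \sum_c x (s p) c * v 0 (tensor_index k (update s p c)).
Proof.
elim: k v s => [|k IH] v s; first by rewrite big_ord0 /op /= trmx0 mulmx0 mxE.
set a0 := s k; set b0 := tensor_index k s.
pose v' := \row_d v 0 (mxtens_index (a0, d)).
transitivity (\sum_c x a0 c * v 0 (mxtens_index (c,
  b0)) + (v' *m op (tensor_power k) x) 0 b0).
  rewrite [LHS]mxE [LHS]sum_tens [X in _ + X]mxE.
  have -> : \sum_c x a0 c * v 0 (mxtens_index (c, b0)) =
      \sum_c \sum_d v 0 (mxtens_index (c, d)) * (x a0 c * (d == b0)%:R).
    apply: eq_bigr => c _; rewrite (bigD1 b0) //= big1 ?addr0 => [|d db].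
      by rewrite eqxx mulr1 mulrC.
    by rewrite (negbTE db) !mulr0.
  have -> : \sum_d v' 0 d * op (tensor_power k) x d b0 =
      \sum_c \sum_d v 0 (mxtens_index (c,
        d)) * ((c == a0)%:R * op (tensor_power k) x d b0).
    rewrite [RHS](bigD1 a0) //= [X in _ + X]big1 ?addr0 => [|c ca].
      by apply: eq_bigr => d _; rewrite mxE eqxx mul1r.
    by apply: big1 => d _; rewrite (negbTE ca) mul0r mulr0.
  rewrite -big_split; apply: eq_bigr => c _; rewrite -big_split; apply: eq_bigr => d _ /=.
  by rewrite -mulrDr; congr (_ * _); rewrite [op _ _]op_tens mxE !tensmxE !mxE.
rewrite IH [RHS]big_ord_recr [LHS]addrC /=; congr (_ + _).
  apply: eq_bigr => p _; apply: eq_bigr => c _; rewrite mxE; congr (_ * v 0 _).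
  by rewrite /update gtn_eqF.
apply: eq_bigr => c _; congr (_ * v 0 (mxtens_index _)).
rewrite /update eqxx; congr (_, _); apply: eq_tensor_index => p pk; by rewrite ltn_eqF.
Qed.

Section Minor.
Variables (k : nat) (kl : (k <= l.+1)%N).

Definition leading (q : 'I_k) : 'I_l.+1 := widen_ord kl q.
Definition selection_mx (s : nat ->
  'I_l.+1) : 'M[C]_k := \matrix_(p < k, q < k) (s p == leading q)%:R.
(** The exterior product of the first [k] basis vectors, written as an
    antisymmetric tensor: its coordinates are the maximal minors of the matrix of
    the inclusion of the first [k] coordinates. *)
Definition minor_vec : 'rV[C]_(sldim (tensor_power k)) :=
  \row_i \det (selection_mx (tensor_digits i)).

Lemma minor_vecE s : minor_vec 0 (tensor_index k s) = \det (selection_mx s).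
Proof.
rewrite mxE; congr (\det _); apply/matrixP => p q; rewrite !mxE tensor_indexK //.
Qed.

(** An upper triangular [x] preserves the span of the first [k] basis vectors, and
    on the exterior product it acts by the trace of its restriction. In
    coordinates: expanding along the altered row, the Leibniz rule sums to the
    trace of [adj D * D * Y], with [Y] the upper left block of [x]. *)
Lemma minor_vec_op x : (forall a b : 'I_l.+1, (b < a)%N -> x a b = 0) ->
  minor_vec *m op (tensor_power k) x = (\sum_q x (leading q) (leading q)) *: minor_vec.
Proof.
move=> ux; apply/rowP => i; rewrite -(tensor_digitsK i); move: (tensor_digits i) => s.
rewrite tensor_power_op [RHS]mxE minor_vecE; set D := selection_mx s.
have det_upd (p : 'I_k) c : \det (selection_mx (update s p c)) =
  \sum_q (c == leading q)%:R * cofactor D p q.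
  rewrite (expand_det_row _ p); apply: eq_bigr => q _; rewrite mxE /update eqxx;
    congr (_ * _).
  congr (_ * \det _); apply/matrixP => a b; rewrite !mxE.
  by rewrite /update /= [_ == (p : nat)]eq_sym (negbTE (neq_bump p a)).
(* If [s p] is not among the first [k] indices, both sides vanish, as [x] is
   upper triangular. *)
have xD (p q : 'I_k) : x (s p) (leading q) = \sum_r D p r * x (leading r) (leading q).
  have [pk|kp] := ltnP (s p) k.
    rewrite (bigD1 (Ordinal pk)) //= big1 => [|r rp]; rewrite mxE.
      have -> : leading (Ordinal pk) = s p by apply: val_inj.
      by rewrite eqxx mul1r addr0.
    case: eqP => [e|_]; last by rewrite mul0r.
    by case/eqP: rp; apply: val_inj; rewrite /= e.
  rewrite ux; last by rewrite /= (leq_trans (ltn_ord q)).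
  apply/esym/big1 => r _; rewrite mxE; case: eqP => [e|_]; last by rewrite mul0r.
  by move: kp; rewrite e leqNgt /= ltn_ord.
transitivity (\sum_q \sum_r x (leading r) (leading q) * (\adj D *m D) q r).
  transitivity (\sum_(p < k) \sum_(q < k) x (s p) (leading q) * cofactor D p q).
    apply: eq_bigr => p _;
      rewrite (eq_bigr (fun c =>
      \sum_q x (s p) c * ((c == leading q)%:R * cofactor D p q))).
      rewrite exchange_big; apply: eq_bigr => q _;
        rewrite (bigD1 (leading q)) //= big1 ?addr0.
        by rewrite eqxx mul1r.
      by move=> c /negbTE ->; rewrite mul0r mulr0.
    by move=> c _; rewrite minor_vecE det_upd mulr_sumr.
  rewrite exchange_big; apply: eq_bigr => q _ /=.
  rewrite (eq_bigr (fun p =>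
    \sum_r D p r * x (leading r) (leading q) * cofactor D p q)); last first.
    by move=> p _; rewrite xD mulr_suml.
  rewrite exchange_big; apply: eq_bigr => r _ /=; rewrite mxE mulr_sumr.
  by apply: eq_bigr => p _; rewrite [\adj D _ _]mxE; ring.
rewrite mulr_suml; apply: eq_bigr => q _; rewrite mul_adj_mx (bigD1 q) //= big1 ?addr0.
  by rewrite mxE eqxx mulr1n.
by move=> r rq; rewrite mxE eq_sym (negbTE rq) mulr0n mulr0.
Qed.

Lemma minor_vec_neq0 : minor_vec != 0.
Proof.
apply/eqP => /rowP/(_ (tensor_index k (fun p => inord p))); rewrite minor_vecE mxE.
rewrite (_ : selection_mx _ = 1%:M) ?det1 => [/eqP|]; first by rewrite oner_eq0.
apply/matrixP => p q; rewrite !mxE -!val_eqE /= inordK //.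
by apply: leq_trans (ltn_ord p) kl.
Qed.

End Minor.

(** For a raising operator the trace in [minor_vec_op] is zero; for the coroot [i]
    it is one if [i = j] and zero otherwise. *)
Lemma minor_highest_vec (j : 'I_l) : exists v,
  @highest_vec C l (tensor_power j.+1) (omega j) v.
Proof.
have kl : (j.+1 <= l.+1)%N by rewrite ltnW // ltnS.
exists (minor_vec kl); split; first exact: minor_vec_neq0.
  move=> i; rewrite minor_vec_op => [|a b ba]; last first.
    have nab c : (a == c) && (b == c) = false.
      by apply/negP => /andP[/eqP ea /eqP eb]; rewrite ea eb ltnn in ba.
    by rewrite /coroot !mxE !nab subrr.
  congr (_ *: _); rewrite mxE.
  have S (c : 'I_l.+1) : \sum_(q < j.+1) ((leading kl q == c)%:R : C) = (c < j.+1)%N%:R.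
    have [cj|jc] := ltnP c j.+1.
      rewrite (bigD1 (Ordinal cj)) //= big1 => [|q qc].
        by rewrite (_ : leading kl (Ordinal cj) = c) ?eqxx ?addr0 //; apply: val_inj.
      by case: eqP => // e; case/eqP: qc; apply: val_inj; rewrite /= -e.
    by rewrite big1 // => q _; case: eqP => // e; move: jc; rewrite -e leqNgt /= ltn_ord.
  rewrite (eq_bigr (fun q => (leading kl q == lo i)%:R - (leading kl q == hi i)%:R));
    last first.
    by move=> q _; rewrite /coroot !mxE !andbb.
  rewrite sumrB !S /= /bump /= add1n !ltnS -val_eqE /=.
  by case: ltngtP; rewrite ?subrr ?subr0.
move=> i; rewrite minor_vec_op => [|a b ba].
  rewrite big1 ?scale0r // => q _; rewrite mxE; case: eqP => //= ->.
  by rewrite (negbTE (lo_neq_hi i)).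
rewrite mxE; case: eqP => //= ea; case: eqP => //= eb.
by move: ba; rewrite ea eb /= /bump /=; lia.
Qed.

Lemma highest_vec_tens M N lam mu v u : @highest_vec C l M lam v ->
  @highest_vec C l N mu u ->
  exists t, @highest_vec C l (sltens M N) (lam + mu) t.
Proof.
move=> [v0 wv vr] [u0 wu ur].
pose t : 'rV[C]_(sldim (sltens M N)) := (v *t u : 'M_(1 * 1, sldim M * sldim N)).
have tE x : t *m op (sltens M N) x = (v *m op M x) *t u + v *t (u *m op N x).
  rewrite op_tens [LHS]mulmxDr; congr (_ + _).
    by rewrite -[in RHS](mulmx1 u); apply: (tensmx_mul v u (op M x) 1%:M).
  by rewrite -[in RHS](mulmx1 v); apply: (tensmx_mul v u 1%:M (op N x)).
have tcoef a b : t 0 (mxtens_index (a, b)) = v 0 a * u 0 b.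
  by rewrite !mxE mxtens_indexK /= !ord1.
exists t; split.
- apply: contraNneq v0 => t0; apply/eqP/rowP => a; rewrite mxE.
  have [b ub] : exists b, u 0 b != 0.
    apply: contrapT => /forallNP no; case/negP: u0; apply/eqP/rowP => b; rewrite mxE.
    by apply/eqP; have /negP := no b; rewrite negbK.
  by apply: (mulIf ub); rewrite -tcoef t0 mxE mul0r.
- move=> i; rewrite tE wv wu; apply/rowP => j; rewrite -(mxtens_unindexK j).
  by rewrite !mxE !mxtens_indexK /= intrD !ord1; ring.
- move=> i; rewrite tE vr ur; apply/rowP => j; rewrite -(mxtens_unindexK j).
  by rewrite !mxE !mxtens_indexK /= mul0r mulr0 addr0.
Qed.

(** Tensor products of the modules of [minor_highest_vec]. *)
Lemma star_rep_highest_vec lam : dominant lam ->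
  exists N v, star_rep N /\ @highest_vec C l N lam v.
Proof.
have [m] := ubnP (absz (height lam)); elim: m lam => // m IH lam hm dl.
have [->|nz] := eqVneq lam 0.
  exists sltriv, (const_mx 1); split; first exact: star_rep_triv.
  split.
  - by apply/eqP => /rowP/(_ 0); rewrite !mxE => /eqP; rewrite oner_eq0.
  - by move=> i; rewrite /op /= trmx0 mulmx0 mxE scale0r.
  - by move=> i; rewrite /op /= trmx0 mulmx0.
have [i [mu [dmu lamE hmu]]] := dominant_sub_omega dl nz.
have [|N [v [sN hv]]] := IH mu _ dmu; first by move: hm hmu; lia.
have [u hu] := minor_highest_vec i; have [t ht] := highest_vec_tens hv hu.
exists (sltens N (tensor_power i.+1)), t; rewrite lamE; split=> //.
exact: star_rep_tens sN (star_rep_tensor_power _).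
Qed.

(** The irreducible module is isomorphic to a summand of a compatible module with a
    highest weight vector of the same weight. *)
Lemma weyl_module_unitarizable M lam v : slirr M -> @highest_vec C l M lam v ->
  unitarizable M.
Proof.
move=> iM hv; have [N [u [sN hu]]] := star_rep_highest_vec (highest_vec_dominant hv).
have uN := star_unitarizable sN; have [k [S [P decP]]] := unitarizable_decomposition uN.
have [a [w hw]] := decomposition_highest_vec decP hu.
have iS : slirr (S a) by case: decP.
have /sliso_intertwines[Q [hQ fQ _]] := highest_vec_iso iM iS hv hw.
apply: (unitarizable_sub (Q := Q *m (P a)^T)) uN.
  exact: intertwines_comp hQ (decomposition_intertwines decP a).
by rewrite /row_free; rewrite (mxrankMfree _ (decomposition_inj decP a)).
Qed.

End Fundamental.

(** * Dual modules and the symmetry of multiplicities *)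

Section Duality.
Variables (C : numClosedFieldType) (l : nat).
Implicit Types (M N L A B : slrep C l) (lam mu nu w : weight l).

Section Dual.
Variable N : slrep C l.

Lemma dual_act_linear a (x y : 'M[C]_l.+1) : \tr x = 0 -> \tr y = 0 ->
  - (N (a *: x + y))^T = a *: - (N x)^T + - (N y)^T.
Proof. by move=> x0 y0; rewrite slact_linear // linearD linearZ /= opprD scalerN. Qed.

Lemma dual_act_bracket (x y : 'M[C]_l.+1) : \tr x = 0 -> \tr y = 0 ->
  - (N (x *m y - y *m x))^T = - (N x)^T *m - (N y)^T - - (N y)^T *m - (N x)^T.
Proof.
by move=> x0 y0; rewrite slact_bracket // linearB /= !trmx_mul !mulNmx !mulmxN !opprK
  opprB.
Qed.

Definition sldual : slrep C l := SlRep dual_act_linear dual_act_bracket.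

Lemma op_dual x : op sldual x = - (op N x)^T.
Proof. by rewrite /op /= linearN /= trmxK. Qed.

(** The annihilator of a submodule is a submodule. *)
Lemma dual_irr : slirr N -> slirr sldual.
Proof.
move=> iN; split=> [|U sU U0]; first by case: iN.
have K0 : kermx U^T == 0.
  apply: contraT => K0; case/negP: U0.
  have /row_fullP[D DK] : row_full (kermx U^T).
    apply: (@irr_full C l N _ (kermx U^T) iN _ K0) => x x0; apply/sub_kermxP.
    have /submxP[E UE] := sU x x0; rewrite -mulmxA.
    have -> : op N x *m U^T = - U^T *m E^T.
      rewrite mulNmx -[U^T *m
        E^T]trmx_mul -UE -[(sldual x)^T]/(op sldual x) op_dual mulmxN linearN /= opprK.
      by rewrite trmx_mul trmxK.
    by rewrite mulmxA mulmxN mulmx_ker oppr0 mul0mx.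
  by rewrite -[U]trmxK -[U^T]mul1mx -DK -mulmxA mulmx_ker mulmx0 trmx0.
by move: K0; rewrite kermx_eq0 /row_free mxrank_tr.
Qed.

Lemma dual_wt_rows r (D : 'M[C]_(r, sldim N)) (w : 'I_r -> weight l) : wt_rows D w ->
  row_full D ->
  exists D' : 'M[C]_(r, sldim sldual), @wt_rows C l sldual r D' (fun k =>
    - w k) /\ row_full D'.
Proof.
move=> [fD wD] fuD.
have [P P1 P2] : exists2 P, P *m D = 1%:M & D *m P = 1%:M.
  by exists (pinvmx D); [apply: mulVpmx | apply: mulmxVp].
have wtD i : D *m op N (coroot C i) = diag_mx (\row_k (w k 0 i)%:~R) *m D.
  by apply/row_matrixP => k; rewrite row_mul wD; apply/rowP => j;
    rewrite mul_diag_mx !mxE.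
exists P^T; split; last by apply/row_fullP; exists D^T; rewrite -trmx_mul P1 trmx1.
split; first by apply/row_freeP; exists D^T; rewrite -trmx_mul P2 trmx1.
move=> k i; rewrite -row_mul op_dual mulmxN -trmx_mul.
have -> : op N (coroot C i) *m P = P *m diag_mx (\row_k (w k 0 i)%:~R).
  rewrite -[LHS]mul1mx -P1 -mulmxA [D *m _]mulmxA wtD -mulmxA P2 mulmx1 //.
rewrite trmx_mul tr_diag_mx; apply/rowP => j.
by rewrite mul_diag_mx !mxE rmorphN mulNr.
Qed.

(** The weights of the dual are the negatives of those of [N]. Its highest weight
    and [dual_weight nu] are both weights of it, and [dual_weight] preserves the
    root order, so each lies below the other. *)
Lemma dual_highest_vec nu v : slirr N -> @highest_vec C l N nu v ->
  exists u, @highest_vec C l sldual (dual_weight nu) u.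
Proof.
move=> iN hv; have iD := dual_irr iN; have [d0 _] := iD.
have [kap [u hu]] := highest_vec_exists d0.
have [r [D [w [wD fD _ _]]]] := irr_weight_basis iN hv.
have [D' [wD' fD']] := dual_wt_rows wD fD.
have mult x : weight_mult sldual x = weight_mult N (- x).
  rewrite (wt_rows_mult _ wD fD) (wt_rows_mult _ wD' fD').
  by apply: eq_card => k; rewrite !inE eqr_oppLR.
have e : kap = dual_weight nu.
  apply: root_le_anti; last first.
    apply: (irr_weight_le iD hu); rewrite mult opprK weight_mult_weyl.
    by have [->] := irr_weight_top iN hv.
  rewrite -(dual_weightK kap); apply/dual_weight_root_le/(irr_weight_le iN hv).
  rewrite /dual_weight -weyl_actN weight_mult_weyl -mult.
  by have [->] := irr_weight_top iD hu.
by exists u; rewrite -e.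
Qed.

End Dual.

Section Contraction.
Variables L A B : slrep C l.

(** Pairs the second tensor factor of the values of [t] with linear forms on
    [B]. *)
Definition contract (t : 'M[C]_(sldim L, sldim (sltens A B))) :
    'M[C]_(sldim (sltens L (sldual B)), sldim A) :=
  \matrix_(i < sldim L * sldim B, a < sldim A)
    t (mxtens_unindex i).1 (mxtens_index (a, (mxtens_unindex i).2)).

Lemma tens1_mulE m n p (X : 'M[C]_m) (t : 'M[C]_(m * n, p)) c b a :
  ((X *t 1%:M) *m t) (mxtens_index (c, b)) a =
    \sum_c' X c c' * t (mxtens_index (c', b)) a.
Proof.
rewrite mxE sum_tens; apply: eq_bigr => c' _.
rewrite (bigD1 b) //= big1 ?addr0 => [|b' bb]; rewrite tensmxE [_%:M _ _]mxE.
  by rewrite eqxx mulr1.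
by rewrite eq_sym (negbTE bb) mulr0 mul0r.
Qed.

Lemma tens1r_mulE m n p (X : 'M[C]_n) (t : 'M[C]_(m * n, p)) c b a :
  ((1%:M *t X) *m t) (mxtens_index (c, b)) a =
    \sum_b' X b b' * t (mxtens_index (c, b')) a.
Proof.
rewrite mxE sum_tens (bigD1 c) //= [X in _ + X]big1 ?addr0 => [|c' cc].
  by apply: eq_bigr => b' _; rewrite tensmxE [_%:M _ _]mxE eqxx mul1r.
by apply: big1 => b' _; rewrite tensmxE [_%:M _ _]mxE eq_sym (negbTE cc) !mul0r.
Qed.

Lemma mul_tens1E m n p (X : 'M[C]_m) (t : 'M[C]_(p, m * n)) c b a :
  (t *m (X *t 1%:M)) a (mxtens_index (c, b)) =
    \sum_c' t a (mxtens_index (c', b)) * X c' c.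
Proof.
rewrite -[t *m _]trmxK mxE trmx_mul trmx_tens trmx1 tens1_mulE.
by apply: eq_bigr => c' _; rewrite !mxE mulrC.
Qed.

Lemma mul_tens1rE m n p (X : 'M[C]_n) (t : 'M[C]_(p, m * n)) c b a :
  (t *m (1%:M *t X)) a (mxtens_index (c, b)) =
    \sum_b' t a (mxtens_index (c, b')) * X b' b.
Proof.
rewrite -[t *m _]trmxK mxE trmx_mul trmx_tens trmx1 tens1r_mulE.
by apply: eq_bigr => c' _; rewrite !mxE mulrC.
Qed.

Lemma contract_intertwines t : intertwines t -> intertwines (contract t).
Proof.
move=> ht x x0; apply/matrixP => i a; rewrite -(mxtens_unindexK i).
case: (mxtens_unindex i) => c b {i}; rewrite op_tens op_dual.
rewrite [in LHS]mulmxDl mxE tens1_mulE tens1r_mulE.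
have := congr1 (fun X : 'M_(sldim L, sldim A * sldim B) =>
  X c (mxtens_index (a, b))) (ht x x0).
rewrite op_tens mulmxDr /= [RHS]mxE mul_tens1E mul_tens1rE mxE.
move=> e; rewrite [RHS]mxE.
transitivity (\sum_c' op L x c c' * t c' (mxtens_index (a, b)) -
  \sum_b' t c (mxtens_index (a, b')) * op B x b' b).
  congr (_ + _); first by apply: eq_bigr => c' _;
    rewrite [contract _ _ _]mxE mxtens_indexK.
  rewrite -sumrN; apply: eq_bigr => b' _.
  by rewrite [contract _ _ _]mxE mxtens_indexK /= !mxE mulNr mulrC.
rewrite e addrK; apply: eq_bigr => a' _.
by rewrite [contract _ _ _]mxE mxtens_indexK.
Qed.

Lemma contract_sum m (z : 'I_m -> C) (t : 'I_m -> 'M[C]_(sldim L, sldim (sltens A B))) :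
  \sum_i z i *: contract (t i) = 0 -> \sum_i z i *: t i = 0.
Proof.
move=> e; apply/matrixP => c j; rewrite -(mxtens_unindexK j).
case: (mxtens_unindex j) => a b {j}.
have := congr1 (fun X : 'M_(sldim L * sldim B, sldim A) => X (mxtens_index (c, b)) a) e.
rewrite /= !summxE !mxE => {}e; rewrite -[RHS]e; apply: eq_bigr => i _.
by rewrite !mxE mxtens_indexK.
Qed.

End Contraction.

(** The embeddings of the summands isomorphic to [L]. *)
Lemma multiplicity_independent L T c : slirr L -> is_multiplicity L T c ->
  exists t : 'I_c -> 'M[C]_(sldim L, sldim T), (forall i, intertwines (t i)) /\
    forall z : 'I_c -> C, \sum_i z i *: t i = 0 -> forall i, z i = 0.
Proof.
move=> iL [k [S [P [irr homP ff <-]]]]; have decP : decomposition P by [].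
set I := [set a | _]%SET.
have H a : exists Q : 'M[C]_(sldim L, sldim (S a)), a \in I -> intertwines Q /\ Q != 0.
  have [aI|aI] := boolP (a \in I); last by exists 0.
  have := aI; rewrite inE => /asboolP/sliso_sym/sliso_intertwines[Q [hQ fQ fuQ]].
  exists Q; split=> //; apply: contraTneq fQ => ->; rewrite /row_free mxrank0.
  by case: iL => d0 _; rewrite eq_sym -lt0n.
pose Q a := sval (cid (H a)).
have QP a : a \in I -> intertwines (Q a) /\ Q a != 0 by apply: svalP (cid (H a)).
exists (fun i => Q (enum_val i) *m (P (enum_val i))^T); split.
  move=> i; have [hQ _] := QP _ (enum_valP i).
  exact: intertwines_comp hQ (decomposition_intertwines decP _).
move=> z z0 i.
pose cf a := \sum_i (if enum_val i == a then z i else 0) *: Q a.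
have cfi : cf (enum_val i) = z i *: Q (enum_val i).
  rewrite /cf (bigD1 i) //= eqxx big1 ?addr0 // => j ji.
  case: eqP => [/enum_val_inj e|_]; last by rewrite scale0r.
  by rewrite e eqxx in ji.
have [_ Q0] := QP _ (enum_valP i).
suff cf0 : \sum_a cf a *m (P a)^T = 0.
  have /eqP := decomposition_free decP cf0 (enum_val i).
  by rewrite cfi scaler_eq0 (negbTE Q0) orbF => /eqP.
rewrite -[RHS]z0.
under eq_bigr do rewrite mulmx_suml.
rewrite exchange_big; apply: eq_bigr => j _ /=.
rewrite (bigD1 (enum_val j)) //= eqxx big1 ?addr0 ?scalemxAl // => a aj.
by rewrite eq_sym (negbTE aj) scale0r mul0mx.
Qed.

(** By Schur's lemma a homomorphism to [A] is given on each summand isomorphic to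
    [A] by a scalar and vanishes on the others, so it is determined by [c]
    scalars. *)
Lemma multiplicity_bound A T c m (u : 'I_m -> 'M[C]_(sldim T, sldim A)) : slirr A ->
  is_multiplicity A T c -> (forall i, intertwines (u i)) ->
  (forall z : 'I_m -> C, \sum_i z i *: u i = 0 -> forall i, z i = 0) -> (m <= c)%N.
Proof.
move=> iA [k [S [P [irr homP ff <-]]]] hu free; have decP : decomposition P by [].
set I := [set a | _]%SET.
have hPu i a : @intertwines C l (S a) A ((P a)^T *m u i).
  exact: intertwines_comp (decomposition_intertwines decP a) (hu i).
have H a : exists v : 'I_m -> C, exists chi : 'M[C]_(sldim (S a), sldim A),
    (forall i, (P a)^T *m u i = v i *: chi) /\ (a \notin I -> forall i, v i = 0).
  have [all0|] := pselect (forall i, (P a)^T *m u i = 0).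
    by exists (fun=> 0), 0; split=> // i; rewrite all0 scaler0.
  move=> /existsNP[i /eqP nz].
  have /choice[v vP] : forall j, exists z, (P a)^T *m u j = z *: ((P a)^T *m u i).
    by move=> j; apply: schur_scalar nz.
  exists v, ((P a)^T *m u i); split=> //.
  case/negP; rewrite inE; apply/asboolP/sliso_intertwines.
  by have /andP[f fu] := schur_bij (irr a) iA (hPu i a) nz; exists ((P a)^T *m u i).
have /choice[v vP] := H.
pose X : 'M[C]_(m, #|I|) := \matrix_(i, j) v (enum_val j) i.
suff : row_free X by move=> /eqP <-; apply: rank_leq_col.
apply: inj_row_free => z zX.
suff : \sum_i z 0 i *: u i = 0 by move/free => h; apply/rowP => i; rewrite h mxE.
(* It suffices to show that the combination vanishes on every summand. *)
have [d dE] := decomposition_full decP (1%:M : 'M_(sldim T)).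
rewrite -[LHS]mul1mx dE mulmx_suml; apply: big1 => a _; rewrite -mulmxA.
suff -> : (P a)^T *m (\sum_i z 0 i *: u i) = 0 by rewrite mulmx0.
have [chi [chiE off]] := vP a.
rewrite mulmx_sumr (eq_bigr (fun i => (z 0 i * v a i) *: chi)); last first.
  by move=> i _; rewrite -scalemxAr chiE scalerA.
rewrite -scaler_suml; have [aI|aI] := boolP (a \in I); last first.
  by rewrite big1 ?scale0r // => i _; rewrite off ?mulr0.
have := congr1 (fun Y : 'rV_(#|I|) => Y 0 (enum_rank_in aI a)) zX; rewrite !mxE => e.
rewrite (_ : \sum_i _ = 0) ?scale0r // -[RHS]e; apply: eq_bigr => i _.
by rewrite mxE enum_rankK_in.
Qed.

(** The inequality suffices for the symmetry, as it can be applied a second time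
    with [L] and [A] exchanged and [B] dualized. *)
Lemma multiplicity_le L A B B' c c' : slirr L -> slirr A -> sliso B' (sldual B) ->
  is_multiplicity L (sltens A B) c -> is_multiplicity A (sltens L B') c' -> (c <= c')%N.
Proof.
move=> iL iA /sliso_intertwines[Th [hT fT fuT]] mL mA.
have [t [ht free]] := multiplicity_independent iL mL.
pose U : 'M_(sldim (sltens L B'), sldim (sltens L (sldual B))) := 1%:M *t Th.
have hU : intertwines U.
  by move=> x x0; rewrite !op_tens mulmxDl mulmxDr !tensmx_mul !mul1mx !mulmx1 hT.
have [D DU] : exists D, D *m U = 1%:M.
  by have /row_fullP[D DT] := fuT; exists (1%:M *t D);
    rewrite tensmx_mul mul1mx DT tensmx1.
apply: (multiplicity_bound (u := fun i => U *m contract (t i)) iA mA).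
  by move=> i; apply: intertwines_comp hU (contract_intertwines (ht i)).
move=> z z0; apply: free; apply: contract_sum.
have -> : \sum_i z i *: contract (t i) = D *m \sum_i z i *: (U *m contract (t i)).
  by rewrite mulmx_sumr; apply: eq_bigr => i _; rewrite -scalemxAr mulmxA DU mul1mx.
by rewrite z0 mulmx0.
Qed.

End Duality.

(** * Characters of the Weyl modules *)

Section WeylModules.
Variables (C : numClosedFieldType) (l : nat) (V : weight l -> slrep C l).
Hypothesis V_weyl : forall lam, dominant lam -> is_weyl_module lam (V lam).
Implicit Types (lam mu nu x z : weight l).
Local Notation PiPlus_fset lam := (fset_set (PiPlus lam)).
Local Notation ch := (fun lam => slch lam (V lam)).

Lemma weyl_highest_vec lam : dominant lam ->
  slirr (V lam) /\ exists v, @highest_vec C l (V lam) lam v.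
Proof.
move=> /V_weyl[irr [v [v0 vr wv]]]; split=> //; exists v^T; split.
- by apply: contraNneq v0 => e; rewrite -[v]trmxK e trmx0.
- by move=> i; rewrite -trmx_mul wv linearZ.
- by move=> i; rewrite -trmx_mul vr ?trmx0 //= /bump /= add1n.
Qed.

Lemma weyl_iso lam M v : dominant lam -> slirr M -> @highest_vec C l M lam v ->
  sliso M (V lam).
Proof.
by move=> /weyl_highest_vec[irr [u hu]] iM hv; apply: highest_vec_iso hv hu.
Qed.

(** The sum over [Pi lam] loses nothing, as all weights lie there. *)
Lemma slchE lam x : dominant lam -> (slch lam (V lam))@_x = (weight_mult (V lam) x)%:Z.
Proof.
move=> dl; have [irr [v hv]] := weyl_highest_vec dl.
rewrite /slch fsbig_finite /=; last exact: Pi_finite.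
have inP y : (y \in fset_set (Pi lam)) = `[<Pi lam y>] by rewrite in_fset_set //;
  apply: Pi_finite.
rewrite raddf_sum /=; have [px|px] := boolP (x \in fset_set (Pi lam)).
  rewrite (bigD1_seq _ px) ?fset_uniq //= big1 => [|y yx]; rewrite mcoeffZ ebasisE.
    by rewrite eqxx mulr1 addr0.
  by rewrite (negbTE yx) mulr0.
rewrite big_seq big1 => [|y yP]; last first.
  by rewrite mcoeffZ ebasisE; case: eqP px => [<-|]; rewrite ?yP // mulr0.
apply/esym/eqP; rewrite -[0]/(0%N%:Z) eqz_nat -leqn0 leqNgt; apply: contra px => px.
by rewrite inP; apply/asboolP/(irr_weight_Pi irr hv px).
Qed.

Lemma slch_unitriangular : unitriangular ch.
Proof.
move=> lam dl; have [irr [v hv]] := weyl_highest_vec dl; split.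
- by apply/invariantP => s x; rewrite !slchE // weight_mult_weyl.
- by rewrite slchE //; have [->] := irr_weight_top irr hv.
- move=> x nx; rewrite slchE //; apply/eqP; rewrite eqz_nat -leqn0 leqNgt.
  by apply/negP => /(irr_weight_Pi irr hv).
Qed.

Lemma slch_mul mu nu z : dominant mu -> dominant nu ->
  (gmul (ch mu) (ch nu))@_z = (weight_mult (sltens (V mu) (V nu)) z)%:Z.
Proof.
move=> dmu dnu; have [imu [v hv]] := weyl_highest_vec dmu.
have [inu [v' hv']] := weyl_highest_vec dnu.
have [r [B [w [wB fB _ _]]]] := irr_weight_basis imu hv.
have [r' [B' [w' [wB' fB' _ _]]]] := irr_weight_basis inu hv'.
rewrite gmulE (tens_mult z wB fB wB' fB').
have mE x : (ch mu)@_x = \sum_a (w a == x)%:R.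
  rewrite /= slchE // (wt_rows_mult x wB fB) -sum1_card -natz natr_sum big_mkcond.
  by apply: eq_bigr => a _; rewrite inE; case: eqP.
have mE' x : (ch nu)@_x = \sum_b (w' b == x)%:R.
  rewrite /= slchE // (wt_rows_mult x wB' fB') -sum1_card -natz natr_sum big_mkcond.
  by apply: eq_bigr => a _; rewrite inE; case: eqP.
rewrite -sum1_card -natz natr_sum [RHS]big_mkcond /=.
transitivity (\sum_a \sum_b ((w a + w' b == z)%:R : int)); last first.
  by rewrite pair_bigA /=; apply: eq_bigr => -[a b] _; rewrite inE; case: eqP.
transitivity (\sum_(x <- msupp (ch mu)) \sum_a (w a == x)%:R * (ch nu)@_(z - x)).
  by apply: eq_bigr => x _; rewrite mE mulr_suml.
rewrite exchange_big; apply: eq_bigr => a _ /=.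
have wa : w a \in msupp (ch mu).
  rewrite -mcoeff_neq0 mE (bigD1 a) //= eqxx -natr_sum -natrD pnatr_eq0 add1n //.
rewrite (bigD1_seq _ wa) ?fset_uniq //= big1 => [|x xa]; last first.
  by rewrite eq_sym (negbTE xa) mul0r.
rewrite eqxx mul1r addr0 mE'; apply: eq_bigr => b _.
by rewrite [w a + _]addrC; congr (nat_of_bool _)%:R; apply/eqP/eqP => [->|<-];
  rewrite ?subrK ?addrK.
Qed.

(** A single decomposition of the tensor product gives all multiplicities, and
    comparing characters shows that they are the structure constants. *)
Lemma weyl_tens_coefs mu nu : dominant mu -> dominant nu ->
  exists c : weight l -> nat,
    (forall lam, dominant lam ->
      is_multiplicity (V lam) (sltens (V mu) (V nu)) (c lam)) /\
    product_coefs ch mu nu (fun lam => (c lam)%:Z).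
Proof.
move=> dmu dnu; have [imu [v hv]] := weyl_highest_vec dmu.
have [inu [v' hv']] := weyl_highest_vec dnu.
have uT := unitarizable_tens (weyl_module_unitarizable imu hv) (weyl_module_unitarizable
  inu hv').
have [k [S [P decP]]] := unitarizable_decomposition uT.
have [irr homP ffP] := decP.
have /choice[hw hwP] : forall a, exists lam, exists u, @highest_vec C l (S a) lam u.
  by move=> a; have [d0 _] := irr a; apply: highest_vec_exists.
have dhw a : dominant (hw a) by have [u] := hwP a; apply: highest_vec_dominant.
have isoE lam a : dominant lam -> `[< sliso (S a) (V lam) >] = (hw a == lam).
  move=> dl; have [u hu] := hwP a; apply/asboolP/eqP => [iso|<-]; last exact: weyl_iso hu.
  have [u' hu'] := sliso_highest_vec iso hu; have [il [w hw']] := weyl_highest_vec dl.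
  exact: irr_highest_weight_unique il hu' hw'.
have multS a x : weight_mult (S a) x = weight_mult (V (hw a)) x.
  by apply: sliso_weight_mult; have [u hu] := hwP a; apply: weyl_iso hu.
have hwPP a : PiPlus (mu + nu) (hw a).
  apply/PiPlusP; split; first exact: dhw.
  have [r [B [w [wB fB wle _]]]] := irr_weight_basis imu hv.
  have [r' [B' [w' [wB' fB' wle' _]]]] := irr_weight_basis inu hv'.
  have : (0 < weight_mult (sltens (V mu) (V nu)) (hw a))%N.
    rewrite (decomposition_mult decP) (bigD1 a) //= multS.
    by have [il [u hu]] := weyl_highest_vec (dhw a); have [->] := irr_weight_top il hu.
  rewrite (tens_mult _ wB fB wB' fB') card_gt0 => /set0Pn[[b b']]; rewrite inE => /eqP <-.
  exact: root_leD.
exists (fun lam => #|[set a | hw a == lam]%SET|); split.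
  move=> lam dl; exists k, S, P; split=> //.
  by apply: eq_card => a; rewrite !inE isoE.
split; last first.
  move=> lam nP; apply/eqP; rewrite eqz_nat cards_eq0; apply/eqP/setP => a; rewrite !inE.
  by apply/negP => /eqP e; apply: nP; rewrite -e.
apply/malgP => z; rewrite slch_mul // (decomposition_mult decP).
rewrite fsum_PiPlus [RHS]raddf_sum /=.
transitivity (\sum_(lam <- PiPlus_fset (mu + nu)) \sum_a (hw a == lam)%:R * (ch lam)@_z).
  rewrite [RHS]exchange_big -[LHS]natz natr_sum; apply: eq_bigr => a _ /=.
  have hin : hw a \in PiPlus_fset (mu + nu) by rewrite in_PiPlus_fset; apply/asboolP.
  rewrite (bigD1_seq _ hin) ?fset_uniq //= big1 => [|x xa]; last first.
    by rewrite eq_sym (negbTE xa) mul0r.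
  by rewrite eqxx mul1r addr0 slchE // multS natz.
apply: eq_bigr => lam _; rewrite mcoeffZ -mulr_suml; congr (_ * _).
rewrite -sum1_card -[RHS]natz natr_sum [RHS]big_mkcond.
by apply: eq_bigr => a _; rewrite inE; case: eqP.
Qed.

Lemma multiplicity_sym lam mu nu c c' : dominant lam -> dominant mu -> dominant nu ->
  is_multiplicity (V lam) (sltens (V mu) (V nu)) c ->
  is_multiplicity (V mu) (sltens (V lam) (V (dual_weight nu))) c' -> c = c'.
Proof.
move=> dl dm dn m m'; have [il _] := weyl_highest_vec dl;
  have [im _] := weyl_highest_vec dm.
have dual_iso eta : dominant eta -> sliso (V (dual_weight eta)) (sldual (V eta)).
  move=> de; have [ie [v hv]] := weyl_highest_vec de;
    have [u hu] := dual_highest_vec ie hv.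
  by apply: sliso_sym; apply: weyl_iso hu;
    [apply: dual_weight_dominant | apply: dual_irr].
apply/eqP; rewrite eqn_leq (multiplicity_le il im (dual_iso nu dn) m m') /=.
have := dual_iso _ (dual_weight_dominant dn); rewrite dual_weightK => iso.
exact: (multiplicity_le im il iso m' m).
Qed.

Lemma eq_product_coefs (f g : weight l -> gring l) mu nu (c : weight l -> int) :
  (forall lam, dominant lam -> f lam = g lam) -> dominant mu -> dominant nu ->
  product_coefs f mu nu c -> product_coefs g mu nu c.
Proof.
move=> fg dmu dnu [e z]; split=> //; rewrite -!fg // e; apply: eq_fsbigr => lam.
by rewrite inE => -[_ dl]; rewrite fg.
Qed.

(** The last two assertions of the main result, over any algebraically closed
    field with conjugation. *)
Theorem littlewood_richardson_uniqueness (l_gt0 : (0 < l)%N) (f : weight l -> gring l)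
    (n : weight l -> weight l -> weight l -> int) : unitriangular f ->
  (forall mu nu, dominant mu -> dominant nu -> product_coefs f mu nu (n mu nu)) ->
  (forall lam mu, dominant lam -> PiPlus lam mu ->
    forall k : 'I_l -> int, lam - mu = \sum_i k i *: sroot i -> (#|Supp k| < l)%N ->
    (f lam)@_mu = (weight_mult (V lam) mu)%:Z) ->
  (forall lam mu nu, dominant lam -> dominant mu -> dominant nu ->
    n mu nu lam = n lam (dual_weight nu) mu) ->
  (forall lam, dominant lam -> f lam = slch lam (V lam)) /\
  (forall lam mu nu, dominant lam -> dominant mu -> dominant nu ->
    exists2 c : nat, is_multiplicity (V lam) (sltens (V mu) (V nu)) c & n mu nu lam =
      c%:Z).
Proof.
move=> uf fn fV n_sym.
(* The hypotheses go below the existential, so that choice applies. *)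
have cE mu nu : exists c : weight l -> nat, dominant mu -> dominant nu ->
    (forall lam, dominant lam ->
      is_multiplicity (V lam) (sltens (V mu) (V nu)) (c lam)) /\
    product_coefs ch mu nu (fun lam => (c lam)%:Z).
  have [[dmu dnu]|nd] := pselect (dominant mu /\ dominant nu).
    by have [c cP] := weyl_tens_coefs dmu dnu; exists c.
  by exists (fun=> 0%N) => dmu dnu; case: nd.
have /choice[c cP] : forall p : weight l * weight l, exists c : weight l -> nat,
    dominant p.1 -> dominant p.2 ->
    (forall lam, dominant lam ->
      is_multiplicity (V lam) (sltens (V p.1) (V p.2)) (c lam)) /\
    product_coefs ch p.1 p.2 (fun lam => (c lam)%:Z) by move=> p; apply: cE.
have fch lam : dominant lam -> f lam = slch lam (V lam).
  apply: (structure_constants_determine (f := f) (g := ch) (n := n)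
    (c := fun mu nu lam => (c (mu, nu) lam)%:Z) l_gt0 uf slch_unitriangular fn) => //.
  - by move=> mu nu dmu dnu; have [] := cP (mu, nu) dmu dnu.
  - move=> {}lam mu nu dl dmu dnu; congr (_%:Z).
    have [/(_ _ dl) m1 _] := cP (mu, nu) dmu dnu.
    have [/(_ _ dmu) m2 _] := cP (lam, dual_weight nu) dl (dual_weight_dominant dnu).
    exact: multiplicity_sym m1 m2.
  - move=> {}lam mu dl dmu le [i ri]; rewrite /= slchE //; have [k kE] := le.
    apply: (fV _ _ dl _ (fun i => (k i)%:Z)); first exact/PiPlusP.
      by rewrite kE; apply: eq_bigr => j _; rewrite -scaler_nat natz.
    have k0 : k i = 0%N by move: ri; rewrite kE rootcoef_sum => -[/eqP];
      rewrite muln_eq0 => /eqP.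
    rewrite -[X in (_ < X)%N]card_ord -cardsT; apply: proper_card; apply/properP.
    by split; [apply/fintype.subsetP | exists i; rewrite !inE // k0].
split=> // lam mu nu dl dmu dnu.
have [/(_ _ dl) m pc] := cP (mu, nu) dmu dnu; exists (c (mu, nu) lam) => //.
have pn := eq_product_coefs fch dmu dnu (fn _ _ dmu dnu).
have [d [_ du]] := product_coef_exists slch_unitriangular dmu dnu.
by rewrite -(du _ pn) (du _ pc).
Qed.

End WeylModules.

Theorem theorem3p1 (R : realType) (l : nat) (l_gt0 : (0 < l)%N)
    (V : weight l -> slrep (complex R) l)
    (V_weyl : forall lam, dominant lam -> is_weyl_module lam (V lam))
    (f : weight l -> gring l) (f_adapted : adapted_family f) :
  [/\ invariant_basis f,
      forall mu nu, dominant mu -> dominant nu ->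
        exists! c : weight l -> int, product_coefs f mu nu c &
      forall n : weight l -> weight l -> weight l -> int,
        (forall mu nu, dominant mu -> dominant nu ->
          product_coefs f mu nu (n mu nu)) ->
        (forall lam mu, dominant lam -> PiPlus lam mu ->
          forall k : 'I_l -> int, lam - mu = \sum_i k i *: sroot i ->
          (#|Supp k| < l)%N ->
          (f lam)@_mu = (weight_mult (V lam) mu)%:Z) ->
        (forall lam mu nu, dominant lam -> dominant mu -> dominant nu ->
          n mu nu lam = n lam (- weyl_act (longest l) nu) mu) ->
        (forall lam, dominant lam -> f lam = slch lam (V lam)) /\
        (forall lam mu nu, dominant lam -> dominant mu -> dominant nu ->
          exists2 c : nat,
            is_multiplicity (V lam) (sltens (V mu) (V nu)) c &
            n mu nu lam = c%:Z)].
Proof.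
have uf := adapted_unitriangular f_adapted; split.
- exact: unitriangular_basis.
- by move=> mu nu; apply: product_coef_exists.
move=> n fn fV n_sym.
exact: (@littlewood_richardson_uniqueness (complex R) l V V_weyl l_gt0 f n uf fn fV
  n_sym).
Qed.
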